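(* Let $L$ be either $\mathbb{Q}_p$ or a finite field extension of $\mathbb{Q}_p$, and let $K$ be one of the fields $L,\ L((t_1)),\ L((t_1))((t_2)),\ L((t_1))((t_2))((t_3))$, and so on. Then $K_0(K,\mathcal{L}_{\rm ring})=0$ and there exists an $\mathcal{L}_{\rm ring}$-definable bijection $K\to K^\times$.
   Context: $\mathcal{L}_{\rm ring}=(+,-,\cdot,0,1)$ and $K^\times=K\setminus\{0\}$. Definable means definable with parameters. Iterated Laurent series fields are defined by induction: $L((t_1))$ is the field of formal Laurent series in $t_1$ over $L$, and $L((t_1))\ldots((t_n))$ is the field of formal Laurent series in $t_n$ over $L((t_1))\ldots((t_{n-1}))$. Grothendieck ring: for a structure $(M,\mathcal{L})$, $K_0(M,\mathcal{L})$ is the abelian group generated by symbols $[A]$, for $A$ an $\mathcal{L}$-definable subset of some $M^n$, $n>0$, with relations $[A]=[A']$ if there is an $\mathcal{L}$-definable bijection $A\to A'$, and $[A]=[B]+[C]$ if $A$ is the disjoint union of the definable sets $B$ and $C$; multiplication is induced by $[A][B]=[A\times B]$. *)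

(* Defs.v *)
From HB Require Import structures.
From mathcomp Require Import all_boot all_order all_algebra all_field.
From mathcomp Require Import boolp classical_sets functions cardinality fsbigop.
From mathcomp Require Import ring_quotient freeg.
From mathcomp Require Import zify.

Set Implicit Arguments.
Unset Strict Implicit.
Unset Printing Implicit Defensive.

Import Order.TTheory GRing.Theory Num.Theory.

Local Open Scope ring_scope.
Local Open Scope classical_set_scope.

(* Z_p as the inverse limit of the rings Z/p^n: an element is a sequence      *)
(* of residues, the n-th one being the representative in [0, p^n) of a class  *)
(* modulo p^n. Primality of p is an argument of the type because the domain   *)
(* structure depends on it.                                                   *)
Record padic_int (p : nat) (p_pr : prime p) := PadicInt {
  residue :> nat -> int;
  residue_compat : forall n, residue n = (residue n.+1 %% (p ^ n)%N)%Z
}.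


Section PadicInt.
Variables (p : nat) (p_pr : prime p).
Local Notation Zp := (padic_int p_pr).
Local Notation q n := ((p ^ n)%N%:Z).
Implicit Types x y z : Zp.

HB.instance Definition _ := gen_eqMixin Zp.
HB.instance Definition _ := gen_choiceMixin Zp.

Fact padic_int_ext x y : (forall n, x n = y n) -> x = y.
Proof.
case: x y => [x hx] [y hy] /= /funext exy; rewrite exy in hx *.
by congr PadicInt; apply: Prop_irrelevance.
Qed.

Fact residue_mod x n : (x n %% q n)%Z = x n.
Proof. by rewrite {1}residue_compat modz_mod -residue_compat. Qed.

Fact modz_pow (a : int) n : ((a %% q n.+1)%Z %% q n)%Z = (a %% q n)%Z.
Proof. by rewrite [in RHS](divz_eq a (q n.+1)) expnS PoszM mulrA modzMDl. Qed.

Fact padic_int_subproof (u : nat -> int)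
    (hu : forall n, (u n = u n.+1 %[mod q n])%Z) n :
  (u n %% q n)%Z = ((u n.+1 %% q n.+1)%Z %% q n)%Z.
Proof. by rewrite modz_pow. Qed.

Definition padic_int_of (u : nat -> int)
    (hu : forall n, (u n = u n.+1 %[mod q n])%Z) : Zp :=
  PadicInt p_pr (padic_int_subproof hu).

Fact residue_step x n : (x n = x n.+1 %[mod q n])%Z.
Proof. by rewrite {1}residue_compat modz_mod. Qed.

Fact padic_const_subproof (a : int) n : (a = a %[mod q n])%Z.
Proof. by []. Qed.
Definition padic_const (a : int) : Zp :=
  padic_int_of (padic_const_subproof a).

Fact padic_opp_subproof x n : (- x n = - x n.+1 %[mod q n])%Z.
Proof. by rewrite -[LHS]modzNm residue_step modzNm. Qed.
Definition padic_opp x := padic_int_of (padic_opp_subproof x).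

Fact padic_add_subproof x y n :
  (x n + y n = x n.+1 + y n.+1 %[mod q n])%Z.
Proof. by rewrite -[LHS]modzDm !residue_step modzDm. Qed.
Definition padic_add x y := padic_int_of (padic_add_subproof x y).

Fact padic_mul_subproof x y n :
  (x n * y n = x n.+1 * y n.+1 %[mod q n])%Z.
Proof. by rewrite -[LHS]modzMm !residue_step modzMm. Qed.
Definition padic_mul x y := padic_int_of (padic_mul_subproof x y).

Fact padic_addA : associative padic_add.
Proof. by move=> x y z; apply: padic_int_ext => n /=; rewrite modzDml modzDmr addrA. Qed.
Fact padic_addC : commutative padic_add.
Proof. by move=> x y; apply: padic_int_ext => n /=; rewrite addrC. Qed.
Fact padic_add0 : left_id (padic_const 0) padic_add.
Proof. by move=> x; apply: padic_int_ext => n /=; rewrite modzDml add0r residue_mod. Qed.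
Fact padic_addN : left_inverse (padic_const 0) padic_opp padic_add.
Proof. by move=> x; apply: padic_int_ext => n /=; rewrite modzDml addNr. Qed.
HB.instance Definition _ :=
  GRing.isZmodule.Build Zp padic_addA padic_addC padic_add0 padic_addN.

Fact padic_mulA : associative padic_mul.
Proof. by move=> x y z; apply: padic_int_ext => n /=; rewrite modzMml modzMmr mulrA. Qed.
Fact padic_mulC : commutative padic_mul.
Proof. by move=> x y; apply: padic_int_ext => n /=; rewrite mulrC. Qed.
Fact padic_mul1 : left_id (padic_const 1) padic_mul.
Proof. by move=> x; apply: padic_int_ext => n /=; rewrite modzMml mul1r residue_mod. Qed.
Fact padic_mulDl : left_distributive padic_mul padic_add.
Proof. by move=> x y z; apply: padic_int_ext => n /=; rewrite modzMml modzDm mulrDl. Qed.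
Fact padic_1neq0 : padic_const 1 != 0.
Proof.
apply/eqP => /(congr1 (fun x : Zp => x 1%N)) /=.
by rewrite expn1 mod0z modz_small // ltz_nat prime_gt1.
Qed.
HB.instance Definition _ := GRing.Zmodule_isComNzRing.Build Zp
  padic_mulA padic_mulC padic_mul1 padic_mulDl padic_1neq0.

Definition padic_unit : pred Zp := fun x => `[< exists y, y * x = 1 >].
Definition padic_inv x : Zp := xget x [set y | y * x = 1].

Fact padic_mulVx : {in padic_unit, left_inverse 1 padic_inv *%R}.
Proof.
move=> x; rewrite -[x \in _]/(padic_unit x) => /asboolP [y yx].
by rewrite /padic_inv; case: xgetP => [_ -> //|/(_ y)].
Qed.
Fact padic_unitPl x y : y * x = 1 -> padic_unit x.
Proof. by move=> yx; apply/asboolP; exists y. Qed.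
Fact padic_inv_out : {in [predC padic_unit], padic_inv =1 id}.
Proof.
move=> x; rewrite inE -[x \in _]/(padic_unit x) => /asboolPn nx.
by rewrite /padic_inv; case: xgetP => // y _ yx; case: nx; exists y.
Qed.
HB.instance Definition _ := GRing.ComNzRing_hasMulInverse.Build Zp
  padic_mulVx padic_unitPl padic_inv_out.

Fact residue_le x n k : (x (k + n)%N = x n %[mod q n])%Z.
Proof.
elim: k => [|k IH] //; rewrite addSn -IH.
apply/eqP; rewrite eqz_mod_dvd; apply: (@dvdz_trans (q (k + n))).
  by rewrite expnD PoszM dvdz_mull.
by rewrite -eqz_mod_dvd; apply/eqP; rewrite -residue_step.
Qed.

Fact residue_neq0 x : x != 0 -> exists n, ~~ (q n %| x n)%Z.
Proof.
move=> x0; apply: contrapT => /forallNP h; case/eqP: x0; apply: padic_int_ext => n /=.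
rewrite mod0z -[LHS]residue_mod; apply/eqP.
by have /negP/negPn/dvdz_mod0P -> := h n.
Qed.

Fact padic_domain : GRing.integral_domain_axiom Zp.
Proof.
move=> x y xy0; apply: contraT; rewrite negb_or => /andP[x0 y0].
have [m xm] := residue_neq0 x0; have [n yn] := residue_neq0 y0.
have dvd_le (z : Zp) k l : (q k %| z (l + k)%N)%Z = (q k %| z k)%Z.
  by apply/idP/idP => /dvdz_mod0P h; apply/dvdz_mod0P; rewrite -h residue_le.
have /dvdz_mod0P : ((x (m + n)%N * y (m + n)%N) %% q (m + n))%Z = 0.
  by have := congr1 (fun z : Zp => z (m + n)%N) xy0; rewrite /= mod0z.
rewrite -(dvd_le y n m) in yn; rewrite -(dvd_le x m n) addnC in xm.
move: (x (m + n)%N) (y (m + n)%N) xm yn => a b; rewrite !dvdzE abszM !absz_nat.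
move: `|a|%N `|b|%N => {}a {}b.
case: a => [|a]; first by rewrite dvdn0.
case: b => [|b]; first by rewrite dvdn0.
rewrite !pfactor_dvdn // lognM // -!ltnNge => ha hb.
by rewrite leqNgt -addSn leq_add // ltnW.
Qed.
HB.instance Definition _ := GRing.ComUnitRing_isIntegral.Build Zp padic_domain.

End PadicInt.

Definition padic (p : nat) (p_pr : prime p) := {fraction padic_int p_pr}.
HB.instance Definition _ p (p_pr : prime p) := GRing.Field.on (padic p_pr).

(* F((t)): the value at i : int is the coefficient of t^i.                   *)
Record laurent (F : fieldType) := Laurent {
  lcoef :> int -> F;
  lcoef_bounded : exists v : int, forall i : int, i < v -> lcoef i = 0
}.

Section CauchyProduct.
Variable F : fieldType.
Implicit Types f g h : nat -> F.

Definition cauchy f g n : F := \sum_(i < n.+1) f i * g (n - i)%N.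

Fact cauchy_poly f g n N : (n < N)%N ->
  cauchy f g n = (\poly_(i < N) f i * \poly_(i < N) g i)`_n.
Proof.
move=> nN; rewrite coefM; apply: eq_bigr => i _; rewrite !coef_poly.
by rewrite (leq_ltn_trans _ nN) ?(leq_ltn_trans (leq_subr _ _) nN) // -ltnS.
Qed.

Fact cauchyC f g n : cauchy f g n = cauchy g f n.
Proof. by rewrite !(@cauchy_poly _ _ _ n.+1) // mulrC. Qed.

Fact cauchyA f g h n : cauchy f (cauchy g h) n = cauchy (cauchy f g) h n.
Proof.
have E u v : forall i, (i < n.+1)%N ->
    (\poly_(i < n.+1) cauchy u v i)`_i
    = (\poly_(i < n.+1) u i * \poly_(i < n.+1) v i)`_i.
  by move=> i ni; rewrite coef_poly ni (cauchy_poly _ _ ni).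
rewrite !(@cauchy_poly _ _ _ n.+1) //.
transitivity (\poly_(i < n.+1) f i * (\poly_(i < n.+1) g i * \poly_(i < n.+1) h i))`_n.
  by rewrite 2!coefM; apply: eq_bigr => i _; rewrite E // ltnS leq_subr.
by rewrite mulrA [LHS]coefM [RHS]coefM; apply: eq_bigr => i _; rewrite E.
Qed.

Fact cauchy_inv f : f 0%N != 0 -> exists g, forall n, cauchy g f n = (n == 0)%N%:R.
Proof.
move=> f0.
pose step (s : seq F) := rcons s
  (((size s == 0)%N%:R - \sum_(i < size s) s`_i * f (size s - i)%N) / f 0%N).
pose w n := iter n step [::].
have sw n : size (w n) = n by elim: n => //= n; rewrite size_rcons => ->.
have wS n k : (k < n)%N -> (w n.+1)`_k = (w n)`_k.
  by move=> kn; rewrite /= nth_rcons sw kn.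
have wE n k : (k < n)%N -> (w n)`_k = (w k.+1)`_k.
  move=> kn; rewrite -(subnK kn); elim: (n - k.+1)%N => // m <-.
  by rewrite addSn wS // ltn_addl.
exists (fun n => (w n.+1)`_n) => n; rewrite /cauchy big_ord_recr /= subnn.
rewrite -[_`_n in X in _ + X]/((w n.+1)`_n) /= nth_rcons sw ltnn eqxx divfK //.
set S := (X in X + _); set T := (X in _ + (_ - X)).
suff -> : S = T by rewrite addrC subrK.
by apply: eq_bigr => i _; rewrite -(@wE n).
Qed.
End CauchyProduct.

Section Laurent.
Variable F : fieldType.
Local Notation LF := (laurent F).
Implicit Types f g h : LF.

HB.instance Definition _ := gen_eqMixin LF.
HB.instance Definition _ := gen_choiceMixin LF.

Fact laurent_ext f g : (forall i, f i = g i) -> f = g.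
Proof.
case: f g => [f hf] [g hg] /= /funext e; rewrite e in hf *.
by congr Laurent; apply: Prop_irrelevance.
Qed.

Fact laurent_zero_subproof : exists v : int, forall i, i < v -> (0 : F) = 0.
Proof. by exists 0. Qed.
Definition laurent_zero : LF := Laurent laurent_zero_subproof.

Fact laurent_one_subproof :
  exists v : int, forall i, i < v -> (i == 0)%:R = 0 :> F.
Proof. by exists 0 => i /lt_eqF ->. Qed.
Definition laurent_one : LF := Laurent laurent_one_subproof.

Fact laurent_opp_subproof f : exists v : int, forall i, i < v -> - f i = 0.
Proof. by have [v fv] := lcoef_bounded f; exists v => i /fv ->; rewrite oppr0. Qed.
Definition laurent_opp f : LF := Laurent (laurent_opp_subproof f).

Fact laurent_bounded2 f g :
  exists v : int, forall i, i < v -> f i = 0 /\ g i = 0.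
Proof.
have [[v fv] [w gw]] := (lcoef_bounded f, lcoef_bounded g).
by exists (Num.min v w) => i; rewrite lt_min => /andP[/fv -> /gw ->].
Qed.

Fact laurent_add_subproof f g :
  exists v : int, forall i, i < v -> f i + g i = 0.
Proof.
have [v fgv] := laurent_bounded2 f g.
by exists v => i /fgv[-> ->]; rewrite addr0.
Qed.
Definition laurent_add f g : LF := Laurent (laurent_add_subproof f g).

(* The sum over i in Z has finite support by boundedness of f and g below.    *)
Definition laurent_conv f g (n : int) : F :=
  (\sum_(i \in [set: int]) f i * g (n - i))%R.

Fact laurent_conv0 f g (v w n : int) :
  (forall i, i < v -> f i = 0) -> (forall i, i < w -> g i = 0) ->
  n < v + w -> laurent_conv f g n = 0.
Proof.
move=> fv gw nvw; apply: fsbig1 => i _.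
have [/fv -> | vi] := ltP i v; first by rewrite mul0r.
by rewrite gw ?mulr0 //; lia.
Qed.

Fact laurent_convE f g (v w : int) (n : nat) :
  (forall i, i < v -> f i = 0) -> (forall i, i < w -> g i = 0) ->
  laurent_conv f g (v + w + n%:Z)
  = cauchy (fun i => f (v + i%:Z)) (fun i => g (w + i%:Z)) n.
Proof.
move=> fv gw; rewrite /laurent_conv /cauchy.
under [RHS]eq_bigr => i _.
  have -> : w + (n - i)%N%:Z = v + w + n%:Z - (v + i%:Z) by have := ltn_ord i; lia.
  over.
pose F' i := f i * g (v + w + n%:Z - i).
rewrite [RHS](@fsbig_ord _ _ _ n.+1 (fun i => F' (v + i%:Z))).
rewrite -(@fsbig_image _ _ _ _ _ _ (fun i : nat => v + i%:Z) F'); last first.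
  by move=> i j _ _ /addrI [].
apply/esym; apply: fsbig_widen => // i [_ /= ni].
rewrite /F'; have [/fv -> | vi] := ltP i v; first by rewrite mul0r.
rewrite gw ?mulr0 //; have [|] := leP (i - v) n; last by lia.
move=> lei; case: ni; exists `|i - v|%N; rewrite /=; lia.
Qed.

Fact laurent_mul_subproof f g :
  exists v : int, forall i, i < v -> laurent_conv f g i = 0.
Proof.
have [[v fv] [w gw]] := (lcoef_bounded f, lcoef_bounded g).
by exists (v + w) => i; apply: laurent_conv0.
Qed.
Definition laurent_mul f g : LF := Laurent (laurent_mul_subproof f g).

Fact laurent_addA : associative laurent_add.
Proof. by move=> f g h; apply: laurent_ext => i /=; rewrite addrA. Qed.
Fact laurent_addC : commutative laurent_add.
Proof. by move=> f g; apply: laurent_ext => i /=; rewrite addrC. Qed.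
Fact laurent_add0 : left_id laurent_zero laurent_add.
Proof. by move=> f; apply: laurent_ext => i /=; rewrite add0r. Qed.
Fact laurent_addN : left_inverse laurent_zero laurent_opp laurent_add.
Proof. by move=> f; apply: laurent_ext => i /=; rewrite addNr. Qed.
HB.instance Definition _ := GRing.isZmodule.Build LF
  laurent_addA laurent_addC laurent_add0 laurent_addN.

Fact laurent_ext_from (v : int) f g :
  (forall i, i < v -> f i = 0) -> (forall i, i < v -> g i = 0) ->
  (forall n : nat, f (v + n%:Z) = g (v + n%:Z)) -> f = g.
Proof.
move=> fv gv fg; apply: laurent_ext => i.
have [iv|vi] := ltP i v; first by rewrite fv ?gv.
by have -> : i = v + `|i - v|%N%:Z by lia.
Qed.

Fact laurent_mulA : associative laurent_mul.
Proof.
move=> f g h; have [u fu] := lcoef_bounded f; have [v gv] := lcoef_bounded g.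
have [w hw] := lcoef_bounded h.
have fg0 i : i < u + v -> laurent_mul f g i = 0 by exact: laurent_conv0.
have gh0 i : i < v + w -> laurent_mul g h i = 0 by exact: laurent_conv0.
apply: (@laurent_ext_from (u + v + w)) => [i|i|n].
- by rewrite -addrA; apply: laurent_conv0.
- exact: laurent_conv0.
rewrite -[RHS]/(laurent_conv _ _ _) laurent_convE //.
rewrite -[LHS]/(laurent_conv _ _ _) -[u + v + w]addrA laurent_convE //.
transitivity (cauchy (fun i => f (u + i%:Z)) (cauchy (fun i => g (v + i%:Z)) (fun i => h (w + i%:Z))) n).
  by apply: eq_bigr => i _; rewrite -[laurent_mul _ _ _]/(laurent_conv _ _ _) laurent_convE.
rewrite cauchyA.
by apply: eq_bigr => i _; rewrite -[laurent_mul _ _ _]/(laurent_conv _ _ _) laurent_convE.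
Qed.

Fact laurent_mulC : commutative laurent_mul.
Proof.
move=> f g; have [u fu] := lcoef_bounded f; have [v gv] := lcoef_bounded g.
apply: (@laurent_ext_from (u + v)) => [i|i|n]; first exact: laurent_conv0.
  by rewrite addrC; apply: laurent_conv0.
rewrite -[LHS]/(laurent_conv _ _ _) -[RHS]/(laurent_conv _ _ _).
by rewrite laurent_convE // [u + v]addrC laurent_convE // cauchyC.
Qed.

Fact laurent_mulDl : left_distributive laurent_mul laurent_add.
Proof.
move=> f g h; have [u fgu] := laurent_bounded2 f g.
have [v hv] := lcoef_bounded h.
have fu i : i < u -> f i = 0 by move=> /fgu[].
have gu i : i < u -> g i = 0 by move=> /fgu[].
have fgu' i : i < u -> laurent_add f g i = 0.
  by move=> iu; rewrite /= fu ?gu ?addr0.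
apply: (@laurent_ext_from (u + v)) => [i iuv|i iuv|n] /=.
- exact: laurent_conv0 fgu' hv _.
- by rewrite !(@laurent_conv0 _ _ u v) ?addr0.
rewrite !laurent_convE // -big_split /=.
by apply: eq_bigr => i _; rewrite mulrDl.
Qed.

Fact laurent_mul1 : left_id laurent_one laurent_mul.
Proof.
move=> f; have [v fv] := lcoef_bounded f.
have one0 i : i < 0 -> laurent_one i = 0 by move=> /lt_eqF /= ->.
apply: (laurent_ext_from _ fv) => [i iv|n].
  by apply: (laurent_conv0 one0 fv); rewrite add0r.
rewrite -[LHS]/(laurent_conv _ _ _) -{1}[v]add0r laurent_convE //.
rewrite /cauchy big_ord_recl /= subn0 mul1r big1 ?addr0 // => i _.
by rewrite [X in X * _](_ : _ = 0) ?mul0r.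
Qed.

Fact laurent_one_neq0 : laurent_one != 0.
Proof.
by apply/eqP => /(congr1 (fun f : LF => f 0)) /= /eqP; rewrite oner_eq0.
Qed.

HB.instance Definition _ := GRing.Zmodule_isComNzRing.Build LF
  laurent_mulA laurent_mulC laurent_mul1 laurent_mulDl laurent_one_neq0.

Definition laurent_inv f : LF := xget 0 [set g | g * f = 1].

Fact laurent_exists_inv f : f != 0 -> exists g : LF, g * f = 1.
Proof.
move=> f0; have [v fv] := lcoef_bounded f.
have ex_n : exists n : nat, f (v + n%:Z) != 0.
  apply: contrapT => /forallNP h; case/eqP: f0.
  by apply: (laurent_ext_from fv) => // n; apply/eqP/negPn/negP/h.
have [n nP nmin] := ex_minnP ex_n.
pose u : int := v + n%:Z.
have fu i : i < u -> f i = 0.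
  move=> iu; have [/fv //|vi] := ltP i v.
  have e : i = v + `|i - v|%N%:Z by lia.
  by apply/eqP; rewrite e; apply: contraT => /nmin; lia.
have fu0 : f (u + 0%N%:Z) != 0 by rewrite addr0.
have [w wP] := @cauchy_inv F (fun i => f (u + i%:Z)) fu0.
pose wz (i : int) : F := if - u <= i then w (absz (i + u)) else 0.
have wzb : exists v : int, forall i, i < v -> wz i = 0.
  by exists (- u) => i; rewrite ltNge /wz => /negbTE ->.
exists (Laurent wzb).
apply: (@laurent_ext_from (- u + u)) => [i|i|k].
- by apply: laurent_conv0 => // j; rewrite ltNge /= /wz => /negbTE ->.
- by rewrite addNr => /lt_eqF /= ->.
rewrite -[LHS]/(laurent_conv _ _ _) laurent_convE //; last first.
  by move=> j; rewrite ltNge /= /wz => /negbTE ->.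
rewrite addNr add0r /= -[RHS]wP; apply: eq_bigr => i _; congr (_ * _).
rewrite /= /wz; have -> : - u <= - u + i%:Z by lia.
by congr w; lia.
Qed.

Fact laurent_mulVf f : f != 0 -> laurent_inv f * f = 1.
Proof.
move=> /laurent_exists_inv [g gf].
by rewrite /laurent_inv; case: xgetP => [_ -> //|/(_ g)].
Qed.

Fact laurent_inv0 : laurent_inv 0 = 0.
Proof.
rewrite /laurent_inv; case: xgetP => // g _ /= /eqP.
by rewrite mulr0 eq_sym oner_eq0.
Qed.

HB.instance Definition _ := GRing.ComNzRing_isField.Build LF
  laurent_mulVf laurent_inv0.
End Laurent.

(* L((t_1))...((t_n)); n = 0 gives L itself. With L : fieldExtType (padic p_pr), *)
(* Q_p is the extension of degree one (padic p_pr)^o.                         *)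
Fixpoint iterated_laurent (L : fieldType) (n : nat) : fieldType :=
  if n is m.+1 then laurent (iterated_laurent L m) else L.

(* The constants of [GRing.formula K] are the elements of K, so a formula     *)
(* carries its own parameters; [GRing.rformula] confines it to the language   *)
(* (+, -, *, 0, 1), excluding the inverse and the unit predicate.             *)
Definition definable (K : fieldType) n (A : set (n.-tuple K)) : Prop :=
  exists2 phi : GRing.formula K, GRing.rformula phi &
    forall x : n.-tuple K, A x <-> GRing.holds x phi.

Definition definable_fun (K : fieldType) m n (A : set (m.-tuple K))
    (f : m.-tuple K -> n.-tuple K) : Prop :=
  definable [set [tuple of x ++ f x] | x in A].

Definition definable_bijection (K : fieldType) m n
    (A : set (m.-tuple K)) (B : set (n.-tuple K)) : Prop :=
  exists2 f : m.-tuple K -> n.-tuple K, set_bij A B f & definable_fun A f.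

Record defset (K : fieldType) n := Defset {
  defset_set :> set (n.-tuple K);
  defset_definable : definable defset_set
}.

Section Definability.
Variable K : fieldType.

HB.instance Definition _ n := gen_eqMixin (defset K n).
HB.instance Definition _ n := gen_choiceMixin (defset K n).

Fact defset_ext n (A B : defset K n) : (A : set _) = B -> A = B.
Proof.
case: A B => [A hA] [B hB] /= e; rewrite e in hA *.
by congr Defset; apply: Prop_irrelevance.
Qed.

(* Substitution: free variables are sent through r (None standing for the     *)
(* constant 0) and bound variables are renamed to N, N+1, ...                 *)
Fixpoint tren (r : nat -> option nat) (t : GRing.term K) : GRing.term K :=
  match t with
  | GRing.Var i => if r i is Some j then GRing.Var K j else GRing.NatConst K 0
  | GRing.Const x => GRing.Const x
  | GRing.NatConst n => GRing.NatConst K n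
  | GRing.Add t1 t2 => GRing.Add (tren r t1) (tren r t2)
  | GRing.Opp t1 => GRing.Opp (tren r t1)
  | GRing.NatMul t1 n => GRing.NatMul (tren r t1) n
  | GRing.Mul t1 t2 => GRing.Mul (tren r t1) (tren r t2)
  | GRing.Inv t1 => GRing.Inv (tren r t1)
  | GRing.Exp t1 n => GRing.Exp (tren r t1) n
  end.

Definition rupd (r : nat -> option nat) (i N : nat) (j : nat) : option nat :=
  if j == i then Some N else r j.

Fixpoint fren (r : nat -> option nat) (N : nat) (f : GRing.formula K) :=
  match f with
  | GRing.Bool b => GRing.Bool b
  | GRing.Equal t1 t2 => GRing.Equal (tren r t1) (tren r t2)
  | GRing.Unit t1 => GRing.Unit (tren r t1)
  | GRing.And f1 f2 => GRing.And (fren r N f1) (fren r N f2)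
  | GRing.Or f1 f2 => GRing.Or (fren r N f1) (fren r N f2)
  | GRing.Implies f1 f2 => GRing.Implies (fren r N f1) (fren r N f2)
  | GRing.Not f1 => GRing.Not (fren r N f1)
  | GRing.Exists i f1 => GRing.Exists N (fren (rupd r i N) N.+1 f1)
  | GRing.Forall i f1 => GRing.Forall N (fren (rupd r i N) N.+1 f1)
  end.

Fact tren_rterm r t : GRing.rterm (tren r t) = GRing.rterm t.
Proof. by elim: t => //= [i|t1 -> t2 ->|t1 -> t2 ->] //; case: (r i). Qed.

Fact fren_rformula r N f : GRing.rformula (fren r N f) = GRing.rformula f.
Proof.
by elim: f r N => //= [t1 t2 r _|f1 h1 f2 h2 r N|f1 h1 f2 h2 r N|f1 h1 f2 h2 r N];
  rewrite ?tren_rterm ?h1 ?h2.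
Qed.

Fact eval_tren (r : nat -> option nat) (e e' : seq K) t :
  (forall i, e'`_i = oapp (nth 0 e) 0 (r i)) ->
  GRing.eval e (tren r t) = GRing.eval e' t.
Proof.
move=> he; elim: t => //= [i|t1 -> t2 ->|t1 ->|t1 -> n|t1 -> t2 ->|t1 ->|t1 -> n] //.
by rewrite he; case: (r i).
Qed.

Fact holds_fren r N (e e' : seq K) f :
  (forall i, e'`_i = oapp (nth 0 e) 0 (r i)) ->
  (forall i j, r i = Some j -> (j < N)%N) ->
  GRing.holds e (fren r N f) <-> GRing.holds e' f.
Proof.
elim: f r N e e' => //=.
- by move=> t1 t2 r N e e' he hr; rewrite !(@eval_tren r e e').
- by move=> t1 r N e e' he hr; rewrite !(@eval_tren r e e').
- by move=> f1 h1 f2 h2 r N e e' he hr; rewrite (h1 r N e e') // (h2 r N e e').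
- by move=> f1 h1 f2 h2 r N e e' he hr; rewrite (h1 r N e e') // (h2 r N e e').
- by move=> f1 h1 f2 h2 r N e e' he hr; rewrite (h1 r N e e') // (h2 r N e e').
- by move=> f1 h1 r N e e' he hr; rewrite (h1 r N e e').
- move=> i f1 h1 r N e e' he hr.
  suff E x : GRing.holds (set_nth 0 e N x) (fren (rupd r i N) N.+1 f1)
         <-> GRing.holds (set_nth 0 e' i x) f1.
    by split=> -[x /E]; exists x.
  apply: h1 => [j|j k]; rewrite /rupd ?nth_set_nth /=; case: eqP => _ /=.
  + by rewrite nth_set_nth /= eqxx.
  + rewrite he; case E: (r j) => [k|] //=; rewrite nth_set_nth /=.
    by rewrite ltn_eqF // (hr _ _ E).
  + by case=> ->.
  + by move=> /hr /ltnW.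
- move=> i f1 h1 r N e e' he hr.
  suff E x : GRing.holds (set_nth 0 e N x) (fren (rupd r i N) N.+1 f1)
         <-> GRing.holds (set_nth 0 e' i x) f1.
    by split=> h x; apply/E.
  apply: h1 => [j|j k]; rewrite /rupd ?nth_set_nth /=; case: eqP => _ /=.
  + by rewrite nth_set_nth /= eqxx.
  + rewrite he; case E: (r j) => [k|] //=; rewrite nth_set_nth /=.
    by rewrite ltn_eqF // (hr _ _ E).
  + by case=> ->.
  + by move=> /hr /ltnW.
Qed.

Definition tsub m n (s : 'I_m -> 'I_n) (x : n.-tuple K) : m.-tuple K :=
  [tuple tnth x (s i) | i < m].

Fact definable_sub m n (s : 'I_m -> 'I_n) (A : set (m.-tuple K)) :
  definable A -> definable [set x | A (tsub s x)].
Proof.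
case=> f rf hf.
pose r i := omap (fun j : 'I_m => s j : nat) (insub i).
exists (fren r n f); first by rewrite fren_rformula.
move=> x; rewrite /= hf; symmetry; apply: holds_fren => [i|i j]; rewrite /r.
  case: insubP => [k _ <-|im] /=.
    by rewrite (nth_map k) ?size_enum_ord // nth_ord_enum (tnth_nth 0).
  by rewrite nth_default // size_map size_enum_ord leqNgt.
by case: insubP => //= k _ _ [<-].
Qed.

Fact definable_setI n (A B : set (n.-tuple K)) :
  definable A -> definable B -> definable [set x | A x /\ B x].
Proof.
case=> f rf hf [g rg hg]; exists (GRing.And f g) => [|x /=]; first exact/andP.
by rewrite hf hg.
Qed.

Fact definable_true n : definable [set x : n.-tuple K | True].
Proof. by exists (GRing.Bool true). Qed.

Fact definable_coord_eq n (i j : 'I_n) : definable [set x : n.-tuple K | tnth x i = tnth x j].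
Proof.
exists (GRing.Equal (GRing.Var K i) (GRing.Var K j)) => // x /=.
by rewrite !(tnth_nth 0).
Qed.

Fact definable_all n m (P : 'I_m -> set (n.-tuple K)) :
  (forall i, definable (P i)) -> definable [set x | forall i, P i x].
Proof.
elim: m P => [|m IH] P hP.
  rewrite (_ : mkset _ = [set x | True]); first exact: definable_true.
  by apply/seteqP; split=> // x _ [].
rewrite (_ : mkset _ = [set x | P ord0 x /\ (forall i : 'I_m, P (fintype.lift ord0 i) x)]).
  by apply: definable_setI => //; apply: IH.
apply/seteqP; split=> x /= => [h|[h0 h] i]; first by split.
by case: (unliftP ord0 i) => [j|] ->.
Qed.

Definition tl m n (z : (m + n).-tuple K) : m.-tuple K := tsub (lshift n) z.
Definition tr m n (z : (m + n).-tuple K) : n.-tuple K := tsub (@rshift m n) z.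

Fact tl_cat m n (x : m.-tuple K) (y : n.-tuple K) : tl [tuple of x ++ y] = x.
Proof. by apply: eq_from_tnth => i; rewrite tnth_mktuple tnth_lshift. Qed.
Fact tr_cat m n (x : m.-tuple K) (y : n.-tuple K) : tr [tuple of x ++ y] = y.
Proof. by apply: eq_from_tnth => i; rewrite tnth_mktuple tnth_rshift. Qed.
Fact tcatE m n (z : (m + n).-tuple K) : z = [tuple of tl z ++ tr z].
Proof.
apply: eq_from_tnth => i; case: (split_ordP i) => j ->.
  by rewrite tnth_lshift tnth_mktuple.
by rewrite tnth_rshift tnth_mktuple.
Qed.

Fact definable_prod m n (A : set (m.-tuple K)) (B : set (n.-tuple K)) :
  definable A -> definable B ->
  definable [set [tuple of x ++ y] | x in A & y in B].
Proof.
move=> hA hB.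
rewrite (_ : image2 _ _ _ = [set z | A (tl z) /\ B (tr z)]).
  by apply: definable_setI; apply: definable_sub.
apply/seteqP; split=> z /=.
  by move=> [x Ax [y By <-]]; rewrite tl_cat tr_cat.
by move=> [Az Bz]; exists (tl z) => //; exists (tr z) => //; rewrite -tcatE.
Qed.

Fact definable_graph m n (A : set (m.-tuple K)) (f : m.-tuple K -> n.-tuple K) :
  definable [set z | A (tl z) /\ f (tl z) = tr z] -> definable_fun A f.
Proof.
rewrite /definable_fun; congr definable; apply/seteqP; split=> z /=.
  by move=> [Az fz]; exists (tl z) => //; rewrite fz -tcatE.
by move=> [x Ax <-]; rewrite tl_cat tr_cat.
Qed.

Fact graph_definable m n (A : set (m.-tuple K)) (f : m.-tuple K -> n.-tuple K) :
  definable_fun A f -> definable [set z | A (tl z) /\ f (tl z) = tr z].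
Proof.
rewrite /definable_fun; congr definable; apply/seteqP; split=> z /=.
  by move=> [x Ax <-]; rewrite tl_cat tr_cat.
by move=> [Az fz]; exists (tl z) => //; rewrite fz -tcatE.
Qed.

Fact definable_fun_sub m n (A : set (m.-tuple K)) (s : 'I_n -> 'I_m) :
  definable A -> definable_fun A (tsub s).
Proof.
move=> hA; apply: definable_graph; apply: definable_setI.
  exact: definable_sub.
have := @definable_all (m + n) n (fun i => [set z |
  tnth z (lshift n (s i)) = tnth z (rshift m i)])
  (fun i => definable_coord_eq _ _).
congr definable; apply/seteqP; split=> z /=.
  by move=> e; apply: eq_from_tnth => i; rewrite !tnth_mktuple.
by move=> e i; move/(congr1 (fun u : n.-tuple K => tnth u i)): e; rewrite !tnth_mktuple.
Qed.

Definition fprod m1 m2 n1 n2 (f : m1.-tuple K -> n1.-tuple K)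
    (g : m2.-tuple K -> n2.-tuple K) (z : (m1 + m2).-tuple K) :
  (n1 + n2).-tuple K := [tuple of f (tl z) ++ g (tr z)].

Fact definable_bijection_prod m1 m2 n1 n2
    (A1 : set (m1.-tuple K)) (A2 : set (m2.-tuple K))
    (B1 : set (n1.-tuple K)) (B2 : set (n2.-tuple K)) :
  definable_bijection A1 B1 -> definable_bijection A2 B2 ->
  definable_bijection [set [tuple of x ++ y] | x in A1 & y in A2]
                      [set [tuple of x ++ y] | x in B1 & y in B2].
Proof.
case=> f [fAB finj fsurj] df [g [gAB ginj gsurj] dg].
exists (fprod f g).
  split.
  - move=> _ [x Ax [y Ay <-]]; exists (f x); first exact: fAB.
    by exists (g y); [exact: gAB | rewrite /fprod tl_cat tr_cat].
  - move=> u v; rewrite !inE => -[x Ax [y Ay <-]] [x' Ax' [y' Ay' <-]].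
    rewrite /fprod !tl_cat !tr_cat => e.
    have := congr1 (@tl _ _) e; have := congr1 (@tr _ _) e.
    by rewrite !tl_cat !tr_cat => /ginj -> //; rewrite ?inE // => /finj ->; rewrite ?inE.
  - move=> _ [x /fsurj [a Aa <-] [y /gsurj [b Ab <-] <-]].
    exists [tuple of a ++ b]; first by exists a => //; exists b.
    by rewrite /fprod tl_cat tr_cat.
apply: definable_graph.
have {}df := graph_definable df; have {}dg := graph_definable dg.
pose s1 (i : 'I_(m1 + n1)) : 'I_(m1 + m2 + (n1 + n2)) :=
  match fintype.split i with inl a => lshift _ (lshift _ a) | inr a => rshift _ (lshift _ a) end.
pose s2 (i : 'I_(m2 + n2)) : 'I_(m1 + m2 + (n1 + n2)) :=
  match fintype.split i with inl a => lshift _ (rshift _ a) | inr a => rshift _ (rshift _ a) end.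
have := definable_setI (definable_sub s1 df) (definable_sub s2 dg).
congr definable; apply/seteqP.
have E1 z : tl (tsub s1 z) = tl (tl z).
  by apply: eq_from_tnth => i; rewrite !tnth_mktuple /s1 (unsplitK (inl _)).
have E2 z : tr (tsub s1 z) = tl (tr z).
  by apply: eq_from_tnth => i; rewrite !tnth_mktuple /s1 (unsplitK (inr _)).
have E3 z : tl (tsub s2 z) = tr (tl z).
  by apply: eq_from_tnth => i; rewrite !tnth_mktuple /s2 (unsplitK (inl _)).
have E4 z : tr (tsub s2 z) = tr (tr z).
  by apply: eq_from_tnth => i; rewrite !tnth_mktuple /s2 (unsplitK (inr _)).
split=> z /=; rewrite E1 E2 E3 E4.
  move=> [[A1z fz] [A2z gz]]; split.
    by exists (tl (tl z)) => //; exists (tr (tl z)) => //; rewrite -tcatE.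
  by rewrite /fprod fz gz -tcatE.
move=> [[x A1x [y A2y e]]]; rewrite /fprod -e tl_cat tr_cat => <-.
by rewrite tl_cat tr_cat.
Qed.

Fact definable_bijection_refl m (A : set (m.-tuple K)) :
  definable A -> definable_bijection A A.
Proof.
move=> hA; exists (tsub id).
  have E x : tsub id x = x :> m.-tuple K.
    by apply: eq_from_tnth => i; rewrite tnth_mktuple.
  by split=> [x|x y _ _|x Ax]; rewrite ?E //; exists x; rewrite ?E.
exact: definable_fun_sub.
Qed.

Fact definable_bijection_sub m n (A : set (m.-tuple K)) (B : set (n.-tuple K))
    (s : 'I_n -> 'I_m) (t : 'I_m -> 'I_n) :
  definable A -> cancel s t -> cancel t s ->
  (forall x, A x -> B (tsub s x)) -> (forall y, B y -> A (tsub t y)) ->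
  definable_bijection A B.
Proof.
move=> hA st ts AB BA.
have E x : tsub t (tsub s x) = x.
  by apply: eq_from_tnth => i; rewrite !tnth_mktuple ts.
have E' y : tsub s (tsub t y) = y.
  by apply: eq_from_tnth => i; rewrite !tnth_mktuple st.
exists (tsub s); last exact: definable_fun_sub.
split=> [x /AB //|x y _ _ e|y By]; first by rewrite -[x]E e E.
by exists (tsub t y); [exact: BA | rewrite E'].
Qed.
End Definability.

Definition defset_prod (K : fieldType) m n (A : defset K m) (B : defset K n) :
    defset K (m + n) :=
  Defset (definable_prod (defset_definable A) (defset_definable B)).

Fact definable_point (K : fieldType) :
  definable [set x : 1.-tuple K | tnth x ord0 = 0].
Proof.
exists (GRing.Equal (GRing.Var K 0) (GRing.NatConst K 0)) => // x /=.
by rewrite (tnth_nth 0).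
Qed.

Definition defset_point (K : fieldType) : defset K 1 :=
  Defset (definable_point K).

(* The index n stands for the ambient power K^(n+1), which excludes K^0.      *)
Definition symbol (K : fieldType) := {n : nat & defset K n.+1}.

Definition symb (K : fieldType) n (A : defset K n.+1) :
    {freeg (symbol K) / int} :=
  << Tagged (fun n => defset K n.+1) A >>.

Inductive K0_relation (K : fieldType) : {freeg (symbol K) / int} -> Prop :=
| K0_relation_bijection m n (A : defset K m.+1) (B : defset K n.+1) of
    definable_bijection A B : K0_relation (symb A - symb B)
| K0_relation_union n (A B C : defset K n.+1) of
    A = B `|` C :> set _ & B `&` C = set0 :
    K0_relation (symb A - (symb B + symb C)).

(* The subgroup generated by the relations.                                   *)
Inductive K0_null (K : fieldType) : {freeg (symbol K) / int} -> Prop :=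
| K0_null_relation u of K0_relation u : K0_null u
| K0_null_zero : K0_null 0
| K0_null_sub u v of K0_null u & K0_null v : K0_null (u - v).

Definition K0_nullb (K : fieldType) : {pred {freeg (symbol K) / int}} :=
  fun u => `[< K0_null u >].

Fact K0_null_closed (K : fieldType) : zmod_closed (@K0_nullb K).
Proof.
split=> [|u v]; first by apply/asboolP; apply: K0_null_zero.
by move=> /asboolP hu /asboolP hv; apply/asboolP; apply: K0_null_sub.
Qed.
HB.instance Definition _ (K : fieldType) :=
  GRing.isZmodClosed.Build _ (@K0_nullb K) (@K0_null_closed K).

(* The multiplication, induced by [A][B] = [A x B], is [K0_mul] below.        *)
Definition K0 (K : fieldType) : Type := Quotient.quot (@K0_nullb K).

Fact subrACA (V : zmodType) (a b c d : V) :
  (a - b) - (c - d) = (a - c) - (b - d).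
Proof. by rewrite !opprD !opprK addrACA. Qed.

Section K0Ring.
Variable K : fieldType.
Local Notation Z := {freeg (symbol K) / int}.

HB.instance Definition _ := GRing.Zmodule.on (K0 K).

Definition K0_pi (u : Z) : K0 K := \pi_(Quotient.quot (@K0_nullb K))%qT u.
Definition K0_repr (x : K0 K) : Z := repr x.

Fact K0_reprK x : K0_pi (K0_repr x) = x.
Proof. exact: reprK. Qed.

Fact K0_piP u v : K0_pi u = K0_pi v <-> K0_null (u - v).
Proof.
have -> : K0_null (u - v) = (u - v \in @K0_nullb K) by rewrite unfold_in asboolE.
by rewrite Quotient.idealrBE; split=> [h|/eqP //]; apply/eqP.
Qed.

Fact K0_pi_sub u v : K0_pi (u - v) = K0_pi u - K0_pi v.
Proof. exact: (raddfB (\pi_(Quotient.quot (@K0_nullb K))%qT)). Qed.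

Fact K0_pi0 : K0_pi 0 = 0.
Proof. exact: (raddf0 (\pi_(Quotient.quot (@K0_nullb K))%qT)). Qed.

Fact K0_piD u v : K0_pi (u + v) = K0_pi u + K0_pi v.
Proof. exact: (raddfD (\pi_(Quotient.quot (@K0_nullb K))%qT)). Qed.

Definition symbol_prod (a b : symbol K) : symbol K :=
  Tagged (fun n => defset K n.+1)
    (defset_prod (tagged a) (tagged b) : defset K (tag a + (tag b).+1).+1).

Definition free_mul (u v : Z) : Z :=
  fglift (fun a => fglift (fun b => << symbol_prod a b >> : Z) v) u.

Fact free_mulBl u v w : free_mul (u - v) w = free_mul u w - free_mul v w.
Proof. exact: lift_is_additive. Qed.

Fact free_mul0l w : free_mul 0 w = 0.
Proof. by have := free_mulBl 0 0 w; rewrite !subrr. Qed.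

Fact free_mulDl u v w : free_mul (u + v) w = free_mul u w + free_mul v w.
Proof.
by apply/eqP; rewrite -subr_eq -free_mulBl addrK.
Qed.

Fact freeg_gen_ind (P : Z -> Prop) :
  (forall a, P << a >>) -> P 0 -> (forall u v, P u -> P v -> P (u - v)) ->
  forall u, P u.
Proof.
move=> Pa P0 PB.
have PN u : P u -> P (- u) by move=> Pu; rewrite -sub0r; apply: PB.
have PD u v : P u -> P v -> P (u + v).
  by move=> Pu Pv; rewrite -[v]opprK; apply: PB => //; apply: PN.
elim/freeg_ind_dom0 => // k x D _ _ PDD; apply: (PD) => //.
rewrite -[k]intz -freegU_mulz.
case: k => n; last rewrite NegzE mulrNz; last apply: (PN).
  by rewrite -pmulrn; elim: n => [|n IH]; rewrite ?mulr0n // mulrS; apply: (PD).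
by rewrite -pmulrn; elim: n.+1 => [|m IH]; rewrite ?mulr0n // mulrS; apply: (PD).
Qed.

Fact free_mul_genl a v :
  free_mul << a >> v = fglift (fun b => << symbol_prod a b >> : Z) v.
Proof. by rewrite /free_mul liftU scale1r. Qed.

Fact free_mulBr u v w : free_mul u (v - w) = free_mul u v - free_mul u w.
Proof.
elim/freeg_gen_ind: u => [a||u u' hu hu'].
- by rewrite !free_mul_genl; apply: lift_is_additive.
- by rewrite !free_mul0l subr0.
by rewrite !free_mulBl hu hu' subrACA.
Qed.

Fact free_mul0r w : free_mul w 0 = 0.
Proof. by have := free_mulBr w 0 0; rewrite !subrr. Qed.

Fact free_mul_gen a b : free_mul << a >> << b >> = << symbol_prod a b >>.
Proof. by rewrite free_mul_genl liftU scale1r. Qed.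

Fact free_mul_symb m n (A : defset K m.+1) (B : defset K n.+1) :
  free_mul (symb A) (symb B)
  = symb (defset_prod A B : defset K (m + n.+1).+1).
Proof. exact: free_mul_gen. Qed.

Fact symb_tagged (a : symbol K) : << a >> = symb (tagged a) :> Z.
Proof. by case: a. Qed.

Fact K0_nullN (u : Z) : K0_null u -> K0_null (- u).
Proof. by rewrite -sub0r; apply: K0_null_sub; apply: K0_null_zero. Qed.

Fact K0_nullD (u v : Z) : K0_null u -> K0_null v -> K0_null (u + v).
Proof. by move=> hu hv; rewrite -[v]opprK; apply/K0_null_sub/K0_nullN. Qed.

Fact K0_null_mull (u v : Z) : K0_null u -> K0_null (free_mul u v).
Proof.
move=> hu; elim/freeg_gen_ind: v => [d||v w]; last 2 first.
- by rewrite free_mul0r; apply: K0_null_zero.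
- by rewrite free_mulBr; apply: K0_null_sub.
rewrite symb_tagged; case: d => d D /=; elim: hu => {u} [u|| u v _ hu _ hv].
- case=> [m n A B AB | n A B C ABC BC]; apply: K0_null_relation.
    rewrite free_mulBl !free_mul_symb; apply: K0_relation_bijection.
    have DD := definable_bijection_refl (defset_definable D).
    exact: (definable_bijection_prod AB DD).
  rewrite free_mulBl free_mulDl !free_mul_symb; apply: K0_relation_union => /=.
    rewrite ABC; apply/seteqP; split=> z /=.
      by case=> x [Bx|Cx] [y Dy <-]; [left|right]; exists x => //; exists y.
    by case=> -[x hx [y Dy <-]]; exists x; [left| exists y|right|exists y].
  apply/seteqP; split=> z //= [[x Bx [y Dy e]] [x' Cx' [y' Dy' e']]].
  have := congr1 (@tl K n.+1 d.+1) (etrans e (esym e')); rewrite !tl_cat => xx'.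
  by have : (B `&` C) x by [split=> //; rewrite xx']; rewrite BC.
- by rewrite free_mul0l; apply: K0_null_zero.
by rewrite free_mulBl; apply: K0_null_sub.
Qed.

Fact definable_bijection_tsub m n (A : set (m.-tuple K)) (B : set (n.-tuple K))
    (s : 'I_n -> 'I_m) :
  definable A -> set_bij A B (tsub s) -> definable_bijection A B.
Proof. by move=> hA hs; exists (tsub s) => //; apply: definable_fun_sub. Qed.

Fact free_mulC u v : K0_null (free_mul u v - free_mul v u).
Proof.
elim/freeg_gen_ind: u => [a||u u' hu hu'].
- elim/freeg_gen_ind: v => [b||v v' hv hv'].
  + rewrite !symb_tagged !free_mul_symb.
    apply/K0_null_relation/K0_relation_bijection.
    case: a b => m A [n B] /=.
    pose s (i : 'I_(n.+1 + m.+1)) : 'I_(m.+1 + n.+1) :=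
      match fintype.split i with inl j => rshift _ j | inr j => lshift _ j end.
    have E (x : m.+1.-tuple K) (y : n.+1.-tuple K) : tsub s [tuple of x ++ y] = [tuple of y ++ x] :> _.-tuple K.
      apply: eq_from_tnth => i; rewrite tnth_mktuple /s.
      by case: (split_ordP i) => j ->; rewrite ?tnth_lshift ?tnth_rshift.
    apply: (@definable_bijection_tsub _ _ _ _ s).
      exact: (defset_definable (defset_prod A B)).
    split.
    * by move=> _ [x Ax [y By <-]]; rewrite E; exists y => //; exists x.
    * move=> z z'; rewrite [z]tcatE [z']tcatE !E => _ _ e.
      have := congr1 (@tl _ _ _) e; have := congr1 (@tr _ _ _) e.
      by rewrite !tl_cat !tr_cat => -> ->.
    * by move=> _ [y By [x Ax <-]]; exists [tuple of x ++ y] => //; exists x => //; exists y.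
  + by rewrite free_mul0r free_mul0l subr0; apply: K0_null_zero.
  + by rewrite free_mulBr free_mulBl subrACA; apply: K0_null_sub.
- by rewrite free_mul0r free_mul0l subr0; apply: K0_null_zero.
rewrite free_mulBr free_mulBl.
rewrite subrACA; exact: K0_null_sub.
Qed.

Fact K0_null_mulr (u v : Z) : K0_null v -> K0_null (free_mul u v).
Proof.
move=> hv; rewrite -(subrK (free_mul v u) (free_mul u v)).
by apply: K0_nullD; [exact: free_mulC | exact: K0_null_mull].
Qed.

Fact free_mulA u v w :
  K0_null (free_mul u (free_mul v w) - free_mul (free_mul u v) w).
Proof.
elim/freeg_gen_ind: u => [a||u u' hu hu']; last 2 first.
- by rewrite !free_mul0l subrr; apply: K0_null_zero.
- rewrite !free_mulBl subrACA; exact: K0_null_sub.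
elim/freeg_gen_ind: v => [b||v v' hv hv']; last 2 first.
- by rewrite !(free_mul0l, free_mul0r) subrr; apply: K0_null_zero.
- rewrite !(free_mulBl, free_mulBr) subrACA; exact: K0_null_sub.
elim/freeg_gen_ind: w => [c||w w' hw hw']; last 2 first.
- by rewrite !(free_mul0l, free_mul0r) subrr; apply: K0_null_zero.
- rewrite !(free_mulBl, free_mulBr) subrACA; exact: K0_null_sub.
rewrite !symb_tagged !free_mul_symb; apply/K0_null_relation/K0_relation_bijection.
case: a b c => m A [n B] [p C] /=.
have e : (m.+1 + n.+1 + p.+1 = m.+1 + (n.+1 + p.+1))%N by rewrite addnA.
have E (x : m.+1.-tuple K) (y : n.+1.-tuple K) (z : p.+1.-tuple K) :
  tsub (cast_ord e) [tuple of x ++ [tuple of y ++ z]] = [tuple of [tuple of x ++ y] ++ z].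
  by apply: eq_from_tnth => i; rewrite tnth_mktuple !(tnth_nth 0) /= catA.
apply: (@definable_bijection_tsub _ _ _ _ (cast_ord e)).
  exact: (defset_definable (defset_prod A (defset_prod B C))).
split.
- move=> _ [x Ax [_ [y By [z Cz <-]] <-]]; rewrite E.
  by exists [tuple of x ++ y]; [exists x => //; exists y | exists z].
- move=> z z' _ _ h; apply: eq_from_tnth => i.
  have := congr1 (fun u : _.-tuple K => tnth u (cast_ord (esym e) i)) h.
  by rewrite !tnth_mktuple cast_ordKV.
- move=> _ [_ [x Ax [y By <-]] [z Cz <-]].
  exists [tuple of x ++ [tuple of y ++ z]]; last exact: E.
  by exists x => //; exists [tuple of y ++ z] => //; exists y => //; exists z.
Qed.

Fact free_mul1 u : K0_null (free_mul (symb (defset_point K)) u - u).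
Proof.
elim/freeg_gen_ind: u => [a||u u' hu hu']; last 2 first.
- by rewrite free_mul0r subrr; apply: K0_null_zero.
- rewrite free_mulBr subrACA; exact: K0_null_sub.
rewrite symb_tagged free_mul_symb; apply/K0_null_relation/K0_relation_bijection.
case: a => n A /=.
apply: (@definable_bijection_tsub _ _ _ _ (@rshift 1 n.+1)).
  exact: (defset_definable (defset_prod (defset_point K) A)).
split.
- by move=> _ [x _ [y Ay <-]]; rewrite [tsub _ _]tr_cat.
- move=> z z'; rewrite !inE => -[x x0 [y _ <-]] [x' x'0 [y' _ <-]].
  rewrite ![tsub _ _]tr_cat => ->; congr [tuple of _ ++ _].
  by apply: eq_from_tnth => i; rewrite (ord1 i) /= x0 x'0.
- move=> y Ay; exists [tuple of [tuple (0 : K) | i < 1] ++ y]; last exact: tr_cat.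
  by exists [tuple (0 : K) | i < 1]; [rewrite /= tnth_mktuple | exists y].
Qed.

Definition K0_class n (A : defset K n.+1) : K0 K := K0_pi (symb A).

Definition K0_mul (x y : K0 K) : K0 K :=
  K0_pi (free_mul (K0_repr x) (K0_repr y)).

Fact K0_pi_mul u v : K0_pi (free_mul u v) = K0_mul (K0_pi u) (K0_pi v).
Proof.
have hr w : K0_null (w - K0_repr (K0_pi w)) by apply/K0_piP; rewrite K0_reprK.
apply/K0_piP; set u' := K0_repr _; set v' := K0_repr _.
rewrite -[free_mul u v](subrK (free_mul u' v)) -addrA -free_mulBl -free_mulBr.
by apply: K0_nullD; [apply: K0_null_mull | apply: K0_null_mulr]; apply: hr.
Qed.

Fact K0_mulA : associative K0_mul.
Proof.
move=> x y z; rewrite -[x]K0_reprK -[y]K0_reprK -[z]K0_reprK -!K0_pi_mul.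
exact/K0_piP/free_mulA.
Qed.
Fact K0_mulC : commutative K0_mul.
Proof.
move=> x y; rewrite -[x]K0_reprK -[y]K0_reprK -!K0_pi_mul.
exact/K0_piP/free_mulC.
Qed.
Fact K0_mul1 : left_id (K0_class (defset_point K)) K0_mul.
Proof.
by move=> x; rewrite -[x]K0_reprK -!K0_pi_mul; apply/K0_piP/free_mul1.
Qed.
Fact K0_mulDl : left_distributive K0_mul +%R.
Proof.
move=> x y z; rewrite -[x]K0_reprK -[y]K0_reprK -[z]K0_reprK.
rewrite -K0_piD -!K0_pi_mul -K0_piD; congr K0_pi.
exact: free_mulDl.
Qed.
HB.instance Definition _ := GRing.Zmodule_isComPzRing.Build (K0 K)
  K0_mulA K0_mulC K0_mul1 K0_mulDl.

Fact K0_classM m n (A : defset K m.+1) (B : defset K n.+1) :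
  K0_class A * K0_class B
  = K0_class (defset_prod A B : defset K (m + n.+1).+1).
Proof. by rewrite -[LHS]K0_pi_mul free_mul_symb. Qed.

End K0Ring.

(* Main.v *)
Require Import Defs.
From mathcomp Require Import all_boot all_order all_algebra all_field.
From mathcomp Require Import boolp classical_sets functions fsbigop.
From mathcomp Require Import generic_quotient freeg ring zify.

(** The vanishing of the Grothendieck ring follows from the bijection, as the
    class of a point is [K] - [K^*] and is the unit of the ring ([K0_trivial]).
    So the theorem asks for a definable bijection between K and K minus a point.

    The field K carries a valuation with values in Z^r, ordered
    lexicographically, and with finite residue field. Let O be its valuation
    ring, pi a generator of the maximal ideal, which is an element of least
    positive value, and G the group of the elements with angular component 1,
    that is, the product of a group isomorphic to Z^r and of a small ball
    1 + radius O. Both O and G are definable in the language of rings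
    ([vring_definable], [ang_definable]). Write P for the part of G in O, and +
    for disjoint unions up to definable bijections. All the bijections used
    are affine maps, powers and inversions:
    - P = pi P + (1 + radius O), so P = P + O;
    - inversion exchanges the two halves of G, so G = P + P;
    - O without 0 is a union of an even number 2c of multiples of P,
      so O = 1 + c G;
    - the n-th power map identifies G with a subgroup of some finite index k_n
      that is divisible by n, so G = k_n G. With n = 2 and n = k_2 - 1 the
      numbers k_n - 1 are coprime, and this forces G = G + G
      ([equid_ang_double]).
    Altogether G = P + P = P + P + O = G + 1 + c G = G + 1 ([equid_ang_add1]), and
    a bijection that removes a point from G extends to K by the identity.

    What remains is to show that K has the structure used above, which is
    recorded as [angular_field]. It passes from a field F of characteristic 0
    to F((t)) ([laurent_angular]): elements are compared through their leading
    coefficients, and Hensel's lemma in F[[t]], in the guise of a contraction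
    principle ([contraction]), solves the equations left over. It holds for the
    fraction field of a complete discrete valuation ring of mixed characteristic
    with finite residue rings ([dvr_angular]). The p-adic integers form such a
    ring ([padic_dvr]), and the property passes to finite extensions
    ([extension_dvr]): a maximal subring of L that contains Z_p but not 1/p is a
    valuation ring, and the completeness of Z_p confines it to a lattice of L, from
    which discreteness, completeness and finiteness follow. *)

Set Implicit Arguments.
Unset Strict Implicit.
Unset Printing Implicit Defensive.

Import Order.TTheory GRing.Theory Num.Theory.
Local Open Scope ring_scope.
Local Open Scope classical_set_scope.

(** * Definable predicates on environments *)

Section Definability.
Variable K : fieldType.
Implicit Types (P Q : seq K -> Prop) (e : seq K).

(** Formulas are evaluated on arbitrary sequences, with 0 for the missing
    entries. Speaking of predicates on such environments, rather than of sets of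
    n-tuples for a fixed n, makes definability stable under quantification:
    a bound variable is any index that the formula does not use for another
    purpose. *)
Definition env_definable P :=
  exists2 phi : GRing.formula K, GRing.rformula phi &
    forall e, P e <-> GRing.holds e phi.

Lemma env_ext P Q : (forall e, P e <-> Q e) -> env_definable P -> env_definable Q.
Proof. by move=> PQ [phi r h]; exists phi => // e; rewrite -PQ h. Qed.

Lemma env_eq (s t : GRing.term K) : GRing.rterm s -> GRing.rterm t ->
  env_definable (fun e => GRing.eval e s = GRing.eval e t).
Proof. by move=> rs rt; exists (GRing.Equal s t) => //=; apply/andP. Qed.

Lemma env_and P Q : env_definable P -> env_definable Q ->
  env_definable (fun e => P e /\ Q e).
Proof.
case=> f rf hf [g rg hg]; exists (GRing.And f g) => [|e /=]; first exact/andP.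
by rewrite hf hg.
Qed.

Lemma env_or P Q : env_definable P -> env_definable Q ->
  env_definable (fun e => P e \/ Q e).
Proof.
case=> f rf hf [g rg hg]; exists (GRing.Or f g) => [|e /=]; first exact/andP.
by rewrite hf hg.
Qed.

Lemma env_not P : env_definable P -> env_definable (fun e => ~ P e).
Proof. by case=> f rf hf; exists (GRing.Not f) => // e /=; rewrite hf. Qed.

Lemma env_false : env_definable (fun=> False).
Proof. by exists (GRing.Bool false). Qed.

Lemma env_ex i P : env_definable P ->
  env_definable (fun e => exists x, P (set_nth 0 e i x)).
Proof.
case=> f rf hf; exists (GRing.Exists i f) => // e /=.
by split=> -[x hx]; exists x; apply/hf.
Qed.

Lemma env_ex_lt (m : nat) (P : nat -> seq K -> Prop) :
  (forall j, env_definable (P j)) ->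
  env_definable (fun e => exists2 j, (j < m)%N & P j e).
Proof.
move=> hP; elim: m => [|m IH].
  by apply: env_ext env_false => e; split=> // -[].
apply: env_ext (env_or IH (hP m)) => e; split.
  by case=> [[j jm Pj]|Pm]; [exists j => //; apply: ltnW | exists m].
case=> j; rewrite ltnS leq_eqVlt => /predU1P[-> |jm] Pj; first by right.
by left; exists j.
Qed.

Definition definable1 (A : K -> Prop) := env_definable (fun e => A e`_0).
Definition definable2 (R : K -> K -> Prop) :=
  env_definable (fun e => R e`_0 e`_1).

(** Renaming the two free variables to i and j; the bound variables are moved
    beyond both, which prevents capture. *)
Lemma env_subst2 R i j : definable2 R -> env_definable (fun e => R e`_i e`_j).
Proof.
case=> f rf hf; pose r k := nth None [:: Some i; Some j] k.
exists (fren r (maxn i j).+1 f); first by rewrite fren_rformula.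
move=> e; rewrite (@holds_fren K r _ e [:: e`_i; e`_j]) ?(hf [:: _; _]) //.
  by case=> [|[|k]] //=; rewrite /r /= !nth_nil.
by case=> [|[|k]] l; rewrite /r /= ?nth_nil // => -[<-]; rewrite ltnS leq_max leqnn ?orbT.
Qed.

Lemma env_subst1 A i : definable1 A -> env_definable (fun e => A e`_i).
Proof. by move=> hA; apply: (@env_subst2 (fun x _ => A x) i i). Qed.

Lemma definable1_tuple (A : K -> Prop) : definable1 A ->
  definable [set x : 1.-tuple K | A (tnth x ord0)].
Proof. by case=> f rf hf; exists f => // x; rewrite -hf /= (tnth_nth 0). Qed.

Lemma definable2_swap R : definable2 R -> definable2 (fun x y => R y x).
Proof. exact: (@env_subst2 R 1 0). Qed.

Lemma definable1_image A R : definable1 A -> definable2 R ->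
  definable1 (fun y => exists2 x, A x & R x y).
Proof.
move=> hA hR.
apply: env_ext (env_ex 1 (env_and (env_subst1 1 hA) (env_subst2 1 0 hR))) => e.
split=> [[x]|[x Ax Rx]]; last by exists x; rewrite !nth_set_nth.
by rewrite !nth_set_nth /= => -[Ax Rx]; exists x.
Qed.

Lemma definable1_and A B : definable1 A -> definable1 B ->
  definable1 (fun x => A x /\ B x).
Proof. exact: env_and. Qed.

Lemma definable1_not A : definable1 A -> definable1 (fun x => ~ A x).
Proof. exact: env_not. Qed.

End Definability.

(** * Definable bijections between finite disjoint unions *)

Section Equidecomposition.
Variable K : fieldType.

Record dset := DSet { dcar :> K -> Prop; dset_def : definable1 dcar }.

Lemma definable1_false : definable1 (fun _ : K => False).
Proof. exact: env_false. Qed.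
Definition dempty := DSet definable1_false.

Implicit Types (S T U : seq dset) (z w : nat * K).

(** A list of definable subsets of K stands for their disjoint union: the point
    (i, x) of the union is the point x of the i-th set. The default [dempty]
    makes every index beyond the list contribute nothing. *)
Definition dsum S z : Prop := nth dempty S z.1 z.2.

Lemma dsum_lt S i x : dsum S (i, x) -> (i < size S)%N.
Proof. by rewrite /dsum /=; case: ltnP => // /(nth_default dempty) ->. Qed.

(** Equality of classes in the monoid of definable subsets of K under disjoint
    union. The bijection is given by its graph R, one definable piece for each
    pair of indices: a symmetric notion, so that inverses and composites need
    no choice. This monoid is not cancellative: an equality in it is stronger
    than an equality in the Grothendieck group, and it is what a bijection
    needs. *)
Definition equid S T := exists R : nat * K -> nat * K -> Prop,
  [/\ forall i j, definable2 (fun x y => R (i, x) (j, y)),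
      forall z w, R z w -> dsum S z /\ dsum T w,
      (forall z, dsum S z -> exists w, R z w) /\
        (forall w, dsum T w -> exists z, R z w),
      forall z w w', R z w -> R z w' -> w = w'
    & forall z z' w, R z w -> R z' w -> z = z'].

Lemma definable2_eqxy : definable2 (@eq K).
Proof. by apply: (@env_eq K (GRing.Var K 0) (GRing.Var K 1)). Qed.

Lemma env_prop (Q : Prop) (P : seq K -> Prop) :
  env_definable P -> env_definable (fun e => Q /\ P e).
Proof.
move=> hR; have [hQ|nQ] := pselect Q.
  by apply: env_ext hR => e; split=> [|[]].
by apply: env_ext (env_false K) => e; split=> [|[]].
Qed.

Lemma definable2_dsum S i : definable2 (fun x (y : K) => dsum S (i, x)).
Proof. exact: (dset_def (nth dempty S i)). Qed.

Lemma equid_refl S : equid S S.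
Proof.
exists (fun z w => z = w /\ dsum S z); split.
- move=> i j.
  apply: (env_ext _ (@env_prop (i = j) _
    (env_and definable2_eqxy (@definable2_dsum S i)))) => e /=.
  by split=> [[-> [-> h]]|[[-> ->] h]].
- by move=> z w [-> h].
- by split=> z h; exists z.
- by move=> z w w' [<- _] [<- _].
- by move=> z w w' [-> _] [-> _].
Qed.

Lemma equid_sym S T : equid S T -> equid T S.
Proof.
case=> R [dR sR [tR uR] fR iR]; exists (fun z w => R w z); split.
- by move=> i j; exact: (definable2_swap (dR j i)).
- by move=> z w /sR[].
- by [].
- by move=> z w w'; apply: iR.
- by move=> z w w'; apply: fR.
Qed.

Lemma equid_trans T S U : equid S T -> equid T U -> equid S U.
Proof.
case=> R [dR sR [tR uR] fR iR] [R' [dR' sR' [tR' uR'] fR' iR']].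
exists (fun z w => exists2 v, R z v & R' v w); split.
- move=> i k.
  have := @env_ex_lt K (size T) _ (fun j =>
    env_ex 2 (env_and (env_subst2 0 2 (dR i j)) (env_subst2 2 1 (dR' j k)))).
  apply: env_ext => e; split.
    by case=> j _ [y]; rewrite !nth_set_nth /= => -[h1 h2]; exists (j, y).
  case=> -[j y] h1 h2; exists j; first by have [_ /dsum_lt] := sR _ _ h1.
  by exists y; rewrite !nth_set_nth.
- by move=> z w [v /sR[h _] /sR'[_ h']].
- split=> z h.
    by have [v hv] := tR _ h; have [w hw] := tR' _ (sR _ _ hv).2; exists w; exists v.
  by have [v hv] := uR' _ h; have [w hw] := uR _ (sR' _ _ hv).1; exists w; exists v.
- by move=> z w w' [v h1 h2] [v' h3 h4]; move: h4; rewrite -(fR _ _ _ h1 h3); apply: fR'.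
- by move=> z z' w [v h1 h2] [v' h3 h4]; move: h3; rewrite -(iR' _ _ _ h2 h4); apply: iR.
Qed.

Lemma dsum_catl S T i x : (i < size S)%N -> dsum (S ++ T) (i, x) = dsum S (i, x).
Proof. by move=> h; rewrite /dsum /= nth_cat h. Qed.
Lemma dsum_catr S T i x : dsum (S ++ T) ((size S + i)%N, x) = dsum T (i, x).
Proof. by rewrite /dsum /= nth_cat ltnNge leq_addr addKn. Qed.

Variant cat_spec S T : nat * K -> Prop :=
| CatL i x of dsum S (i, x) : cat_spec S T (i, x)
| CatR i x of dsum T (i, x) : cat_spec S T ((size S + i)%N, x).

Lemma dsum_catP S T z : dsum (S ++ T) z <-> cat_spec S T z.
Proof.
split; last first.
  by case=> i x h; [rewrite dsum_catl // (dsum_lt h) | rewrite dsum_catr].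
case: z => i x; case: (ltnP i (size S)) => h.
  by rewrite dsum_catl //; constructor.
by rewrite -(subnKC h) dsum_catr; constructor.
Qed.

Lemma equid_cat S S' T T' : equid S S' -> equid T T' -> equid (S ++ T) (S' ++ T').
Proof.
case=> R [dR sR [tR uR] fR iR] [R' [dR' sR' [tR' uR'] fR' iR']].
pose Q z w := ((z.1 < size S)%N /\ R z w) \/ ((size S <= z.1)%N /\ (size S' <= w.1)%N /\
   R' ((z.1 - size S)%N, z.2) ((w.1 - size S')%N, w.2)).
have QL i x j y : R (i, x) (j, y) -> Q (i, x) (j, y).
  by move=> h; left; split => //; have [/dsum_lt] := sR _ _ h.
have QR i x j y : R' (i, x) (j, y) -> Q ((size S + i)%N, x) ((size S' + j)%N, y).
  by move=> h; right; rewrite /= !leq_addr !addKn.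
have QP z w : Q z w -> (dsum S z /\ R z w /\ (z.1 < size S)%N /\ (w.1 < size S')%N) \/
   (exists i j x y, [/\ z = ((size S + i)%N, x), w = ((size S' + j)%N, y) & R' (i, x) (j, y)]).
  case: z w => [i x] [j y] [[/= h r]|[/= h1 [h2 r]]]; [left | right].
    by have [a /dsum_lt b] := sR _ _ r.
  by exists (i - size S)%N, (j - size S')%N, x, y; rewrite !subnKC.
exists Q; split.
- move=> i j; rewrite /definable2 /Q /=; apply: env_or; first exact: (env_prop _ (dR i j)).
  exact: (env_prop _ (env_prop _ (dR' _ _))).
- move=> z w /QP[[a [b _]]|[i [j [x [y [-> -> h]]]]]].
    case: (z) (w) a b => [i x] [j y] _ /sR [a b].
    by split; apply/dsum_catP; left.
  by have [a b] := sR' _ _ h; rewrite !dsum_catr.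
- split=> z /dsum_catP [] i x h.
  + by have [[j y] r] := tR _ h; exists (j, y); apply: QL.
  + by have [[j y] r] := tR' _ h; exists ((size S' + j)%N, y); apply: QR.
  + by have [[j y] r] := uR _ h; exists (j, y); apply: QL.
  + by have [[j y] r] := uR' _ h; exists ((size S + j)%N, y); apply: QR.
- move=> z w w' /QP[[a [b [c d]]]|[i [j [x [y [-> -> h]]]]]] /QP.
    case=> [[_ [b' _]]|]; first exact: fR b b'.
    by case=> [i [j [x [y [zE]]]]]; move: c; rewrite zE /= ltnNge leq_addr.
  case=> [[_ [_ [/=]]]|[i' [j' [x' [y' [[/addnI<- <-] -> h']]]]]].
    by rewrite ltnNge leq_addr.
  by have [-> ->] := fR' _ _ _ h h'.
- move=> z z' w /QP[[a [b [c d]]]|[i [j [x [y [-> -> h]]]]]] /QP.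
    case=> [[_ [b' _]]|]; first exact: iR b b'.
    by case=> [i [j [x [y [_ wE]]]]]; move: d; rewrite wE /= ltnNge leq_addr.
  case=> [[_ [_ [_ /=]]]|[i' [j' [x' [y' [-> [/addnI<- <-] h']]]]]].
    by rewrite ltnNge leq_addr.
  by have [-> ->] := iR' _ _ _ h h'.
Qed.

Lemma equid_catC S T : equid (S ++ T) (T ++ S).
Proof.
pose Q z w := dsum (S ++ T) z /\ z.2 = w.2 /\
  (((z.1 < size S)%N /\ w.1 = (size T + z.1)%N) \/ ((size S <= z.1)%N /\ z.1 = (size S + w.1)%N)).
have QL i x : dsum S (i, x) -> Q (i, x) ((size T + i)%N, x).
  move=> h; split; first by apply/dsum_catP; left.
  by split=> //; left; rewrite (dsum_lt h).
have QR i x : dsum T (i, x) -> Q ((size S + i)%N, x) (i, x).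
  move=> h; split; first by rewrite dsum_catr.
  by split=> //; right; rewrite /= leq_addr.
have QP z w : Q z w -> (exists i x, [/\ dsum S (i, x), z = (i, x) & w = ((size T + i)%N, x)]) \/
    (exists i x, [/\ dsum T (i, x), z = ((size S + i)%N, x) & w = (i, x)]).
  case: z w => [i x] [j y] [/= h [<-]] [[a ->]|[a e]]; [left|right].
    by exists i, x; rewrite -(dsum_catl T).
  by exists j, x; rewrite -(dsum_catr S) e -e.
exists Q; split.
- move=> i j; rewrite /Q /=.
  apply: (env_ext _ (@env_prop ((i < size S)%N /\ j = (size T + i)%N \/
    (size S <= i)%N /\ i = (size S + j)%N) _
    (env_and definable2_eqxy (@definable2_dsum (S ++ T) i)))) => e.
  by split=> [[a [b c]]|[a [b c]]].
- move=> z w /QP [] [i [x [h -> ->]]]; split; apply/dsum_catP; by constructor.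
- split=> z /dsum_catP [] i x h.
  + by exists ((size T + i)%N, x); apply: QL.
  + by exists (i, x); apply: QR.
  + by exists ((size S + i)%N, x); apply: QR.
  + by exists (i, x); apply: QL.
- move=> z w w' /QP [] [i [x [h -> ->]]] /QP [] [j [y [h']]].
  + by case=> -> -> ->.
  + by case=> e; move: (dsum_lt h); rewrite e ltnNge leq_addr.
  + by case=> e; move: (dsum_lt h'); rewrite -e ltnNge leq_addr.
  + by case=> /addnI -> -> ->.
- move=> z w w' /QP [] [i [x [h -> ->]]] /QP [] [j [y [h' ->]]].
  + by case=> /addnI -> ->.
  + by case=> e; move: (dsum_lt h'); rewrite -e ltnNge leq_addr.
  + by case=> e; move: (dsum_lt h); rewrite e ltnNge leq_addr.
  + by case=> -> ->.
Qed.

(** Concatenation of lists is the sum of the monoid, and this lemma says that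
    a finite definable partition is a sum. *)
Lemma equid_split (B : dset) S :
  (forall y, B y <-> exists i, dsum S (i, y)) ->
  (forall i j y, dsum S (i, y) -> dsum S (j, y) -> i = j) -> equid [:: B] S.
Proof.
move=> BS disj; exists (fun z w => z.1 = 0%N /\ z.2 = w.2 /\ dsum S w); split.
- move=> i j; rewrite /definable2 /=; apply: env_prop.
  exact: (env_and definable2_eqxy (definable2_swap (@definable2_dsum S j))).
- move=> [i x] [j y] [/= -> [-> h]]; split=> //.
  by apply/BS; exists j.
- split.
    move=> [[|i] x]; rewrite /dsum /= ?nth_nil // => /BS[i h].
    by exists (i, x).
  by move=> [i x] h; exists (0%N, x).
- by move=> [i x] [j y] [j' y'] [_ [/= <- h]] [_ [/= <- h']]; rewrite (disj _ _ _ h h').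
- by move=> [i x] [j y] [i' x'] [/= -> [-> _]] [/= -> [-> _]].
Qed.

Lemma equid_bij (A B : dset) (R : K -> K -> Prop) : definable2 R ->
  (forall x, A x -> exists2 y, B y & R x y) ->
  (forall y, B y -> exists2 x, A x & R x y) ->
  (forall x y y', A x -> R x y -> R x y' -> y = y') ->
  (forall x x' y, A x -> A x' -> R x y -> R x' y -> x = x') ->
  equid [:: A] [:: B].
Proof.
move=> dR AB BA fR iR.
exists (fun z w => (z.1 = 0%N /\ w.1 = 0%N) /\ A z.2 /\ B w.2 /\ R z.2 w.2); split.
- move=> i j; rewrite /definable2 /=; apply: env_prop; apply: env_and; first exact: (dset_def A).
  by apply: env_and => //; apply: (env_subst1 1 (dset_def B)).
- by move=> [i x] [j y] [/= [-> ->] [Ax [By _]]].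
- split=> -[[|i] x]; rewrite /dsum /= ?nth_nil // => h.
    by have [y By r] := AB _ h; exists (0%N, y).
  by have [y By r] := BA _ h; exists (0%N, y).
- by move=> [i x] [j y] [j' y'] [/= [_ ->] [Ax [_ r]]] [/= [_ ->] [_ [_ r']]]; rewrite (fR _ _ _ Ax r r').
- move=> [i x] [i' x'] [j y] [/= [-> _] [Ax [_ r]]] [/= [-> _] [Ax' [_ r']]].
  by rewrite (iR _ _ _ Ax Ax' r r').
Qed.

Lemma equid_nseq (A : dset) S :
  (forall i, (i < size S)%N -> equid [:: nth dempty S i] [:: A]) ->
  equid S (nseq (size S) A).
Proof.
elim: S => [|B S IH] h; first exact: equid_refl.
apply: (@equid_cat [:: B] [:: A] S); first exact: (h 0%N).
by apply: IH => i; apply: (h i.+1).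
Qed.

Lemma equid_absorb_nseq (A : dset) k : equid [:: A] (A :: nseq k A) ->
  forall i, equid [:: A] (A :: nseq (i * k) A).
Proof.
move=> h; elim=> [|i IH]; first exact: equid_refl.
apply: (equid_trans IH); rewrite mulSn nseqD.
exact: (@equid_cat [:: A] (A :: nseq k A) _ _ h (equid_refl _)).
Qed.

(** If A absorbs k and l copies of itself with k and l coprime, then a Bezout
    relation i k = j l + 1 gives
    A = A + i k A = (A + j l A) + A = A + A. *)
Lemma equid_double (A : dset) k l : (0 < k)%N -> coprime k l ->
  equid [:: A] (A :: nseq k A) -> equid [:: A] (A :: nseq l A) ->
  equid [:: A] [:: A; A].
Proof.
move=> k0 /eqP kl hk hl; case: (egcdnP l k0) => i j e _.
apply: (equid_trans (equid_absorb_nseq hk i)).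
rewrite e kl nseqD.
exact: (@equid_cat (A :: nseq (j * l) A) [:: A] _ _ (equid_sym (equid_absorb_nseq hl j)) (equid_refl _)).
Qed.

Lemma equid_definable_bijection (A B : dset) : equid [:: A] [:: B] ->
  definable_bijection [set x : 1.-tuple K | A (tnth x ord0)]
                      [set x : 1.-tuple K | B (tnth x ord0)].
Proof.
case=> R [dR sR [tR uR] fR iR].
have tot x : exists y, A x -> R (0%N, x) (0%N, y).
  have [Ax|nA] := pselect (A x); last by exists 0.
  have [[i y] r] := tR (0%N, x) Ax; exists y => _.
  by case: i r => // i r; have [_] := sR _ _ r; rewrite /dsum /= nth_nil.
have [f hf] := choice tot.
exists (fun x => [tuple f (tnth x ord0)]).
  split.
  - by move=> x /= /hf /sR [].
  - move=> x y; rewrite !inE => /= /hf h1 /hf h2 e; apply: eq_from_tnth => i.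
    have {}e : f (tnth x ord0) = f (tnth y ord0) := congr1 (fun u => tnth u ord0) e.
    by rewrite e in h1; have [e'] := iR _ _ _ h1 h2; rewrite (ord1 i).
  - move=> y /= By; have [[i x] r] := uR (0%N, tnth y ord0) By.
    have [h _] := sR _ _ r; case: i r h => [|i] r h; last by move: h; rewrite /dsum /= nth_nil.
    exists [tuple x] => //; apply: eq_from_tnth => i; rewrite (ord1 i) /=.
    by have [] := fR _ _ _ (hf _ h) r.
apply: definable_graph.
have [phi rphi hphi] := dR 0%N 0%N; exists phi => // z; rewrite -hphi.
have e0 : tnth (tl z) ord0 = (z : seq K)`_0 by rewrite /tl tnth_mktuple (tnth_nth 0).
have e1 : (z : seq K)`_1 = tnth (tr z) ord0 by rewrite /tr tnth_mktuple (tnth_nth 0).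
rewrite /mkset /= e0 e1; split.
  by case=> /hf h <-.
move=> r; have [h _] := sR _ _ r; split=> //.
apply: eq_from_tnth => i; rewrite (ord1 i) /=.
by have [] := fR _ _ _ (hf _ h) r.
Qed.

End Equidecomposition.

(** * Subrings, and finiteness arguments *)

Definition subring (L : fieldType) (A : L -> Prop) := [/\ A 1,
  forall x y, A x -> A y -> A (x - y) & forall x y, A x -> A y -> A (x * y)].

Section Subring.
Variables (L : fieldType) (A : L -> Prop).
Hypothesis HA : subring A.
Lemma sr1 : A 1. Proof. by case: HA. Qed.
Lemma srB x y : A x -> A y -> A (x - y). Proof. by case: HA => _ + _; apply. Qed.
Lemma srM x y : A x -> A y -> A (x * y). Proof. by case: HA => _ _; apply. Qed.
Lemma sr0 : A 0. Proof. by rewrite -(subrr 1); apply: srB; apply: sr1. Qed.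
Lemma srN x : A x -> A (- x). Proof. by move=> h; rewrite -sub0r; apply: srB => //; apply: sr0. Qed.
Lemma srD x y : A x -> A y -> A (x + y).
Proof. by move=> hx hy; rewrite -[y]opprK; apply: srB => //; apply: srN. Qed.
Lemma srX x n : A x -> A (x ^+ n).
Proof.
move=> h; elim: n => [|n IH]; first by rewrite expr0; apply: sr1.
by rewrite exprS; apply: srM.
Qed.
Lemma sr_sum (I : Type) (s : seq I) (Q : pred I) (f : I -> L) :
  (forall i, Q i -> A (f i)) -> A (\sum_(i <- s | Q i) f i).
Proof. by move=> h; apply: big_ind => //; [apply: sr0 | apply: srD]. Qed.
End Subring.

Lemma pigeonhole (T : finType) (f : nat -> T) :
  exists i j, [/\ (i < j)%N, (j <= #|T|)%N & f i = f j].
Proof.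
have : ~ injective (fun i : 'I_(#|T|).+1 => f i) by move=> /leq_card; rewrite card_ord ltnn.
move=> nf; apply: contrapT => h; apply: nf => i j e; apply: contrapT => ij.
have /eqP : (i : nat) <> j by move=> /val_inj.
rewrite neq_ltn => /orP[lt|lt]; apply: h.
  by exists i, j; split=> //; rewrite -ltnS.
by exists j, i; split=> //; rewrite -ltnS.
Qed.

(** A longest list of pairwise inequivalent elements of X exists because r is
    injective on such a list; by maximality it meets every class. *)
Lemma finite_transversal (V : zmodType) (X : V -> Prop) (E : V -> V -> Prop) (T : finType) (r : V -> T) :
  (forall x y, X x -> X y -> E x y -> E y x) ->
  (forall x y, X x -> X y -> r x = r y -> E x y) ->
  exists s : seq V, [/\ forall i, (i < size s)%N -> X s`_i,
    forall x, X x -> exists2 i, (i < size s)%N & E x s`_i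
  & forall i j, (i < size s)%N -> (j < size s)%N -> E s`_i s`_j -> i = j].
Proof.
move=> Es Er.
pose good (s : seq V) := (forall i, (i < size s)%N -> X s`_i) /\
  forall i j, (i < size s)%N -> (j < size s)%N -> E s`_i s`_j -> i = j.
pose P n := `[< exists2 s, good s & size s = n >].
have exP : exists n, P n by exists 0%N; apply/asboolP; exists [::].
have bP n : P n -> (n <= #|T|)%N.
  move=> /asboolP [s [Xs Us] <-].
  pose f (i : 'I_(size s)) := r s`_i.
  have fi : injective f.
    move=> i j e; apply: val_inj; apply: (Us _ _ (ltn_ord i) (ltn_ord j)).
    by apply: Er e; apply: Xs; apply: ltn_ord.
  by have := leq_card f fi; rewrite card_ord.
case: (ex_maxnP exP bP) => n /asboolP [s [Xs Us] sn] nmax.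
exists s; split=> // x Xx; apply: contrapT => nE.
suff : P n.+1 by move/nmax; rewrite ltnn.
apply/asboolP; exists (rcons s x); last by rewrite size_rcons sn.
split=> [i|i j]; rewrite size_rcons !ltnS !nth_rcons.
  rewrite leq_eqVlt => /predU1P[->|h]; first by rewrite ltnn eqxx.
  by rewrite h; apply: Xs.
rewrite (leq_eqVlt i) (leq_eqVlt j) => /predU1P[->|h] /predU1P[->|h'] //.
- rewrite ltnn eqxx h' => e; case: nE; exists j => //.
- rewrite ltnn eqxx h => e; case: nE; exists i => //; apply: Es => //; exact: Xs.
- by rewrite h h'; apply: Us.
Qed.

(** * Angular data and the bijection between the line and the punctured line *)

Definition power_transversal (K : fieldType) (G : K -> Prop) n (ss : seq K) :=
  [/\ forall i, (i < size ss)%N -> G ss`_i,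
      forall x, G x -> exists2 i, (i < size ss)%N &
        exists2 y, G y & x = ss`_i * y ^+ n
    & forall i j y, (i < size ss)%N -> (j < size ss)%N -> G y ->
        ss`_i = ss`_j * y ^+ n -> i = j].

Definition sign_transversal (K : fieldType) (O G : K -> Prop) (cs : seq K) :=
  [/\ forall i, (i < size cs)%N -> [/\ cs`_i != 0, O cs`_i & O (cs`_i)^-1],
      forall x, x != 0 -> exists2 i, (i < size cs)%N &
        G (x / cs`_i) \/ G (- (x / cs`_i))
    & forall i j, (i < size cs)%N -> (j < size cs)%N ->
        G (cs`_i / cs`_j) \/ G (- (cs`_i / cs`_j)) -> i = j].

(** What the bijection needs of K, in a form that passes from a field to its
    field of Laurent series. [vring] is a valuation ring whose maximal ideal is
    generated by [unif], and [ang] is the group of the elements with angular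
    component 1: it meets the units of [vring] in the ball 1 + radius vring, and
    together with them it generates the multiplicative group, of which it is a
    subgroup of finite even index, with the transversal [creps] up to sign.
    [artin_schreier] is the instance of Hensel's lemma that defines [vring] in the
    language of rings. In [ang_pow], the group of values is free of finite rank
    r > 0 and 1 + radius vring contributes an index N_n, so that the index of the
    n-th powers is n^r N_n; all that matters is that n divides it. *)
Record angular_field (K : fieldType) := AngularField {
  vring : K -> Prop;
  unif : K;
  radius : K;
  ang : K -> Prop;
  uexp : nat;
  creps : seq K;
  char0 : forall n, (0 < n)%N -> n%:R != 0 :> K;
  vring_subring : subring vring;
  vringV : forall x, vring x \/ vring x^-1;
  vring_unif : vring unif;
  unif_nunit : ~ vring unif^-1;
  vring_nunit : forall x, vring x -> vring x^-1 \/ exists2 y, vring y & x = unif * y;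
  artin_schreier : forall a, vring a -> exists z, z ^+ 2 + z = unif * a;
  radius0 : radius != 0;
  uexp_gt0 : (0 < uexp)%N;
  uexpP : forall u : K, u != 0 -> vring u -> vring u^-1 ->
    exists2 w, vring w & u ^+ uexp = 1 + radius * w;
  ang0 : forall x, ang x -> x != 0;
  ang_div : forall x y, ang x -> ang y -> ang (x / y);
  ang_unif : ang unif;
  ang_unit : forall x, (ang x /\ vring x /\ vring x^-1) <->
    exists2 w, vring w & x = 1 + radius * w;
  angN1 : ~ ang (-1);
  crepsP : sign_transversal vring ang creps;
  ang_pow : forall n, (0 < n)%N ->
    exists2 ss : seq K, (n %| size ss)%N & power_transversal ang n ss;
  ang_tor : forall n x, (0 < n)%N -> ang x -> x ^+ n = 1 -> x = 1
}.

Section AngularTheory.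
Variables (K : fieldType) (D : angular_field K).
Local Notation O := (vring D).
Local Notation G := (ang D).
Local Notation pi := (unif D).
Local Notation lam := (radius D).

Local Notation sO := (vring_subring D).

Lemma creps_unit i : (i < size (creps D))%N ->
  [/\ (creps D)`_i != 0, O (creps D)`_i & O ((creps D)`_i)^-1].
Proof. by case: (crepsP D) => h _ _; apply: h. Qed.
Lemma creps_cover x : x != 0 -> exists2 i, (i < size (creps D))%N &
  G (x / (creps D)`_i) \/ G (- (x / (creps D)`_i)).
Proof. by case: (crepsP D) => _ h _; apply: h. Qed.
Lemma creps_uniq i j : (i < size (creps D))%N -> (j < size (creps D))%N ->
  G ((creps D)`_i / (creps D)`_j) \/ G (- ((creps D)`_i / (creps D)`_j)) -> i = j.
Proof. by case: (crepsP D) => _ _ h; apply: h. Qed.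

Lemma unif_neq0 : pi != 0.
Proof. by apply/eqP => h; apply: (@unif_nunit _ D); rewrite h invr0; apply: (sr0 sO). Qed.

Lemma ang1 : G 1.
Proof.
suff: G 1 /\ O 1 /\ O 1^-1 by case.
by apply/ang_unit; exists 0; [apply: (sr0 sO) | rewrite mulr0 addr0].
Qed.
Lemma angV x : G x -> G x^-1.
Proof. by move=> h; rewrite -div1r; apply: ang_div => //; apply: ang1. Qed.
Lemma angM x y : G x -> G y -> G (x * y).
Proof. by move=> hx hy; rewrite -[y]invrK; apply: ang_div => //; apply: angV. Qed.
Lemma angX x n : G x -> G (x ^+ n).
Proof.
move=> h; elim: n => [|n IH]; first by rewrite expr0; apply: ang1.
by rewrite exprS; apply: angM.
Qed.

Lemma unif_mul_neq1 y : O y -> 1 != pi * y.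
Proof.
move=> Oy; apply/eqP => e; apply: (@unif_nunit _ D).
by rewrite -[_^-1]mulr1 e mulKf ?unif_neq0.
Qed.

Lemma nvringV x : ~ O x -> x != 0 /\ exists2 y, O y & x^-1 = pi * y.
Proof.
move=> nO; split; first by apply/eqP => h; apply: nO; rewrite h; apply: (sr0 sO).
have Ov : O x^-1 by case: (vringV D x).
by case: (vring_nunit Ov) => //; rewrite invrK.
Qed.

Lemma unif_mulV y : O y -> y != 0 -> ~ O (pi * y)^-1.
Proof.
move=> Oy y0 /(srM sO Oy); rewrite invfM mulrCA mulfV // mulr1.
exact: unif_nunit.
Qed.

(** If x is not in O, the value of pi x^2 is negative and is not divisible by 2,
    as pi has the least positive value; but a solution z would have a negative
    value, equal to half of it. *)
Lemma vringE x : O x <-> exists z, z * z + z = pi * (x * x).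
Proof.
split=> [Ox|[z e]].
  by have [z <-] := artin_schreier (srM sO Ox Ox); exists z; rewrite expr2.
apply: contrapT => /nvringV [x0 [b Ob xb]].
have xb1 : x * (pi * b) = 1 by rewrite -xb mulfV.
have nOz : ~ O z.
  move=> Oz; have /(srM sO (srM sO Ob Ob)) : O (pi * (x * x)).
    by rewrite -e; apply: (srD sO) => //; apply: (srM sO).
  move=> h; apply/negP: (unif_mul_neq1 h); rewrite negbK; apply/eqP.
  have -> : pi * (b * b * (pi * (x * x))) = (x * (pi * b)) * (x * (pi * b)) by ring.
  by rewrite xb1 mulr1.
have [z0 [c Oc zc]] := nvringV nOz.
have zc1 : z * (pi * c) = 1 by rewrite -zc mulfV.
have e1 : z * z * (1 + pi * c) = pi * (x * x).
  by rewrite -e mulrDr mulr1 -mulrA zc1 mulr1.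
pose y := z / x.
have e2 : y * y * (1 + pi * c) = pi.
  have -> : y * y * (1 + pi * c) = (z * z * (1 + pi * c)) / (x * x).
    by rewrite /y; field.
  by rewrite e1 mulfK // mulf_neq0.
have c1 : 1 + pi * c != 0.
  apply/eqP => h; move: e1; rewrite h mulr0 => /esym/eqP.
  by rewrite !mulf_eq0 (negbTE x0) (negbTE unif_neq0).
case: (vringV D y) => Oy.
  case: (vring_nunit Oy) => [Oyv|[d Od yd]].
    case: (@unif_nunit _ D).
    have -> : pi^-1 = y^-1 * y^-1 * (1 + pi * c)^-1 by rewrite -{1}e2 !invfM.
    suff : O (1 + pi * c)^-1 by move=> h; apply: (srM sO) => //; apply: (srM sO).
    have Oc1 : O (1 + pi * c).
      by apply: (srD sO); [apply: (sr1 sO) | apply: (srM sO) => //; apply: vring_unif].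
    case: (vring_nunit Oc1) => // -[f Of e3].
    have h : O (f - c) by apply: (srB sO).
    by case/eqP: (unif_mul_neq1 h); rewrite mulrBr -e3 addrK.
  have h : O (d * d * (1 + pi * c)).
    apply: (srM sO); first exact: (srM sO).
    by apply: (srD sO); [apply: (sr1 sO) | apply: (srM sO) => //; apply: vring_unif].
  case/eqP: (unif_mul_neq1 h); apply: (mulfI unif_neq0).
  by rewrite mulr1 -{1}e2 yd; ring.
have h : O (y^-1 * y^-1 - c) by apply: (srB sO) => //; apply: (srM sO).
case/eqP: (unif_mul_neq1 h).
have y0 : y != 0 by rewrite mulf_neq0 ?invr_eq0.
have -> : pi * (y^-1 * y^-1 - c) = pi / (y * y) - pi * c by field.
by rewrite -{1}e2 mulrAC mulfV ?mul1r ?addrK // mulf_neq0.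
Qed.

Lemma vring_definable : definable1 O.
Proof.
pose t0 := GRing.Var K 0; pose t1 := GRing.Var K 1.
have h := @env_eq K (GRing.Add (GRing.Mul t1 t1) t1) (GRing.Mul (GRing.Const pi) (GRing.Mul t0 t0)) isT isT.
apply: env_ext (env_ex 1 h) => e /=; rewrite vringE.
by split=> -[z]; rewrite ?nth_set_nth /= => hz; exists z; rewrite ?nth_set_nth.
Qed.

Lemma ball_unit u : O u -> G (1 + lam * u) /\ O (1 + lam * u) /\ O (1 + lam * u)^-1.
Proof. by move=> Ou; apply/ang_unit; exists u. Qed.

(** G contains the N-th powers for N = [uexp], up to the ball, since K^* is
    generated by G and by units. Hence G is the union of finitely many
    sets of elements s y^N (1 + radius u) with y nonzero and u in O. *)
Lemma ang_definable : definable1 G.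
Proof.
have [ss _ [ssG ssc _]] := ang_pow D (uexp_gt0 D).
have E x : G x <-> exists2 i, (i < size ss)%N & exists y u,
   [/\ y <> 0, O u & x = ss`_i * y ^+ uexp D * (1 + lam * u)].
  split=> [/ssc[i i_s [y Gy ->]]|[i i_s [y [u [/eqP y0 Ou ->]]]]].
    exists i => //; exists y, 0; split; [|apply: (sr0 sO)|by rewrite mulr0 addr0 mulr1].
    exact/eqP/(ang0 Gy).
  apply: angM; last by case: (ball_unit Ou).
  apply: angM; first exact: ssG.
  have [j js] := creps_cover y0; have [c0 Oc Ocv] := creps_unit js.
  set c := (creps D)`_j in js c0 Oc Ocv *.
  have cU : G (c ^+ uexp D).
    have [w Ow ->] := uexpP c0 Oc Ocv; by case: (ball_unit Ow).
  have cU' : G ((- c) ^+ uexp D).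
    have [|||w Ow ->] := @uexpP _ D (- c); rewrite ?oppr_eq0 ?invrN //; try exact: (srN sO).
    by case: (ball_unit Ow).
  case=> h.
    have -> : y = (y / c) * c by rewrite divfK.
    by rewrite exprMn; apply: angM => //; apply: angX.
  have -> : y = - (y / c) * - c by rewrite mulrNN divfK.
  by rewrite exprMn; apply: angM => //; apply: angX.
pose x := GRing.Var K 0; pose y := GRing.Var K 1; pose u := GRing.Var K 2.
pose t i := GRing.Mul (GRing.Mul (GRing.Const ss`_i) (GRing.Exp y (uexp D)))
  (GRing.Add (GRing.NatConst K 1) (GRing.Mul (GRing.Const lam) u)).
have h i := env_and (env_not (@env_eq K y (GRing.NatConst K 0) isT isT))
  (env_and (env_subst1 2 vring_definable) (@env_eq K x (t i) isT isT)).
apply: env_ext (env_ex_lt (size ss) (fun i => env_ex 1 (env_ex 2 (h i)))) => e /=; rewrite E.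
split=> -[i i_s [v [w]]].
  by rewrite !nth_set_nth /= !nth_set_nth => -[? [? ?]]; exists i => //; exists v, w.
by case=> ? ? ?; exists i => //; exists v, w; rewrite !nth_set_nth /= !nth_set_nth.
Qed.

Definition ang_set := DSet ang_definable.
Definition vring_set := DSet vring_definable.
Definition pos_set := DSet (definable1_and ang_definable vring_definable).
Definition neg_set := DSet (definable1_and ang_definable (definable1_not vring_definable)).

Lemma definable1_eq a : definable1 (fun x : K => x = a).
Proof. exact: (@env_eq K (GRing.Var K 0) (GRing.Const a) isT isT). Qed.
Definition point_set a := DSet (definable1_eq a).

Lemma definable2_power a b n : definable2 (fun x y : K => y = a * x ^+ n + b).
Proof.
pose x := GRing.Var K 0; pose y := GRing.Var K 1.
exact: (@env_eq K y (GRing.Add (GRing.Mul (GRing.Const a) (GRing.Exp x n))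
  (GRing.Const b)) isT isT).
Qed.

Lemma definable1_power_image (A : dset K) a b n : definable1 (fun y => exists2 x, A x & y = a * x ^+ n + b).
Proof. exact: (definable1_image (dset_def A) (definable2_power a b n)). Qed.
Definition power_image A a b n := DSet (definable1_power_image A a b n).

Lemma equid_power_image (A : dset K) a b n : a != 0 ->
  (forall x y, A x -> A y -> x ^+ n = y ^+ n -> x = y) ->
  equid [:: power_image A a b n] [:: A].
Proof.
move=> a0 inj; apply/equid_sym.
apply: (@equid_bij _ _ _ (fun x y => y = a * x ^+ n + b)).
- exact: definable2_power.
- by move=> x Ax; exists (a * x ^+ n + b) => //; exists x.
- by [].
- by move=> x y y' _ -> ->.
- by move=> x x' y Ax Ax' -> /addIr/(mulfI a0) /inj ->.
Qed.

Lemma equid_scale (A : dset K) a b : a != 0 -> equid [:: power_image A a b 1] [:: A].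
Proof. by move=> a0; apply: equid_power_image => // x y _ _; rewrite !expr1. Qed.

Lemma dsum_map (I : Type) (i0 : I) (f : I -> dset K) s k y :
  dsum [seq f i | i <- s] (k, y) <-> (k < size s)%N /\ f (nth i0 s k) y.
Proof.
split=> [h|[ks h]].
  have ks := dsum_lt h; rewrite size_map in ks; split=> //.
  by move: h; rewrite /dsum /= (nth_map i0).
by rewrite /dsum /= (nth_map i0).
Qed.

Lemma equid_map_nseq (I : Type) (i0 : I) (f : I -> dset K) (A : dset K) s :
  (forall k, (k < size s)%N -> equid [:: f (nth i0 s k)] [:: A]) ->
  equid [seq f i | i <- s] (nseq (size s) A).
Proof.
move=> h; rewrite -(size_map f); apply: equid_nseq => k; rewrite size_map => ks.
by rewrite (nth_map i0) //; apply: h.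
Qed.

Lemma ang_pow_inj n x y : (0 < n)%N -> G x -> G y -> x ^+ n = y ^+ n -> x = y.
Proof.
move=> n0 Gx Gy e; have x0 := ang0 Gx; have y0 := ang0 Gy.
suff : x / y = 1 by move=> h; rewrite -[x](divfK y0) h mul1r.
apply: (@ang_tor _ D n _ n0); first by apply: ang_div.
by rewrite expr_div_n e divff // expf_neq0.
Qed.

(** The n-th power map is a bijection of G onto a subgroup of finite index. *)
Lemma equid_ang_pow n : (0 < n)%N -> exists k, [/\ (0 < k)%N, (n %| k)%N &
  equid [:: ang_set] (nseq k ang_set)].
Proof.
move=> n0; have [ss ns [ssG ssc ssu]] := ang_pow D n0.
exists (size ss); split=> //.
  by have [i i_s _] := ssc _ ang1; apply: leq_ltn_trans i_s.
have h : equid [seq power_image ang_set s 0 n | s <- ss] (nseq (size ss) ang_set).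
  apply: (@equid_map_nseq _ 0) => k ks; apply: equid_power_image; first exact: ang0 (ssG _ ks).
  by move=> x y; apply: ang_pow_inj.
apply: equid_trans h; apply: equid_split.
  move=> y; split.
    move=> /ssc [i i_s [x Gx ->]]; exists i; apply/(dsum_map 0); split=> //.
    by exists x; rewrite ?addr0.
  case=> i /(dsum_map 0)[i_s [x Gx ->]]; rewrite addr0; apply: angM; first exact: ssG.
  exact: angX.
move=> i j y /(dsum_map 0)[i_s [x Gx ->]] /(dsum_map 0)[js [x' Gx' ]].
rewrite !addr0 => e; apply: (ssu i j (x' / x)) => //; first by apply: ang_div.
by rewrite expr_div_n mulrA -e mulfK // expf_neq0 // (ang0 Gx).
Qed.

(** The index k of the squares is even, so with m = k - 1 one has G = G + m G.
    The index l of the m-th powers is a multiple of m, so l - 1 is coprime to m,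
    and G = G + (l - 1) G. *)
Lemma equid_ang_double : equid [:: ang_set] [:: ang_set; ang_set].
Proof.
have [k [k0 k2 hk]] := equid_ang_pow (isT : (0 < 2)%N).
have m0 : (0 < k.-1)%N by case: k k0 k2 {hk} => [|[|k]].
have [l [l0 ml hl]] := equid_ang_pow m0.
apply: (@equid_double _ ang_set k.-1 l.-1 m0).
- apply: (@coprime_dvdl _ l) => //.
  by case: l l0 {ml hl} => // l _; rewrite coprimeSn.
- by case: k k0 hk {k2 m0 ml}.
- by case: l l0 hl {ml}.
Qed.

Lemma equid_ang_mul k : equid [:: ang_set] (nseq k.+1 ang_set).
Proof.
elim: k => [|k IH]; first exact: equid_refl.
apply: equid_trans equid_ang_double _.
exact: (@equid_cat _ [:: ang_set] [:: ang_set] [:: ang_set] _ (equid_refl _) IH).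
Qed.

(** G = P + P, where P is the part of G in O: the map x |-> (pi x)^-1 exchanges P
    and its complement in G. *)
Lemma equid_ang_pos : equid [:: ang_set] [:: pos_set; pos_set].
Proof.
have h : equid [:: neg_set] [:: pos_set].
  apply: (@equid_bij _ _ _ (fun x y => y * (pi * x) = 1)).
  - pose x := GRing.Var K 0; pose y := GRing.Var K 1.
    exact: (@env_eq K (GRing.Mul y (GRing.Mul (GRing.Const pi) x)) (GRing.NatConst K 1) isT isT).
  - move=> x [Gx nO]; have [x0 [y Oy e]] := nvringV nO.
    exists y; last by rewrite mulrA [y * _]mulrC -e mulVf.
    split=> //; have -> : y = x^-1 / pi by rewrite e mulrC mulKf ?unif_neq0.
    by apply: ang_div; [apply: angV | apply: ang_unif].
  - move=> y [Gy Oy]; exists (pi * y)^-1.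
      split; first by apply: angV; apply: angM => //; apply: ang_unif.
      exact: unif_mulV (ang0 Gy).
    by field; rewrite unif_neq0 (ang0 Gy).
  - move=> x y y' [Gx _] e e'; have : pi * x != 0 by rewrite mulf_neq0 ?unif_neq0 // (ang0 Gx).
    by move=> n0; apply: (mulIf n0); rewrite e e'.
  - move=> x x' y [Gx _] _ e e'.
    have y0 : y != 0 by apply: contra_eq_neq e => ->; rewrite mul0r eq_sym oner_eq0.
    by apply: (mulfI unif_neq0); apply: (mulfI y0); rewrite e e'.
apply: equid_trans (@equid_cat _ [:: pos_set] [:: pos_set] _ _ (equid_refl _) h).
apply: equid_split => [y|[|[|i]] [|[|j]] y]; rewrite /dsum /= ?nth_nil //.
- split=> [Gy|[[|[|i]]]]; rewrite /= ?nth_nil //; try by case.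
  by have [Oy|nO] := pselect (O y); [exists 0%N|exists 1%N].
- by case=> _ Oy [].
- by move=> [_ nO] [].
Qed.

(** P = P + O: the set pi P is P without the elements of value 0, which form a
    ball, and a ball is in affine bijection with O. *)
Lemma equid_pos_ball : equid [:: pos_set] [:: pos_set; vring_set].
Proof.
have h : equid [:: power_image pos_set pi 0 1; power_image vring_set lam 1 1] [:: pos_set; vring_set].
  apply: (@equid_cat _ [:: _] [:: _] [:: _] [:: _]); apply: equid_scale; [exact: unif_neq0 | exact: radius0].
apply: equid_trans h.
apply: equid_split => [y|[|[|i]] [|[|j]] y]; rewrite /dsum /= ?nth_nil //.
- split=> [[Gy Oy]|[[|[|i]]]]; rewrite /= ?nth_nil //.
  + case: (vring_nunit Oy) => [Oyv|[x Ox e]].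
      exists 1%N => /=; have [w Ow ->] := (ang_unit D y).1 (conj Gy (conj Oy Oyv)).
      by exists w; rewrite // expr1 addrC.
    exists 0%N => /=; exists x; rewrite ?expr1 ?addr0 //; split=> //.
    have -> : x = y / pi by rewrite e mulrC mulKf ?unif_neq0.
    by apply: ang_div => //; apply: ang_unif.
  + case=> x [Gx Ox] ->; rewrite expr1 addr0; split; first by apply: angM => //; apply: ang_unif.
    by apply: (srM sO) => //; apply: vring_unif.
  + by case=> x Ox ->; rewrite expr1 addrC; have [? [? _]] := ball_unit Ox.
- case=> x [Gx Ox]; rewrite expr1 addr0 => -> [w Ow]; rewrite expr1 addrC => e.
  have [_ [_]] := ball_unit Ow; rewrite -e => h'; case: (unif_mulV Ox (ang0 Gx) h').
- case=> w Ow; rewrite expr1 addrC => -> [x [Gx Ox]]; rewrite expr1 addr0 => e.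
  have [_ [_]] := ball_unit Ow; rewrite e => h'; case: (unif_mulV Ox (ang0 Gx) h').
Qed.

(** O without 0 is the union of the cosets of P given by the transversal of G,
    two for each element c of [creps], since -1 is not in G. *)
Lemma equid_vring_pos : equid [:: vring_set]
   (point_set 0 :: nseq (size (creps D)) pos_set ++ nseq (size (creps D)) pos_set).
Proof.
(* the signed transversal: the element of sign b and index i is at b * size cs + i *)
pose cs := creps D; pose cs2 := cs ++ [seq - c | c <- cs].
have cs2P k : (k < size cs2)%N -> exists i (b : bool), [/\ (i < size cs)%N,
    cs2`_k = (-1) ^+ b * cs`_i & k = (b * size cs + i)%N].
  rewrite size_cat size_map => ks; case: (ltnP k (size cs)) => h.
    by exists k, false; rewrite nth_cat h mul1r.
  exists (k - size cs)%N, true; rewrite nth_cat (ltnNge k) h /= (nth_map 0) ?ltn_subLR //.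
  by rewrite mulN1r mul1n subnKC.
have cs2E (b : bool) i : (i < size cs)%N -> cs2`_(b * size cs + i) = (-1) ^+ b * cs`_i.
  move=> i_s; rewrite nth_cat; case: b; last by rewrite mul0n i_s mul1r.
  by rewrite mul1n ltnNge leq_addr /= addKn (nth_map 0) // mulN1r.
have cs2U k : (k < size cs2)%N -> [/\ cs2`_k != 0, O cs2`_k & O (cs2`_k)^-1].
  move=> /cs2P [i [b [i_s -> _]]]; have [c0 Oc Ocv] := creps_unit i_s.
  rewrite mulf_eq0 signr_eq0 (negbTE c0); split=> //.
    by case: b; rewrite ?mulN1r ?mul1r //; apply: (srN sO).
  by case: b; rewrite ?mulN1r ?mul1r ?invrN //; apply: (srN sO).
rewrite -nseqD.
have -> : (size (creps D) + size (creps D))%N = size cs2 by rewrite size_cat size_map.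
have h : equid [seq power_image pos_set c 0 1 | c <- cs2] (nseq (size cs2) pos_set).
  by apply: (@equid_map_nseq _ 0) => k ks; apply: equid_scale; case: (cs2U _ ks).
apply: equid_trans (@equid_cat _ [:: point_set 0] [:: point_set 0] _ _ (equid_refl _) h).
have dsS k y : dsum ([:: point_set 0] ++ [seq power_image pos_set c 0 1 | c <- cs2]) (k, y) <->
   (k = 0%N /\ y = 0) \/ exists2 l, k = l.+1 & (l < size cs2)%N /\ exists2 x, pos_set x & y = cs2`_l * x.
  case: k => [|k].
    by rewrite /dsum /=; split=> [->|[[_ ->]|[]//]] //; left.
  rewrite -[dsum _ _]/(dsum [seq power_image pos_set c 0 1 | c <- cs2] (k, y)).
  split=> [/(dsum_map 0)[ks [x Px ->]]|[[]//|[l [<-] [ls [x Px ->]]]]].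
    by right; exists k => //; split=> //; exists x; rewrite ?expr1 ?addr0.
  by apply/(dsum_map 0); split=> //; exists x; rewrite ?expr1 ?addr0.
apply: equid_split.
- move=> y; split.
    move=> Oy; case: (eqVneq y 0) => [->|y0]; first by exists 0%N; apply/dsS; left.
    have [i i_s Gyi] := creps_cover y0; have [c0 Oc Ocv] := creps_unit i_s.
    have [b Gb] : exists b : bool, G (y / cs2`_(b * size cs + i)).
      case: Gyi => h'; [exists false|exists true]; rewrite cs2E ?mul1r //.
      by rewrite mulN1r invrN mulrN.
    have ls : (b * size cs + i < size cs2)%N.
      by rewrite size_cat size_map; case: (b); rewrite ?mul1n ?mul0n ?ltn_add2l // ltn_addr.
    exists (b * size cs + i).+1; apply/dsS; right; exists (b * size cs + i)%N => //; split=> //.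
    have [d0 Od Odv] := cs2U _ ls.
    by exists (y / cs2`_(b * size cs + i)); [split=> //; apply: (srM sO) | rewrite mulrCA mulfV ?mulr1].
  case=> k /dsS [[_ ->]|[l _ [ls [x [_ Ox] ->]]]]; first exact: (sr0 sO).
  by apply: (srM sO) => //; case: (cs2U _ ls).
- have aux l x : (l < size cs2)%N -> pos_set x -> cs2`_l * x != 0.
    by move=> ls [Gx _]; have [d0 _ _] := cs2U _ ls; rewrite mulf_neq0 // (ang0 Gx).
  move=> k k' y /dsS[[-> ->]|[l -> [ls [x Px ->]]]] /dsS[[-> e]|[l' -> [ls' [x' Px' e]]]] //.
  + by move: (aux _ _ ls' Px'); rewrite -e eqxx.
  + by move: (aux _ _ ls Px); rewrite e eqxx.
  have [i [b [i_s ei ->]]] := cs2P _ ls; have [j [b' [js ej ->]]] := cs2P _ ls'.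
  have [c0 _ _] := creps_unit i_s; have [c0' _ _] := creps_unit js.
  move: e; rewrite ei ej => e.
  have [Gx _] := Px; have [Gx' _] := Px'.
  have e2 : (-1) ^+ (b + b') * (cs`_i / cs`_j) = x' / x.
    have x0 := ang0 Gx.
    apply: (mulIf x0); rewrite divfK // exprD.
    apply: (mulfI c0'); apply: (@mulfI _ ((-1) ^+ b')); first by rewrite signr_eq0.
    rewrite [RHS]mulrA -e.
    have sq : (-1) ^+ b' * (-1) ^+ b' = 1 :> K by rewrite -expr2 sqrr_sign.
    have -> : (-1) ^+ b' * (cs`_j * ((-1) ^+ b * (-1) ^+ b' * (cs`_i / cs`_j) * x)) =
      ((-1) ^+ b' * (-1) ^+ b') * ((-1) ^+ b * cs`_i * x) * (cs`_j / cs`_j) by ring.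
    by rewrite sq mul1r mulfV // mulr1.
  have Gd : G ((-1) ^+ (b + b') * (cs`_i / cs`_j)) by rewrite e2; apply: ang_div.
  have ij : i = j.
    apply: (creps_uniq i_s js).
    move: Gd; case: (b) (b') => -[] /=;
      rewrite ?expr1 ?expr0 ?expr2 ?mulrNN ?mulN1r ?mul1r; by [left|right].
  move: Gd; rewrite -ij mulfV // mulr1.
  by case: (b) (b') => -[] //=; rewrite expr1 => /(@angN1 _ D).
Qed.

Lemma equid_catCA (S T U : seq (dset K)) : equid (S ++ T ++ U) (T ++ S ++ U).
Proof. by rewrite !catA; exact: (equid_cat (equid_catC S T) (equid_refl U)). Qed.

Lemma equid_interleave n : equid (nseq n pos_set ++ nseq n pos_set) (nseq n ang_set).
Proof.
elim: n => [|n IH]; first exact: equid_refl.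
rewrite -[n.+1]add1n !nseqD -catA.
apply: (equid_trans (equid_cat (equid_refl (nseq 1 pos_set))
  (equid_catCA (nseq n pos_set) (nseq 1 pos_set) (nseq n pos_set)))).
by rewrite catA; exact: (equid_cat (equid_sym equid_ang_pos) IH).
Qed.

(** With c the number of pairs of opposite cosets, O = 1 + 2 c P = 1 + c G. Hence
    G = P + P = P + P + O = G + O = 1 + G + c G = 1 + G. *)
Lemma equid_ang_add1 : equid [:: point_set 0; ang_set] [:: ang_set].
Proof.
pose c := size (creps D).
have h1 : equid [:: ang_set] (ang_set :: point_set 0 :: nseq c ang_set).
  apply: equid_trans equid_ang_pos _.
  apply: equid_trans (@equid_cat _ [:: pos_set] _ [:: pos_set] _ (equid_refl _) equid_pos_ball) _.
  apply: (@equid_cat _ [:: pos_set; pos_set] [:: ang_set] [:: vring_set]).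
    exact/equid_sym/equid_ang_pos.
  apply: equid_trans equid_vring_pos _.
  exact: (@equid_cat _ [:: point_set 0] [:: point_set 0] _ _ (equid_refl _) (equid_interleave _)).
apply/equid_sym; apply: equid_trans h1 _.
apply: equid_trans (@equid_catCA [:: ang_set] [:: point_set 0] _) _.
apply: (@equid_cat _ [:: point_set 0] [:: point_set 0]); first exact: equid_refl.
exact/equid_sym/equid_ang_mul.
Qed.

Lemma definable1_true : definable1 (fun _ : K => True).
Proof. by exists (GRing.Bool true). Qed.
Definition line_set := DSet definable1_true.
Definition punctured_set := DSet (definable1_not (definable1_eq 0)).
Definition rest_set := DSet (definable1_and (definable1_not (definable1_eq 0))
  (definable1_not ang_definable)).

Lemma angular_line_bijection :
  definable_bijection [set: 1.-tuple K] [set x : 1.-tuple K | tnth x ord0 != 0].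
Proof.
have h : equid [:: line_set] [:: punctured_set].
  have h1 : equid [:: line_set] [:: point_set 0; ang_set; rest_set].
    apply: equid_split => [y|[|[|[|i]]] [|[|[|j]]] y]; rewrite /dsum /= ?nth_nil //.
    - split=> // _; case: (eqVneq y 0) => [->|/eqP y0]; first by exists 0%N.
      by have [Gy|nG] := pselect (G y); [exists 1%N | exists 2%N].
    - by move=> -> /(@ang0 _ D); rewrite eqxx.
    - by move=> -> [].
    - by move=> /(@ang0 _ D) h e; rewrite e eqxx in h.
    - by move=> Gy [].
    - by move=> [h _] /h.
    - by move=> [_ h] /h.
  apply: equid_trans h1 _.
  apply: equid_trans (@equid_cat _ _ _ [:: rest_set] _ equid_ang_add1 (equid_refl _)) _.
  apply/equid_sym.
  apply: equid_split => [y|[|[|i]] [|[|j]] y]; rewrite /dsum /= ?nth_nil //.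
  - split=> [y0|[[|[|i]]]]; rewrite /= ?nth_nil //.
    + by have [Gy|nG] := pselect (G y); [exists 0%N | exists 1%N].
    + by move/(@ang0 _ D)/eqP.
    + by case.
  - by move=> Gy [].
  - by move=> [_ h] /h.
have := equid_definable_bijection h.
congr (definable_bijection _ _); apply/seteqP; split=> x //=; first by move/eqP.
by move/eqP.
Qed.

End AngularTheory.

(** The class of a point, which is the unit of the ring, is the difference of the
    classes of the line and of the punctured line. *)
Lemma K0_trivial (K : fieldType) :
  definable_bijection [set: 1.-tuple K] [set x : 1.-tuple K | tnth x ord0 != 0] ->
  forall x : K0 K, x = 0.
Proof.
move=> h x.
pose A : defset K 1 := Defset (@definable_true K 1).
have dB : definable [set x : 1.-tuple K | tnth x ord0 != 0].
  have := definable1_tuple (definable1_not (@definable1_eq K 0)).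
  by congr definable; apply/seteqP; split=> y /=; move/eqP.
pose B : defset K 1 := Defset dB.
have e1 : K0_pi (symb A) = K0_pi (symb B).
  apply/K0_piP/K0_null_relation/K0_relation_bijection.
  rewrite (_ : (A : set _) = [set: _]) //.
have e2 : K0_pi (symb A) = K0_pi (symb B + symb (defset_point K)).
  apply/K0_piP/K0_null_relation/K0_relation_union.
    apply/seteqP; split=> y //= _.
    by case: (eqVneq (tnth y ord0) 0) => ?; [right|left].
  by apply/seteqP; split=> y //= [] /eqP h1 h2; apply: h1.
have e3 : (1 : K0 K) = 0.
  have -> : (1 : K0 K) = K0_pi (symb (defset_point K)) by [].
  by move: e2; rewrite K0_piD e1 => /eqP; rewrite -subr_eq0 opprD addrA subrr sub0r oppr_eq0 => /eqP.
by rewrite -[x]mul1r e3 mul0r.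
Qed.

(** * The contraction principle *)

(** A ring that is separated and complete for the powers of tau. It is given
    inside a field, so that power series and the integers of a local field, which
    are treated alike below, are both covered. *)
Record complete_ring (F : fieldType) (R : F -> Prop) (tau : F) : Prop := CompleteRing {
  cr_subring : subring R;
  cr_tau : R tau;
  cr_sep : forall x, (forall k, exists2 w, R w & x = tau ^+ k * w) -> x = 0;
  cr_lim : forall z : nat -> F, (forall k, R (z k)) ->
    (forall k, exists2 w, R w & z k.+1 - z k = tau ^+ k * w) ->
    exists2 l, R l & forall k, exists2 w, R w & l - z k = tau ^+ k * w
}.

Section Contraction.
Variables (F : fieldType) (R : F -> Prop) (tau : F).
Hypothesis HR : complete_ring R tau.

Local Notation sR := (cr_subring HR).

Lemma sr_nat n : R n%:R.
Proof.
elim: n => [|n IH]; first exact: sr0 sR.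
by rewrite -addn1 natrD; apply: (srD sR) => //; apply: sr1 sR.
Qed.

(** The functions to which the contraction principle applies; they include the
    polynomials with coefficients in R. *)
Definition lip (h : F -> F) := (forall x, R x -> R (h x)) /\
  (forall x y, R x -> R y -> exists2 w, R w & h x - h y = (x - y) * w).

Lemma lip_cst c : R c -> lip (fun=> c).
Proof. by move=> Rc; split=> // x y _ _; exists 0; [apply: (sr0 sR) | rewrite subrr mulr0]. Qed.
Lemma lip_id : lip id.
Proof. by split=> // x y _ _; exists 1; [apply: sr1 sR | rewrite mulr1]. Qed.
Lemma lip_add f g : lip f -> lip g -> lip (fun x => f x + g x).
Proof.
move=> [fR fl] [gR gl]; split=> [x Rx|x y Rx Ry]; first by apply: (srD sR); [apply: fR|apply: gR].
have [v Rv e] := fl _ _ Rx Ry; have [w Rw e'] := gl _ _ Rx Ry.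
by exists (v + w); [apply: (srD sR) | rewrite mulrDr -e -e' opprD addrACA].
Qed.
Lemma lip_mul f g : lip f -> lip g -> lip (fun x => f x * g x).
Proof.
move=> [fR fl] [gR gl]; split=> [x Rx|x y Rx Ry]; first by apply: (srM sR); [apply: fR|apply: gR].
have [v Rv e] := fl _ _ Rx Ry; have [w Rw e'] := gl _ _ Rx Ry.
exists (v * g x + f y * w).
  by apply: (srD sR); apply: (srM sR) => //; [apply: gR | apply: fR].
have -> : f x * g x - f y * g y = (f x - f y) * g x + f y * (g x - g y) by ring.
by rewrite e e'; ring.
Qed.
Lemma lip_exp n : lip (fun x => x ^+ n).
Proof.
elim: n => [|n IH].
  by rewrite (_ : (fun _ => _) = fun=> 1); [apply: lip_cst; apply: (sr1 sR) | apply/funext => x; rewrite expr0].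
rewrite (_ : (fun _ => _) = fun x => x * x ^+ n); last by apply/funext => x; rewrite exprS.
exact: lip_mul lip_id IH.
Qed.
Lemma lip_sum (f : nat -> F -> F) n : (forall i, lip (f i)) -> lip (fun x => \sum_(i < n) f i x).
Proof.
move=> hf; elim: n => [|n IH].
  by rewrite (_ : (fun _ => _) = fun=> 0); [apply: lip_cst; apply: (sr0 sR) | apply/funext => x; rewrite big_ord0].
rewrite (_ : (fun _ => _) = fun x => (\sum_(i < n) f i x) + f n x); last by apply/funext => x; rewrite big_ord_recr.
exact: lip_add.
Qed.

(** The map x |-> a - tau h(x) is contracting, and its iterates from 0 converge.
    This is the only form of Hensel's lemma used below. *)
Lemma contraction h a : lip h -> R a -> exists2 x, R x & x + tau * h x = a.
Proof.
move=> [hR hl] Ra.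
pose z := fix z k := if k is k'.+1 then a - tau * h (z k') else 0.
have Rz k : R (z k).
  elim: k => [|k IH] /=; first exact: (sr0 sR).
  by apply: (srB sR) => //; apply: (srM sR); [apply: cr_tau HR | apply: hR].
have dz k : exists2 w, R w & z k.+1 - z k = tau ^+ k * w.
  elim: k => [|k [w Rw e]].
    by exists (z 1%N); rewrite // subr0 mul1r.
  have [v Rv e'] := hl _ _ (Rz k.+1) (Rz k).
  exists (- (w * v)); first by apply: (srN sR); apply: srM sR _ _ _ _.
  have -> : z k.+2 - z k.+1 = - (tau * (h (z k.+1) - h (z k))) by rewrite /=; ring.
  by rewrite e' e exprS; ring.
have [l Rl hlim] := cr_lim HR Rz dz.
exists l => //; apply/eqP; rewrite -subr_eq0; apply/eqP.
apply: (cr_sep HR) => k; have [w Rw e] := hlim k; have [v Rv e'] := hlim k.+1.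
have [u Ru e''] := hl _ _ Rl (Rz k).
exists (tau * v + tau * w * u).
  apply: (srD sR); first by apply: (srM sR) => //; apply: cr_tau HR.
  by apply: (srM sR) => //; apply: (srM sR) => //; apply: cr_tau HR.
have -> : l + tau * h l - a = (l - z k.+1) + tau * (h l - h (z k)) by rewrite /=; ring.
by rewrite e' e'' e exprS; ring.
Qed.

Lemma contraction_uniq h x y : lip h -> R x -> R y ->
  x + tau * h x = y + tau * h y -> x = y.
Proof.
move=> [hR hl] Rx Ry e; have [w Rw e'] := hl _ _ Rx Ry.
have e1 : x - y = (- tau * w) * (x - y).
  have -> : - tau * w * (x - y) = - tau * ((x - y) * w) by ring.
  have ex : x = y + tau * h y - tau * h x by rewrite -e addrK.
  by rewrite -e' {1}ex; ring.
apply/eqP; rewrite -subr_eq0; apply/eqP; apply: (cr_sep HR) => k.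
exists ((- w) ^+ k * (x - y)).
  by apply: (srM sR); [apply: (srX sR); apply: (srN sR) | apply: (srB sR)].
rewrite mulrA -exprMn; elim: k => [|k IH]; first by rewrite mul1r.
by rewrite {1}IH {1}e1 exprSr; ring.
Qed.

(** The n-th powers of the ball 1 + lam R fill the ball 1 + n lam R: by the
    binomial formula, (1 + lam w)^n = 1 + n lam (w + tau h(w)) with the
    coefficients C(n-1, i) lam^i / ((i+1) tau) in h. The hypothesis on lam does
    not involve n, so that one ball serves for all exponents. *)
Section Roots.
Variables (lam : F) (n : nat).
Hypotheses (Fchar0 : forall n, (0 < n)%N -> n%:R != 0 :> F) (n0 : (0 < n)%N).
Hypotheses (tau0 : tau != 0).
Hypothesis lamP : forall i, (0 < i)%N -> R (lam ^+ i / (i.+1%:R * tau)).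

Let d i := 'C(n.-1, i)%:R * (if i == 0%N then 0 else lam ^+ i / (i.+1%:R * tau)).
Let h w := \sum_(i < n) d i * w ^+ i.+1.

Let h_lip : lip h.
Proof.
apply: (@lip_sum (fun i w => d i * w ^+ i.+1)) => i.
apply: lip_mul; last exact: lip_exp.
apply: lip_cst; apply: (srM sR); first exact: sr_nat.
by case: eqP => [_|/eqP]; [exact: (sr0 sR) | rewrite -lt0n; apply: lamP].
Qed.

Let hE w : (1 + lam * w) ^+ n = 1 + n%:R * lam * (w + tau * h w).
Proof.
rewrite exprDn big_ord_recl /= subn0 expr1n expr0 bin0 mulr1 mulr1n; congr (_ + _).
rewrite mulrDr /h /d !mulr_sumr.
under eq_bigr => i _ do rewrite expr1n mul1r /bump /= add1n.
under [in RHS]eq_bigr => i _ do rewrite /=.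
case: n n0 => // m _; rewrite !big_ord_recl /= !bin1 mulr0 mul0r !mulr0 add0r.
congr (_ + _); first by rewrite expr1 -mulr_natl mulrA.
apply: eq_bigr => i _; rewrite /bump /= add1n.
have i0 : i.+2%:R != 0 :> F by apply: Fchar0.
have e : i.+2%:R * 'C(m.+1, i.+2)%:R = m.+1%:R * 'C(m, i.+1)%:R :> F.
  by rewrite -!natrM mul_bin_diag.
rewrite -mulr_natl; apply: (mulfI i0); rewrite [LHS]mulrA e exprMn [lam ^+ i.+2]exprS.
move: (lam ^+ i.+1) (w ^+ i.+2) => a b.
move: i0 {e}; move: (i.+2%:R : F) => x x0.
by field; rewrite tau0 x0.
Qed.

Lemma root_exists c : R c -> exists2 w, R w & (1 + lam * w) ^+ n = 1 + n%:R * lam * c.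
Proof. by move=> Rc; have [w Rw <-] := contraction h_lip Rc; exists w. Qed.

Lemma pow_ball w : R w -> exists2 c, R c & (1 + lam * w) ^+ n = 1 + n%:R * lam * c.
Proof.
move=> Rw; exists (w + tau * h w); last exact: hE.
by apply: (srD sR) => //; apply: (srM sR); [apply: cr_tau HR | case: h_lip => + _; apply].
Qed.

Lemma root_uniq w : lam != 0 -> R w -> (1 + lam * w) ^+ n = 1 -> w = 0.
Proof.
move=> lam0 Rw; rewrite hE -[RHS]addr0 => /addrI/eqP.
rewrite !mulf_eq0 (negbTE lam0) (negbTE (Fchar0 n0)) /= => /eqP e.
apply: (contraction_uniq h_lip) => //; first exact: (sr0 sR).
rewrite e /h big1 ?mulr0 ?addr0 // => i _.
by rewrite expr0n mulr0.
Qed.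
End Roots.
End Contraction.

(** * Laurent series *)

Section LaurentField.
Variable F : fieldType.
Local Notation LF := (laurent F).
Implicit Types (f g : LF) (k : int).

Lemma lcoefD f g i : (f + g) i = f i + g i. Proof. by []. Qed.
Lemma lcoefN f i : (- f) i = - f i. Proof. by []. Qed.
Lemma lcoefB f g i : (f - g) i = f i - g i. Proof. by []. Qed.
Lemma lcoef0 i : (0 : LF) i = 0. Proof. by []. Qed.
Lemma lcoef1 i : (1 : LF) i = (i == 0)%:R. Proof. by []. Qed.

Lemma lcoefM_lead f g k l : (forall i, i < k -> f i = 0) -> (forall i, i < l -> g i = 0) ->
  (f * g) (k + l) = f k * g l /\ forall i, i < k + l -> (f * g) i = 0.
Proof.
move=> fk gl; split; last by move=> i; apply: laurent_conv0.
rewrite -[LHS]/(laurent_conv f g (k + l)) -[k + l]addr0 (laurent_convE 0 fk gl).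
by rewrite /cauchy big_ord_recl big_ord0 /= !addr0.
Qed.

Fact lmono_subproof c k : exists v : int, forall i, i < v -> (if i == k then c else 0 : F) = 0.
Proof. by exists k => i /lt_eqF ->. Qed.
Definition lmono c k : LF := Laurent (lmono_subproof c k).

Lemma lmonoM c k f i : (lmono c k * f) i = c * f (i - k).
Proof.
rewrite -[LHS]/(laurent_conv _ _ _) /laurent_conv.
rewrite -(@fsbig_widen _ _ _ _ [set k]) //; first by rewrite fsbig_set1 /= eqxx.
by move=> j [_ /= /eqP/negbTE ->]; rewrite mul0r.
Qed.

Lemma lmonoMmono a b k l : lmono a k * lmono b l = lmono (a * b) (k + l).
Proof.
apply: laurent_ext => i; rewrite lmonoM /= subr_eq addrC.
by case: eqP; rewrite ?mulr0.
Qed.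

Lemma lmono10 : lmono 1 0 = 1 :> LF.
Proof. by apply: laurent_ext => i /=; case: eqP. Qed.

Lemma lmonoV k : lmono 1 k * lmono 1 (- k) = 1.
Proof. by rewrite lmonoMmono mulr1 subrr lmono10. Qed.

Lemma lmonoX a k n : lmono a k ^+ n = lmono (a ^+ n) (k *+ n).
Proof.
elim: n => [|n IH]; first by rewrite !expr0 mulr0n lmono10.
by rewrite !exprS IH lmonoMmono mulrS.
Qed.

Lemma lmonoD a b k : lmono a k + lmono b k = lmono (a + b) k.
Proof. by apply: laurent_ext => i; rewrite lcoefD /=; case: eqP; rewrite ?addr0. Qed.
Lemma lmono0 k : lmono 0 k = 0.
Proof. by apply: laurent_ext => i /=; case: eqP. Qed.

Lemma lnat n : n%:R = lmono n%:R 0 :> LF.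
Proof.
elim: n => [|n IH]; first by rewrite lmono0.
by rewrite -addn1 !natrD IH -[1%:R]/1 -{1}lmono10 lmonoD.
Qed.

Definition lead f k c := [/\ c != 0, f k = c & forall i, i < k -> f i = 0].

Lemma lead_ex f : f != 0 -> exists k c, lead f k c.
Proof.
move=> f0; have [v fv] := lcoef_bounded f.
have ex_n : exists n : nat, f (v + n%:Z) != 0.
  apply: contrapT => /forallNP h; case/eqP: f0.
  by apply: (laurent_ext_from fv) => // n; apply/eqP/negPn/negP/h.
have [n nP nmin] := ex_minnP ex_n.
exists (v + n%:Z), (f (v + n%:Z)); split=> // i ik.
have [/fv //|vi] := ltP i v.
have e : i = v + `|i - v|%N%:Z by lia.
by apply/eqP; rewrite e; apply: contraT => /nmin; lia.
Qed.

Lemma lead_neq0 f k c : lead f k c -> f != 0.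
Proof. by case=> c0 fk _; apply: contra_neq c0 => f0; rewrite -fk f0. Qed.

Lemma lead_uniq f k c l d : lead f k c -> lead f l d -> k = l /\ c = d.
Proof.
case=> c0 fk fk' [d0 fl fl'].
suff kl : k = l by rewrite -fk -fl kl.
case: (ltgtP k l) => // h.
  by move: c0; rewrite -fk fl' // eqxx.
by move: d0; rewrite -fl fk' // eqxx.
Qed.

Lemma leadM f g k l c d : lead f k c -> lead g l d -> lead (f * g) (k + l) (c * d).
Proof.
case=> c0 fk fk' [d0 gl gl']; have [e h] := lcoefM_lead fk' gl'.
by split=> //; rewrite ?mulf_neq0 // e fk gl.
Qed.

Lemma lead_mono c k : c != 0 -> lead (lmono c k) k c.
Proof. by move=> c0; split=> //= [|i /lt_eqF ->] //; rewrite eqxx. Qed.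

Lemma lead1 : lead 1 0 1.
Proof. by rewrite -lmono10; apply/lead_mono/oner_neq0. Qed.

Lemma leadV f k c : lead f k c -> lead f^-1 (- k) c^-1.
Proof.
move=> h; have f0 := lead_neq0 h; have c0 : c != 0 by case: h.
have [|l [d hd]] := @lead_ex f^-1; first by rewrite invr_eq0.
have := leadM h hd; rewrite mulfV // => /(lead_uniq lead1) [e1 e2].
have -> : - k = l by lia.
have -> : c^-1 = d by rewrite -[d](mulKf c0) -e2 mulr1.
exact: hd.
Qed.

Lemma leadX f k c n : lead f k c -> lead (f ^+ n) (k *+ n) (c ^+ n).
Proof.
move=> h; elim: n => [|n IH]; first by rewrite !expr0 mulr0n; apply: lead1.
by rewrite !exprS mulrS; apply: leadM.
Qed.

Definition pseries f := forall i, i < 0 -> f i = 0.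

Lemma pseriesM0 f g : pseries f -> pseries g -> (f * g) 0 = f 0 * g 0.
Proof. by move=> pf pg; have [] := lcoefM_lead pf pg; rewrite addr0. Qed.

Lemma pseries_mono c : pseries (lmono c 0).
Proof. by move=> i /lt_eqF /= ->. Qed.

Lemma pseriesM f g : pseries f -> pseries g -> pseries (f * g).
Proof. by move=> pf pg i i0; have [_] := lcoefM_lead pf pg; rewrite addr0; apply. Qed.

Lemma pseriesX f n : pseries f -> pseries (f ^+ n) /\ (f ^+ n) 0 = f 0 ^+ n.
Proof.
move=> pf; elim: n => [|n [IH e]]; first by split=> // i /lt_eqF; rewrite expr0 lcoef1 => ->.
by rewrite !exprS; split; [apply: pseriesM | rewrite pseriesM0 // e].
Qed.

Lemma pseries_shift f k : (forall i, i < k -> f i = 0) ->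
  pseries (lmono 1 (- k) * f) /\ f = lmono 1 k * (lmono 1 (- k) * f).
Proof.
move=> fk; split; last by rewrite mulrA lmonoV mul1r.
by move=> i i0; rewrite lmonoM mul1r fk //; lia.
Qed.

Lemma pseries_complete : complete_ring pseries (lmono 1 1).
Proof.
have XE n : lmono 1 1 ^+ n = lmono 1 n by rewrite lmonoX expr1n natz.
split.
- split; first by move=> i /lt_eqF; rewrite lcoef1 => ->.
  + by move=> f g pf pg i i0; rewrite lcoefB pf ?pg ?subr0.
  + exact: pseriesM.
- by move=> i i0 /=; case: eqP i0 => // ->.
- move=> f h; apply: laurent_ext => i; rewrite lcoef0.
  have [w pw ->] := h (`|i|%N.+1).
  by rewrite XE lmonoM pw ?mulr0 //; lia.
move=> z pz dz.
have dz' (k : nat) (i : int) : i < k%:Z -> z k.+1 i = z k i.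
  move=> ik; apply/eqP; rewrite -subr_eq0 -lcoefB; have [w pw ->] := dz k.
  by rewrite XE lmonoM pw ?mulr0 //; lia.
have dzm (m k : nat) (i : int) : i < k%:Z -> z (k + m)%N i = z k i.
  move=> ik; elim: m => [|m IH]; first by rewrite addn0.
  by rewrite addnS dz' // (lt_le_trans ik) // lez_nat leq_addr.
have lb : exists v : int, forall i, i < v -> (if i < 0 then 0 else z `|i|%N.+1 i) = 0.
  by exists 0 => i ->.
exists (Laurent lb); first by move=> i /= ->.
move=> k; have h (i : int) : i < k%:Z -> (Laurent lb - z k) i = 0.
  move=> ik; rewrite lcoefB /=; case: ltP => i0; first by rewrite pz ?subr0.
  apply/eqP; rewrite subr_eq0; apply/eqP.
  have -> : k = (`|i|.+1 + (k - `|i|.+1))%N by lia.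
  by rewrite dzm //; lia.
have [pw e] := pseries_shift h; exists (lmono 1 (- k%:Z) * (Laurent lb - z k)) => //.
by rewrite XE.
Qed.

Section OneUnits.
Hypothesis F0 : forall n, (0 < n)%N -> n%:R != 0 :> F.

Lemma laurent_char0 n : (0 < n)%N -> n%:R != 0 :> LF.
Proof.
by move=> n0; rewrite lnat; apply: lead_neq0 (lead_mono 0 (F0 n0)).
Qed.

Lemma tneq0 : lmono 1 1 != 0 :> LF.
Proof. exact: lead_neq0 (lead_mono 1 (oner_neq0 F)). Qed.

Lemma natV_pseries n : (0 < n)%N -> pseries (n%:R^-1).
Proof.
move=> n0; have := leadV (lead_mono 0 (F0 n0)); rewrite -lnat oppr0.
by case=> _ _.
Qed.

(** The hypothesis on the ball, for lam = tau = t: it holds because the integers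
    are invertible constants. *)
Lemma tpowP i : (0 < i)%N -> pseries (lmono 1 1 ^+ i / (i.+1%:R * lmono 1 1)).
Proof.
case: i => // i _; rewrite exprSr invfM mulrA mulrAC mulfK ?tneq0 //.
apply: pseriesM; last exact: natV_pseries.
by have [] := pseriesX i (cr_tau pseries_complete).
Qed.

Lemma one_unit_shift u : pseries u -> u 0 = 1 -> exists2 c, pseries c & u = 1 + lmono 1 1 * c.
Proof.
move=> pu u0.
have h i : i < 1 -> (u - 1) i = 0.
  move=> i1; rewrite lcoefB lcoef1; case: (ltgtP i 0) => i0; last by rewrite i0 u0 subrr.
    by rewrite pu // subr0.
  by lia.
have [pw e] := pseries_shift h; exists (lmono 1 (-1) * (u - 1)) => //.
by rewrite -e addrC subrK.
Qed.

Lemma one_unit_root n u : (0 < n)%N -> pseries u -> u 0 = 1 ->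
  exists2 w, pseries w & w 0 = 1 /\ w ^+ n = u.
Proof.
move=> n0 pu u0; have [c pc ->] := one_unit_shift pu u0.
have hc : pseries (n%:R^-1 * c) by apply: pseriesM => //; apply: natV_pseries.
have [w pw e] := root_exists pseries_complete laurent_char0 n0 tneq0 tpowP hc.
exists (1 + lmono 1 1 * w).
  have sR := cr_subring pseries_complete.
  apply: (srD sR); first exact: (sr1 sR).
  by apply: pseriesM => //; exact: (cr_tau pseries_complete).
split; first by rewrite lcoefD lcoef1 lmonoM pw ?mulr0 ?addr0.
rewrite e; congr (_ + _); rewrite mulrAC mulrA mulfV ?laurent_char0 // mul1r mulrC //.
Qed.

Lemma one_unit_root_uniq n u : (0 < n)%N -> pseries u -> u 0 = 1 -> u ^+ n = 1 -> u = 1.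
Proof.
move=> n0 pu u0; have [c pc ->] := one_unit_shift pu u0 => e.
have -> := root_uniq pseries_complete laurent_char0 n0 tneq0 tpowP tneq0 pc e.
by rewrite mulr0 addr0.
Qed.
End OneUnits.
End LaurentField.

(** * Angular data on Laurent series *)

Section LaurentStep.
Variables (F : fieldType) (D : angular_field F).
Local Notation LF := (laurent F).
Implicit Types (f g : LF).
Local Notation O := (vring D).
Local Notation G := (ang D).
Local Notation pi := (unif D).
Local Notation lam := (radius D).
Local Notation sO := (vring_subring D).

(** The valuation of F((t)) is the composite of the order in t with the valuation
    of F: in the group of values the order in t dominates, and [unif] and the
    ball keep their constants. A series is read through its leading coefficient:
    it has angular component 1 exactly when that coefficient has. *)
Definition lvring f := pseries f /\ O (f 0).
Definition lang f := exists k c, lead f k c /\ G c.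

Lemma lvring_lead f k c : lead f k c -> lvring f <-> (0 < k \/ k = 0 /\ O c).
Proof.
case=> c0 fk fk'; split=> [[pf Of]|].
  case: (ltgtP k 0) => h; [|by left|by right; rewrite -fk h].
  by move: c0; rewrite -fk pf // eqxx.
case=> [k0|[k0 Oc]].
  split=> [i i0|]; first by apply: fk'; apply: lt_trans k0.
  by rewrite fk' //; apply: (sr0 sO).
by split=> [i i0|]; [apply: fk'; rewrite k0 | rewrite -k0 fk].
Qed.

Lemma lvringV f : lvring f \/ lvring f^-1.
Proof.
have [->|f0] := eqVneq f 0; first by left; split=> //; apply: (sr0 sO).
have [k [c h]] := lead_ex f0; rewrite (lvring_lead h) (lvring_lead (leadV h)).
case: (ltgtP k 0) => k0; [right|left|]; last 1 first.
- by case: (vringV D c); [left; right | right; right]; rewrite k0 ?oppr0.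
- by left; lia.
- by left.
Qed.

Lemma lmonoK a f : a != 0 -> lmono a 0 * (lmono a^-1 0 * f) = f.
Proof. by move=> a0; rewrite mulrA lmonoMmono mulfV // lmono10 mul1r. Qed.

Lemma lvring_divc a f y : a != 0 -> pseries f -> f 0 = a * y -> O y ->
  exists2 g, lvring g & f = lmono a 0 * g.
Proof.
move=> a0 pf f0 Oy; exists (lmono a^-1 0 * f); last by rewrite lmonoK.
split; first by apply: pseriesM => //; apply: pseries_mono.
by rewrite lmonoM subr0 f0 mulKf.
Qed.

Lemma lead_pseries f : pseries f -> f 0 != 0 -> lead f 0 (f 0).
Proof. by []. Qed.

Lemma lvring_nunit f : lvring f -> lvring f^-1 \/ exists2 g, lvring g & f = lmono pi 0 * g.
Proof.
move=> [pf Of]; have [f0|f0] := eqVneq (f 0) 0.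
  by right; apply: (@lvring_divc pi f 0) => //; [exact: unif_neq0 | rewrite mulr0 | exact: (sr0 sO)].
case: (vring_nunit Of) => [Ov|[y Oy e]]; last by right; apply: lvring_divc e Oy => //; exact: unif_neq0.
by left; rewrite (lvring_lead (leadV (lead_pseries pf f0))) oppr0; right.
Qed.

(** First solve for the constant term, in F; as 1 + 2 z0 is nonzero, the rest is
    an instance of the contraction principle for power series. *)
Lemma lartin_schreier a : lvring a -> exists z, z ^+ 2 + z = lmono pi 0 * a.
Proof.
move=> [pa Oa0]; have [z0 hz0] := artin_schreier Oa0.
pose d := 1 + z0 *+ 2.
have d0 : d != 0.
  have e : d ^+ 2 = 1 - pi * (- (a 0 *+ 4)).
    have -> : pi * - (a 0 *+ 4) = - (pi * a 0) *+ 4 by ring.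
    by rewrite -hz0 /d; ring.
  apply/eqP => h; move: e; rewrite h expr2 mul0r => /esym/eqP; rewrite subr_eq0.
  apply/negP/unif_mul_neq1; apply: (srN sO); rewrite -mulr_natr; apply: (srM sO) => //.
  have O1 := sr1 sO; have -> : 4%:R = 1 + 1 + (1 + 1) :> F by ring.
  by do !apply: (srD sO).
have CR := pseries_complete F.
have pz c : pseries (lmono c 0 : LF) by exact: pseries_mono.
have ha (i : int) : i < 1 -> (a - lmono (a 0) 0) i = 0.
  move=> i1; rewrite lcoefB /=; case: (ltgtP i 0) => i0; last by rewrite i0 subrr.
    by rewrite pa // subr0.
  by lia.
have [pa' ea] := pseries_shift ha; set a' := (lmono _ _ * _) in pa' ea.
have hl : lip (@pseries F) (fun w : LF => w ^+ 2 * lmono d^-1 0).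
  by apply: (lip_mul CR); [exact: (lip_exp CR) | apply: (lip_cst CR)].
have ha' : pseries (lmono (pi / d) 0 * a') by apply: pseriesM.
have [w pw e] := contraction CR hl ha'.
exists (lmono z0 0 + lmono 1 1 * w).
have ea2 : a = lmono (a 0) 0 + lmono 1 1 * a' by rewrite -ea addrC subrK.
rewrite ea2 mulrDr lmonoMmono addr0 -hz0.
have dV : lmono d 0 * lmono d^-1 0 = 1 :> LF by rewrite lmonoMmono mulfV // addr0 lmono10.
have piE : lmono pi 0 = lmono d 0 * lmono (pi / d) 0 :> LF.
  by rewrite lmonoMmono mulrC divfK // addr0.
have dE : lmono d 0 = 1 + lmono z0 0 *+ 2 :> LF.
  by rewrite /d [in RHS]mulr2n -lmono10 !lmonoD -mulr2n.
have zE : lmono (z0 ^+ 2 + z0) 0 = lmono z0 0 ^+ 2 + lmono z0 0 :> LF.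
  by rewrite lmonoX mul0rn lmonoD.
rewrite zE.
have -> : lmono pi 0 * (lmono 1 1 * a') = lmono 1 1 * (lmono d 0 * (lmono (pi / d) 0 * a')).
  by rewrite piE; ring.
rewrite -e.
have -> : lmono d 0 * (w + lmono 1 1 * (w ^+ 2 * lmono d^-1 0)) =
  lmono d 0 * w + (lmono d 0 * lmono d^-1 0) * (lmono 1 1 * w ^+ 2) by ring.
by rewrite dV dE; ring.
Qed.

Lemma lang_mono c k : G c -> lang (lmono c k).
Proof. by move=> Gc; exists k, c; split=> //; apply/lead_mono/(ang0 Gc). Qed.

Lemma lang_lead f k c : lead f k c -> lang f <-> G c.
Proof.
move=> h; split=> [[l [d [h' Gd]]]|Gc]; last by exists k, c.
by have [_ ->] := lead_uniq h h'.
Qed.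

Lemma luexpP f : f != 0 -> lvring f -> lvring f^-1 ->
  exists2 g, lvring g & f ^+ uexp D = 1 + lmono lam 0 * g.
Proof.
move=> f0; have [k [c h]] := lead_ex f0; have c0 : c != 0 by case: h.
rewrite (lvring_lead h) (lvring_lead (leadV h)) => -[k0|[k0 Oc]] [k1|[k1 Ov]]; try lia.
have pf : pseries f by case: h => _ _; rewrite k0.
have [w Ow e] := uexpP c0 Oc Ov; have [pfn fn0] := pseriesX (uexp D) pf.
have [||||g Og eg] := @lvring_divc lam (f ^+ uexp D - 1) w; rewrite ?(radius0 D) //.
- by move=> i i0; rewrite lcoefB lcoef1 pfn // (lt_eqF i0) subr0.
- by rewrite lcoefB lcoef1 fn0 eqxx; case: h => _; rewrite k0 => -> _; rewrite e addrC addKr.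
by exists g => //; rewrite -eg addrC subrK.
Qed.

Lemma lang_unit f : (lang f /\ lvring f /\ lvring f^-1) <->
  exists2 g, lvring g & f = 1 + lmono lam 0 * g.
Proof.
split.
  case=> -[k [c [h Gc]]] []; rewrite (lvring_lead h) (lvring_lead (leadV h)).
  move=> -[k0|[k0 Oc]] [k1|[k1 Ov]]; try lia.
  have pf : pseries f by case: h => _ _; rewrite k0.
  have [w Ow e] := (ang_unit D c).1 (conj Gc (conj Oc Ov)).
  have [||||g Og eg] := @lvring_divc lam (f - 1) w; rewrite ?(radius0 D) //.
  - by move=> i i0; rewrite lcoefB lcoef1 pf // (lt_eqF i0) subr0.
  - by rewrite lcoefB lcoef1 eqxx; case: h => _; rewrite k0 => -> _; rewrite e addrC addKr.
  by exists g => //; rewrite -eg addrC subrK.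
case=> g [pg Og] fE.
have pf : pseries f.
  rewrite fE.
  apply: (srD (cr_subring (pseries_complete F))); first exact: (sr1 (cr_subring (pseries_complete F))).
  by apply: pseriesM => //; apply: pseries_mono.
have f0 : f 0 = 1 + lam * g 0 by rewrite fE lcoefD lcoef1 eqxx lmonoM subr0.
have [Gf [Of Ov]] := ball_unit Og.
have h : lead f 0 (f 0) by apply: lead_pseries => //; rewrite f0; apply: ang0 Gf.
rewrite (lang_lead h) (lvring_lead h) (lvring_lead (leadV h)) f0 oppr0.
by split=> //; split; right.
Qed.

Lemma langN1 : ~ lang (-1).
Proof.
have h : lead (-1 : LF) 0 (-1).
  by split=> [||i /lt_eqF]; rewrite ?oppr_eq0 ?oner_eq0 // lcoefN lcoef1 // => ->; rewrite oppr0.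
by rewrite (lang_lead h); apply: angN1.
Qed.

Lemma leadN f k c : lead f k c -> lead (- f) k (- c).
Proof.
by case=> c0 fk fk'; split=> [||i /fk'] /=; rewrite ?oppr_eq0 // ?fk // => ->; rewrite oppr0.
Qed.

Lemma lead_divm f k c d : d != 0 -> lead f k c -> lead (f / lmono d 0) k (c / d).
Proof. by move=> d0 h; rewrite -[k]addr0 -oppr0; apply: leadM h (leadV (lead_mono 0 d0)). Qed.

Local Notation lreps := [seq lmono c 0 : LF | c <- creps D].

Lemma lrepsE i : (i < size lreps)%N -> (i < size (creps D))%N /\ lreps`_i = lmono (creps D)`_i 0.
Proof. by rewrite size_map => h; rewrite (nth_map 0). Qed.

Lemma lreps_unit i : (i < size lreps)%N ->
  [/\ lreps`_i != 0, lvring lreps`_i & lvring (lreps`_i)^-1].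
Proof.
move=> /lrepsE [i_s ->]; have [c0 Oc Ov] := creps_unit i_s; have h := lead_mono 0 c0.
split; first exact: lead_neq0 h.
  by rewrite (lvring_lead h); right.
by rewrite (lvring_lead (leadV h)) oppr0; right.
Qed.

Lemma lreps_cover f : f != 0 -> exists2 i, (i < size lreps)%N &
    lang (f / lreps`_i) \/ lang (- (f / lreps`_i)).
Proof.
move=> /lead_ex [k [c h]]; have c0 : c != 0 by case: h.
have [i i_s hi] := creps_cover D c0; have [d0 _ _] := creps_unit i_s.
exists i; rewrite ?size_map // (nth_map 0) //.
have h' := lead_divm d0 h.
by rewrite (lang_lead h') (lang_lead (leadN h')).
Qed.

Lemma lreps_uniq i j : (i < size lreps)%N -> (j < size lreps)%N ->
  lang (lreps`_i / lreps`_j) \/ lang (- (lreps`_i / lreps`_j)) -> i = j.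
Proof.
move=> /lrepsE [i_s ->] /lrepsE [js ->].
have [c0 _ _] := creps_unit i_s; have [d0 _ _] := creps_unit js.
have h' := lead_divm d0 (lead_mono 0 c0).
rewrite (lang_lead h') (lang_lead (leadN h')); exact: creps_uniq.
Qed.

(** The order in t contributes n classes t^i, and a series with leading term 1 has
    an n-th root. *)
Lemma lang_pow n : (0 < n)%N ->
  exists2 ss : seq LF, (n %| size ss)%N & power_transversal lang n ss.
Proof.
move=> n0; have [ss ns [ssG ssc ssu]] := ang_pow D n0.
(* the index i n + r, with r < n, codes the pair of the i-th element of ss and t^r *)
pose f j : LF := lmono ss`_(j %/ n) (j %% n)%N.
have sz : size (mkseq f (size ss * n)) = (size ss * n)%N by rewrite size_mkseq.
have nE j : (j < size ss * n)%N -> (j %/ n < size ss)%N /\ (mkseq f (size ss * n))`_j = f j.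
  by move=> h; rewrite nth_mkseq // ltn_divLR.
exists (mkseq f (size ss * n)); rewrite ?sz; first exact: dvdn_mull.
rewrite /power_transversal sz; split.
- by move=> i /nE [h ->]; apply/lang_mono/ssG.
- move=> g [k [c [h /ssc[i i_s [y Gy cE]]]]].
  have c0 : c != 0 by case: h.
  pose r := `|(k %% n%:Z)%Z|%N; pose q := (k %/ n%:Z)%Z.
  have nZ : n%:Z != 0 by rewrite -lt0n in n0 *; lia.
  have rk : r%:Z = (k %% n%:Z)%Z by rewrite /r gez0_abs // modz_ge0.
  have rn : (r < n)%N by rewrite -ltz_nat rk ltz_pmod //; lia.
  pose u := lmono c^-1 (- k) * g.
  have gE : g = lmono c k * u.
    by rewrite /u mulrA lmonoMmono mulfV // subrr lmono10 mul1r.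
  have hu : lead u 0 1.
    rewrite -(subrr k) -(mulVf c0) addrC; apply: leadM h; apply: lead_mono.
    by rewrite invr_eq0.
  have [pu u0] : pseries u /\ u 0 = 1 by case: hu.
  have [w pw [w0 wn]] := one_unit_root (char0 D) n0 pu u0.
  have hw : lead w 0 1 by split=> //; rewrite oner_eq0.
  have ltx : (i * n + r < size ss * n)%N.
    apply: (@leq_trans (i.+1 * n)); last by rewrite leq_mul2r i_s orbT.
    by rewrite mulSn addnC ltn_add2r.
  exists (i * n + r)%N => //; exists (lmono y q * w).
    exists (q + 0), (y * 1); split; last by rewrite mulr1.
    by apply: leadM => //; apply/lead_mono/(ang0 Gy).
  have [_ ->] := nE _ ltx; rewrite /f divnMDl // divn_small // addn0 modnMDl modn_small //.
  rewrite exprMn wn mulrA lmonoX lmonoMmono -cE gE; congr (lmono _ _ * _).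
  by rewrite rk {1}(divz_eq k n) addrC -mulr_natr natz.
- move=> i j g /nE [i_s ->] /nE [js ->] [k [c [h Gc]]] e.
  have := leadM (lead_mono (j %% n)%N (ang0 (ssG _ js))) (leadX n h).
  rewrite -[_ * _]e => /(lead_uniq (lead_mono _ (ang0 (ssG _ i_s)))) [e1 e2].
  have ij : (i %/ n = j %/ n)%N by apply: ssu e2.
  suff ij' : (i %% n = j %% n)%N by rewrite (divn_eq i n) (divn_eq j n) ij ij'.
  have hi := ltn_pmod i n0; have hj := ltn_pmod j n0.
  move: e1; rewrite -mulr_natr natz => e1.
  have := congr1 (fun x => (x %% n%:Z)%Z) e1 => /=; rewrite addrC modzMDl !modz_small; lia.
Qed.

Lemma lang_tor n f : (0 < n)%N -> lang f -> f ^+ n = 1 -> f = 1.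
Proof.
move=> n0 [k [c [h Gc]]] e; have := leadX n h; rewrite e => /(lead_uniq (lead1 F)) [e1 e2].
have c1 : c = 1 by apply: (ang_tor n0 Gc).
have k0 : k = 0.
  by move/esym/eqP: e1; rewrite mulrn_eq0 gtn_eqF //= => /eqP.
case: h => _; rewrite k0 c1 => u0 pu.
exact: (one_unit_root_uniq (char0 D) n0).
Qed.

Lemma lvring_subring : subring lvring.
Proof.
split.
- by split; [exact: (sr1 (cr_subring (pseries_complete F))) | rewrite lcoef1 eqxx; apply: (sr1 sO)].
- move=> f g [pf Of] [pg Og]; split; first exact: (srB (cr_subring (pseries_complete F))).
  by rewrite lcoefB; apply: (srB sO).
move=> f g [pf Of] [pg Og]; split; first exact: pseriesM.
by rewrite pseriesM0 //; apply: (srM sO).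
Qed.
Lemma lvring_unif : lvring (lmono pi 0).
Proof. by split; [exact: pseries_mono | rewrite /= ?eqxx; apply: vring_unif]. Qed.
Lemma lunif_nunit : ~ lvring (lmono pi 0)^-1.
Proof.
rewrite (lvring_lead (leadV (lead_mono 0 (unif_neq0 D)))) oppr0 => -[//|[_]].
exact: unif_nunit.
Qed.
Lemma lrad0 : lmono lam 0 != 0 :> LF.
Proof. exact: lead_neq0 (lead_mono 0 (radius0 D)). Qed.
Lemma lang0 f : lang f -> f != 0.
Proof. by case=> k [c [h _]]; apply: lead_neq0 h. Qed.
Lemma lang_div f g : lang f -> lang g -> lang (f / g).
Proof.
move=> [k [c [h Gc]]] [l [d [h' Gd]]]; exists (k - l), (c / d).
by split; [apply: leadM => //; apply: leadV | apply: ang_div].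
Qed.

Definition laurent_angular : angular_field LF :=
  AngularField (laurent_char0 (char0 D)) lvring_subring lvringV lvring_unif
    lunif_nunit lvring_nunit lartin_schreier lrad0 (uexp_gt0 D) luexpP
    lang0 lang_div (lang_mono 0 (ang_unif D)) lang_unit langN1
    (And3 lreps_unit lreps_cover lreps_uniq) lang_pow lang_tor.
End LaurentStep.

(** * Complete discrete valuation rings of mixed characteristic *)

(** [dvr p O pi]: O is a complete discrete valuation ring of the field F of
    characteristic zero, with uniformizer pi, residue characteristic p and finite
    residue rings, the latter in the form of a finite invariant that separates
    the classes modulo mu. *)
Record dvr (F : fieldType) (p : nat) (O : F -> Prop) (pi : F) : Prop := Dvr {
  dvr_char0 : forall n, (0 < n)%N -> n%:R != 0 :> F;
  dvr_cr : complete_ring O pi;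
  dvrV : forall x, O x \/ O x^-1;
  dvr_piV : ~ O pi^-1;
  dvr_nunit : forall x, O x -> O x^-1 \/ exists2 y, O y & x = pi * y;
  dvr_p : exists2 w, O w & p%:R = pi * w;
  dvr_fin : forall mu, O mu -> mu != 0 -> exists (T : finType) (r : F -> T),
    forall x y, O x -> O y -> r x = r y -> exists2 w, O w & x - y = mu * w
}.

Section DvrAngular.
Variables (F : fieldType) (p : nat) (p_pr : prime p) (O : F -> Prop) (pi : F).
Hypothesis HO : dvr p O pi.
Let CR := dvr_cr HO.
Let sO := cr_subring CR.
Let char0 := dvr_char0 HO.

Let lam : F := p%:R ^+ 2.

Let pi_neq0 : pi != 0.
Proof. by apply/eqP => h; apply: (dvr_piV HO); rewrite h invr0; apply: (sr0 sO). Qed.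

Let p0 : p%:R != 0 :> F. Proof. by apply/char0/prime_gt0. Qed.
Let lam_neq0 : lam != 0. Proof. by rewrite expf_neq0. Qed.
Let Op : O p%:R. Proof. exact: (sr_nat CR). Qed.
Let Olam : O lam. Proof. exact: (srX sO). Qed.

Let n1pi y : O y -> 1 = pi * y -> False.
Proof.
move=> Oy e; apply: (dvr_piV HO).
by rewrite -[_^-1]mulr1 e mulKf.
Qed.

Let lam_pi : exists2 w, O w & lam = pi * w.
Proof.
have [w Ow e] := dvr_p HO.
by exists (w * p%:R); [apply: (srM sO) | rewrite /lam expr2 {1}e mulrA].
Qed.

Definition dunit u := [/\ u != 0, O u & O u^-1].

Lemma dunitM u v : dunit u -> dunit v -> dunit (u * v).
Proof. by move=> [u0 Ou Ouv] [v0 Ov Ovv]; split; rewrite ?mulf_neq0 ?invfM //; apply: (srM sO). Qed.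
Lemma dunitV u : dunit u -> dunit u^-1.
Proof. by move=> [u0 Ou Ouv]; split; rewrite ?invr_eq0 ?invrK. Qed.
Lemma dunit1 : dunit 1.
Proof. by split; rewrite ?oner_neq0 ?invr1 //; apply: (sr1 sO). Qed.

Lemma dunit_one_add w : O w -> dunit (1 + pi * w).
Proof.
move=> Ow; have Ob : O (1 + pi * w).
  by apply: (srD sO); [apply: (sr1 sO) | apply: (srM sO) => //; apply: (cr_tau CR)].
have nb y : O y -> 1 + pi * w <> pi * y.
  move=> Oy e; apply: (@n1pi (y - w)); first exact: (srB sO).
  by rewrite mulrBr -e addrK.
split=> //.
  by apply/eqP => h; apply: (nb 0); [apply: (sr0 sO) | rewrite h mulr0].
by case: (dvr_nunit HO Ob) => // -[y /nb].
Qed.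

Lemma dunit_ball w : O w -> dunit (1 + lam * w).
Proof. by move=> Ow; have [v Ov ->] := lam_pi; rewrite -mulrA; apply: dunit_one_add; apply: (srM sO). Qed.

Lemma dunitX u n : dunit u -> dunit (u ^+ n).
Proof.
move=> h; elim: n => [|n IH]; first by rewrite expr0; apply: dunit1.
by rewrite exprS; apply: dunitM.
Qed.

Lemma dunit_pi k : dunit (pi ^ k) -> k = 0.
Proof.
have aux n : ~ O (pi ^+ n.+1)^-1.
  move=> h; apply: (dvr_piV HO); rewrite -[_^-1](mulfK (expf_neq0 n pi_neq0)).
  rewrite -mulrA [pi ^+ n * _]mulrC mulrA -invfM -exprS mulrC.
  by apply: (srM sO) => //; apply: (srX sO); apply: (cr_tau CR).
case: k => [[|n]|n] // [_ h h'].
  by case: (aux n).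
by case: (aux n); rewrite NegzE in h.
Qed.

Lemma dunit_nat n : coprime p n -> O (n%:R^-1).
Proof.
move=> pn; case: (dvr_nunit HO (sr_nat CR n)) => // -[y Oy e].
case: n pn e => [|n] pn e.
  by move: pn; rewrite /coprime gcdn0 => /eqP h; move: p_pr; rewrite h.
have [w Ow ep] := dvr_p HO.
have [a b e1 _] := egcdnP p (ltn0Sn n).
case: (@n1pi (a%:R * y - b%:R * w)).
  by apply: (srB sO); apply: (srM sO) => //; apply: (sr_nat CR).
have -> : pi * (a%:R * y - b%:R * w) = a%:R * (pi * y) - b%:R * (pi * w) by ring.
have cop : gcdn n.+1 p = 1%N by apply/eqP; rewrite gcdnC.
by rewrite -e -ep -!natrM e1 cop natrD addrAC subrr add0r.
Qed.

(** With radius p^2 the binomial coefficients of the n-th power map are harmless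
    for all n at once: i + 1 = p^a m with a <= i and m prime to p. *)
Lemma ball_radiusP i : (0 < i)%N -> O (lam ^+ i / (i.+1%:R * pi)).
Proof.
case: i => // i _; have [m pm e] := pfactor_coprime p_pr (ltn0Sn i.+1).
set a := logn p i.+2 in e; have ai : (a <= i.+1)%N by rewrite -ltnS ltn_logl.
have [w Ow ep] := dvr_p HO.
have m0 : m%:R != 0 :> F by apply: char0; case: m e {pm}.
have -> : lam ^+ i.+1 / (i.+2%:R * pi) = p%:R ^+ (i.+1 - a) * p%:R ^+ i * w * m%:R^-1.
  have e1 : i.+2%:R = m%:R * p%:R ^+ a :> F by rewrite {1}e natrM natrX.
  have e2 : lam ^+ i.+1 = p%:R ^+ (i.+1 - a) * p%:R ^+ a * (p%:R ^+ i * (pi * w)).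
    by rewrite -ep -exprD subnK // -exprSr -exprD /lam -exprM mul2n addnn.
  rewrite e1 e2; have pa : p%:R ^+ a != 0 :> F by rewrite expf_neq0.
  by field; rewrite m0 pi_neq0 pa.
apply: (srM sO); last exact: dunit_nat.
by apply: (srM sO) => //; apply: (srM sO); apply: (srX sO).
Qed.

Let ball_pow n w : (0 < n)%N -> O w -> exists2 c, O c & (1 + lam * w) ^+ n = 1 + n%:R * lam * c.
Proof. by move=> n0; apply: (pow_ball CR char0 n0 pi_neq0 ball_radiusP). Qed.

Let ball_root n c : (0 < n)%N -> O c -> exists2 w, O w & (1 + lam * w) ^+ n = 1 + n%:R * lam * c.
Proof. by move=> n0; apply: (root_exists CR char0 n0 pi_neq0 ball_radiusP). Qed.

(** Some power u^(j - i) with i < j at most the number of classes lies in the ball;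
    the exponent is the factorial of that number, a common multiple. *)
Lemma dunit_exp : exists2 N, (0 < N)%N & forall u, u != 0 -> O u -> O u^-1 ->
  exists2 w, O w & u ^+ N = 1 + lam * w.
Proof.
have [T [r rP]] := dvr_fin HO Olam lam_neq0.
exists (#|T|)`!; first exact: fact_gt0.
move=> u u0 Ou Ov.
have [i [j [ij jT e]]] := pigeonhole (fun i => r (u ^+ i)).
have [w Ow ew] := rP (u ^+ j) (u ^+ i) (srX sO _ Ou) (srX sO _ Ou) (esym e).
have h : u ^+ (j - i) = 1 + lam * (w / u ^+ i).
  have ui : u ^+ i != 0 by rewrite expf_neq0.
  by apply: (mulIf ui); rewrite -exprD subnK 1?ltnW // mulrDl mul1r mulrA mulfVK // -ew addrC subrK.
have Ow' : O (w / u ^+ i) by rewrite -exprVn; apply: (srM sO) => //; apply: (srX sO).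
have /dvdnP [q ->] : (j - i %| (#|T|)`!)%N.
  by apply: dvdn_fact; rewrite subn_gt0 ij (leq_trans (leq_subr _ _)).
rewrite mulnC exprM h.
have [|q0] := leqP q 0.
  by rewrite leqn0 => /eqP ->; exists 0; [apply: (sr0 sO) | rewrite mulr0 addr0 expr0].
have [c Oc ->] := ball_pow q0 Ow'.
by exists (q%:R * c); [apply: (srM sO) => //; apply: (sr_nat CR) | ring].
Qed.

(** The subgroup generated by pi and the ball 1 + p^2 O. *)
Definition dang x := exists k w, O w /\ x = pi ^ k * (1 + lam * w).

Lemma dang_ball w : O w -> dang (1 + lam * w).
Proof. by move=> Ow; exists 0, w; rewrite expr0z mul1r. Qed.

Lemma ball_div v w : O v -> O w -> exists2 c, O c & (1 + lam * v) / (1 + lam * w) = 1 + lam * c.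
Proof.
move=> Ov Ow; have [b0 Ob Obv] := dunit_ball Ow.
exists ((v - w) / (1 + lam * w)); first by apply: (srM sO) => //; apply: (srB sO).
by field.
Qed.

Lemma dang0 x : dang x -> x != 0.
Proof.
case=> k [w [Ow ->]]; have [h _ _] := dunit_ball Ow.
by rewrite mulf_neq0 // expfz_neq0.
Qed.

Lemma dang_div x y : dang x -> dang y -> dang (x / y).
Proof.
case=> k [w [Ow ->]] [l [v [Ov ->]]]; have [c Oc e] := ball_div Ow Ov.
exists (k - l), c; split=> //; rewrite -e expfzDr // -invr_expz invfM; ring.
Qed.

Lemma dang_unit x : (dang x /\ O x /\ O x^-1) <-> exists2 w, O w & x = 1 + lam * w.
Proof.
split=> [[[k [w [Ow e]]] [Ox Ov]]|[w Ow ->]]; last first.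
  by have [h1 h2 h3] := dunit_ball Ow; split=> //; apply: dang_ball.
exists w => //; suff k0 : k = 0 by rewrite e k0 expr0z mul1r.
apply: dunit_pi; have ub := dunit_ball Ow; have b0 : 1 + lam * w != 0 by case: ub.
have -> : pi ^ k = x * (1 + lam * w)^-1 by rewrite e mulfK.
apply: dunitM; last exact: dunitV.
by split=> //; rewrite e mulf_neq0 // expfz_neq0.
Qed.

(** Otherwise p^2 divides 2, which is impossible for p = 2 and for p odd alike. *)
Lemma dangN1 : ~ dang (-1).
Proof.
move=> h; have [|w Ow e] := (dang_unit (-1)).1.
  split=> //; rewrite invrN invr1; split; apply: (srN sO); exact: (sr1 sO).
have e2 : 2%:R = - (p%:R * (p%:R * w)).
  apply/eqP; rewrite -addr_eq0 mulrA -expr2 -[_ ^+ 2]/lam.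
  have -> : 2%:R + lam * w = 1 + (1 + lam * w) by ring.
  by rewrite -e subrr.
have [v Ov ep] := dvr_p HO.
have [p2|p2] := eqVneq p 2%N.
  apply: (@n1pi (- (v * w))); first by apply: (srN sO); apply: (srM sO).
  apply: (mulfI p0); rewrite mulr1 -p2 in e2 *; rewrite {1}e2 {2}ep; ring.
have O2 : O 2%:R^-1.
  by apply: dunit_nat; rewrite prime_coprime // dvdn_prime2 // eq_sym.
apply: (@n1pi (- (v * p%:R * w * 2%:R^-1))).
  by apply: (srN sO); apply: (srM sO) => //; apply: (srM sO) => //; apply: (srM sO).
have n2 : 2%:R != 0 :> F by apply: char0.
apply: (mulIf n2); rewrite mul1r {1}e2 {1}ep; field.
by rewrite n2.
Qed.

Lemma dang_pi : dang pi.
Proof. by exists 1, 0; split; [apply: (sr0 sO) | rewrite mulr0 addr0 mulr1 expr1z]. Qed.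

(** Separation bounds the powers of pi that divide x. *)
Lemma dvr_decomp x : x != 0 -> exists k u, dunit u /\ x = pi ^ k * u.
Proof.
have aux y : y != 0 -> O y -> exists (n : nat) u, dunit u /\ y = pi ^+ n * u.
  move=> y0 Oy; pose P n := `[< ~ exists2 w, O w & y = pi ^+ n * w >].
  have exP : exists n, P n.
    apply: contrapT => h; case/eqP: y0; apply: (cr_sep CR) => k.
    by apply: contrapT => nk; apply: h; exists k; apply/asboolP.
  case: (ex_minnP exP) => -[|n] /asboolP nP nmin.
    by case: nP; exists y; rewrite ?expr0 ?mul1r.
  have [w Ow e] : exists2 w, O w & y = pi ^+ n * w.
    apply: contrapT => h; have /nmin : P n by apply/asboolP.
    by rewrite ltnn.
  exists n, w; split=> //; split=> //.
    by apply: contra_neq y0 => w0; rewrite e w0 mulr0.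
  case: (dvr_nunit HO Ow) => // -[z Oz ez]; case: nP; exists z => //.
  by rewrite e ez mulrA exprSr.
move=> x0; case: (dvrV HO x) => Ox.
  by have [n [u [Uu e]]] := aux _ x0 Ox; exists n%:Z, u.
have [|n [u [Uu e]]] := aux _ _ Ox; first by rewrite invr_eq0.
exists (- n%:Z), u^-1; split; first exact: dunitV.
by rewrite -[x]invrK e invfM -invr_expz.
Qed.

Lemma dang1 : dang 1.
Proof. by rewrite -[1]addr0 -(mulr0 lam); apply: dang_ball; apply: (sr0 sO). Qed.

Lemma dang_sign_transversal : exists cs : seq F, sign_transversal O dang cs.
Proof.
have [T [r rP]] := dvr_fin HO Olam lam_neq0.
have [||cs [csU csC csI]] := @finite_transversal F dunit (fun u v => dang (u / v) \/ dang (- (u / v))) T r.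
- move=> x y _ _ [] h; [left|right]; have := dang_div dang1 h; rewrite div1r ?invrN invf_div //.
- move=> x y [x0 Ox Oxv] [y0 Oy Oyv] e; left.
  have [w Ow e'] := rP _ _ Ox Oy e.
  have -> : x / y = 1 + lam * (w / y) by rewrite mulrA -e'; field.
  by apply: dang_ball; apply: (srM sO).
exists cs; split=> // x x0; have [k [u [Uu e]]] := dvr_decomp x0.
have [i i_s h] := csC _ Uu; exists i => //.
have pk : dang (pi ^ k) by exists k, 0; split; [apply: (sr0 sO) | rewrite mulr0 addr0 mulr1].
have mulG y z : dang y -> dang z -> dang (y * z).
  move=> hy hz; rewrite -[z]invrK; apply: dang_div => //; rewrite -div1r; apply: dang_div => //; exact: dang1.
case: h => h; [left|right]; rewrite e -mulrA.
  exact: mulG.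
by rewrite -mulrN; apply: mulG.
Qed.

Lemma expzX (q : int) n : (pi ^ q) ^+ n = pi ^ (q * n).
Proof. by rewrite exprnP exprz_exp. Qed.

(** A transversal is formed by the products pi^i w with i < n and w in a
    transversal of 1 + n radius O in the ball 1 + radius O, because the former is
    the group of the n-th powers of the latter. *)
Lemma dang_pow n : (0 < n)%N ->
  exists2 ss : seq F, (n %| size ss)%N & power_transversal dang n ss.
Proof.
move=> n0; have nF := char0 n0.
have [||T [r rP]] := @dvr_fin _ _ _ _ HO (n%:R * lam).
- by apply: (srM sO) => //; apply: (sr_nat CR).
- by rewrite mulf_neq0.
have [||ws [wsB wsC wsU]] := @finite_transversal F (fun x => exists2 w, O w & x = 1 + lam * w)
  (fun x y => exists2 c, O c & x / y = 1 + n%:R * lam * c) T r.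
- move=> x y _ _ [c Oc e].
  have nl : 1 + n%:R * lam * c = 1 + lam * (n%:R * c) by ring.
  have [|b0 Ob Obv] := @dunit_ball (n%:R * c); first by apply: (srM sO) => //; apply: (sr_nat CR).
  exists (- c / (1 + lam * (n%:R * c))); first by apply: (srM sO) => //; apply: (srN sO).
  by rewrite -invf_div e nl; field.
- move=> x y [v Ov ex] [w Ow ey] e.
  have [b0 Ob Obv] := dunit_ball Ow; rewrite -ey in b0 Ob Obv.
  have [x0 Ox Oxv] := dunit_ball Ov; rewrite -ex in x0 Ox Oxv.
  have [c Oc e'] := rP _ _ Ox Ob e.
  by exists (c / y); [apply: (srM sO) | rewrite mulrA -e'; field].
(* the index i n + r, with r < n, codes the pair of the i-th element of ws and pi^r *)
pose f j : F := pi ^+ (j %% n)%N * ws`_(j %/ n).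
have sz : size (mkseq f (size ws * n)) = (size ws * n)%N by rewrite size_mkseq.
have nE j : (j < size ws * n)%N -> (j %/ n < size ws)%N /\ (mkseq f (size ws * n))`_j = f j.
  by move=> h; rewrite nth_mkseq // ltn_divLR.
have wsO i : (i < size ws)%N -> dunit ws`_i by move=> /wsB [w Ow ->]; apply: dunit_ball.
exists (mkseq f (size ws * n)); rewrite ?sz; first exact: dvdn_mull.
rewrite /power_transversal sz; split.
- by move=> i /nE [/wsB [w Ow h] ->]; exists (i %% n)%N%:Z, w; rewrite -h.
- move=> x [k [w [Ow e]]].
  have [|i i_s [c Oc ec]] := wsC (1 + lam * w); first by exists w.
  have [v Ov ev] := ball_root n0 Oc.
  pose m := `|(k %% n%:Z)%Z|%N; pose q := (k %/ n%:Z)%Z.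
  have nZ : n%:Z != 0 by lia.
  have rk : m%:Z = (k %% n%:Z)%Z by rewrite /m gez0_abs // modz_ge0.
  have mn : (m < n)%N by rewrite -ltz_nat rk ltz_pmod //; lia.
  have ltx : (i * n + m < size ws * n)%N.
    apply: (@leq_trans (i.+1 * n)); last by rewrite leq_mul2r i_s orbT.
    by rewrite mulSn addnC ltn_add2r.
  exists (i * n + m)%N => //; exists (pi ^ q * (1 + lam * v)); first by exists q, v.
  have [_ ->] := nE _ ltx; rewrite /f divnMDl // divn_small // addn0 modnMDl modn_small //.
  have [wi0 _ _] := wsO _ i_s.
  have -> : ws`_i = (1 + lam * w) / (1 + lam * v) ^+ n.
    rewrite ev -ec; have [b0 _ _] := dunit_ball Ow; field; by rewrite b0 wi0.
  have [bv0 _ _] := dunit_ball Ov.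
  rewrite e exprMn expzX; set a := (1 + lam * v) ^+ n.
  have a0 : a != 0 by rewrite expf_neq0.
  have kE : k = m%:Z + q * n%:Z by rewrite rk addrC -divz_eq.
  by rewrite kE expfzDr // -exprnP; field.
- move=> i j y /nE [i_s ->] /nE [js ->] [k [v [Ov ey]]] e.
  have [a0 _ _] := wsO _ i_s; have [b0 _ _] := wsO _ js.
  have [d0 Od Odv] := dunitX n (dunit_ball Ov).
  have eU : pi ^ ((i %% n)%N%:Z - (j %% n)%N%:Z - k * n) =
      ws`_(j %/ n) * (1 + lam * v) ^+ n * (ws`_(i %/ n))^-1.
    move: e; rewrite /f ey exprMn expzX !expfzDr // -!invr_expz => e.
    have A0 := expf_neq0 (j %% n) pi_neq0; have B0 := expfz_neq0 (k * n) pi_neq0.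
    rewrite -!exprnP; apply: (mulIf a0); rewrite divfK //.
    apply: (mulIf B0); apply: (mulIf A0).
    transitivity (pi ^+ (i %% n) * ws`_(i %/ n)); last by rewrite e; ring.
    field; by rewrite A0 B0.
  have k0 : (i %% n)%N%:Z - (j %% n)%N%:Z - k * n = 0.
    apply: dunit_pi; rewrite eU; apply: dunitM; last exact/dunitV/wsO.
    by apply: dunitM; [apply: wsO | split].
  have ij' : (i %% n = j %% n)%N.
    have hi := ltn_pmod i n0; have hj := ltn_pmod j n0.
    have h : (i %% n)%N%:Z = (j %% n)%N%:Z + k * n by apply/eqP; rewrite -subr_eq0 opprD addrA k0.
    have := congr1 (fun x => (x %% n%:Z)%Z) h => /=; rewrite addrC modzMDl !modz_small; lia.
  have ij : (i %/ n = j %/ n)%N.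
    apply: (wsU _ _ i_s js); have [c Oc ec] := ball_pow n0 Ov; exists c => //.
    rewrite -ec; have e1 : ws`_(i %/ n) = ws`_(j %/ n) * (1 + lam * v) ^+ n.
      by have := congr1 (fun x => x * ws`_(i %/ n)) eU; rewrite k0 expr0z mul1r divfK.
    by rewrite e1 mulrC mulKf.
  by rewrite (divn_eq i n) (divn_eq j n) ij ij'.
Qed.

Lemma dang_tor n x : (0 < n)%N -> dang x -> x ^+ n = 1 -> x = 1.
Proof.
move=> n0 [k [w [Ow ->]]]; rewrite exprMn expzX => e.
have [b0 Ob Obv] := dunitX n (dunit_ball Ow).
have k0 : k * n = 0.
  apply: dunit_pi; rewrite -[pi ^ _](mulfK b0) e div1r.
  by split; rewrite ?invr_eq0 ?invrK.
move: e; rewrite k0 expr0z mul1r => e.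
have kz : k = 0 by move/eqP: k0; rewrite mulf_eq0 => /orP[/eqP //|]; lia.
rewrite kz expr0z mul1r (root_uniq CR char0 n0 pi_neq0 ball_radiusP lam_neq0 Ow e) mulr0 addr0 //.
Qed.

Lemma dvr_artin_schreier a : O a -> exists z, z ^+ 2 + z = pi * a.
Proof.
move=> Oa; have [w Ow e] := contraction CR (lip_exp CR 2) Oa.
by exists (pi * w); rewrite -e; ring.
Qed.

Lemma dvr_angular : inhabited (angular_field F).
Proof.
have [N N0 NP] := dunit_exp; have [cs csP] := dang_sign_transversal.
constructor.
exact: (AngularField char0 sO (dvrV HO) (cr_tau CR) (dvr_piV HO)
  (dvr_nunit HO) dvr_artin_schreier lam_neq0 N0 NP dang0 dang_div dang_pi
  dang_unit dangN1 csP dang_pow dang_tor).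
Qed.
End DvrAngular.

(** * The p-adic integers *)

Lemma mulf_cancel (F : fieldType) (a b c d : F) : b != 0 ->
  a * b * c * (b^-1 * d) = a * (c * d).
Proof. by move=> b0; field. Qed.

Section Padic.
Variables (p : nat) (p_pr : prime p).
Local Notation Zp := (padic_int p_pr).
Local Notation Qp := (padic p_pr).
Local Notation q n := ((p ^ n)%N%:Z).
Implicit Types x y z : Zp.

Let p0 : (0 < p)%N. Proof. exact: prime_gt0. Qed.
Let q0 n : q n != 0. Proof. by rewrite eqz_nat -lt0n expn_gt0 p0. Qed.

Lemma residueD x y n : (x + y) n = ((x n + y n) %% q n)%Z. Proof. by []. Qed.
Lemma residueN x n : (- x) n = ((- x n) %% q n)%Z. Proof. by []. Qed.
Lemma residueM x y n : (x * y) n = ((x n * y n) %% q n)%Z. Proof. by []. Qed.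
Lemma residue1 n : (1 : Zp) n = (1 %% q n)%Z. Proof. by []. Qed.
Lemma residue0 n : (0 : Zp) n = 0. Proof. exact: mod0z. Qed.

Lemma residueB x y n : (x - y) n = ((x n - y n) %% q n)%Z.
Proof. by rewrite residueD residueN modzDmr. Qed.

Lemma residue_nat m n : (m%:R : Zp) n = (m%:Z %% q n)%Z.
Proof.
elim: m => [|m IH]; first by rewrite residue0 mod0z.
by rewrite -addn1 natrD residueD IH residue1 modzDm.
Qed.

Lemma residue_ge0 x n : 0 <= x n.
Proof. by rewrite -residue_mod modz_ge0. Qed.
Lemma residue_lt x n : x n < q n.
Proof. by rewrite -residue_mod ltz_pmod // lt0r q0. Qed.

(** Divisibility by p^k is read on one residue: the n-th residue of the quotient is
    the integral quotient of the residue of index n + k. *)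
Lemma padic_divp k x : x k = 0 -> exists y, x = p%:R ^+ k * y.
Proof.
move=> xk; pose u n := (x (n + k)%N %/ q k)%Z.
have xE n : x (n + k)%N = u n * q k.
  have := residue_le x k n; rewrite xk mod0z => h.
  by rewrite {1}(divz_eq (x (n + k)%N) (q k)) h addr0.
have hu n : (u n = u n.+1 %[mod q n])%Z.
  apply/eqP; rewrite eqz_mod_dvd -(dvdz_mul2r (q0 k)).
  rewrite mulrBl -!xE -PoszM -expnD -eqz_mod_dvd addSn.
  exact/eqP/(residue_step x (n + k)).
exists (padic_int_of p_pr hu); apply: padic_int_ext => n.
rewrite -natrX residueM residue_nat /= modzMm mulrC -xE addnC.
by rewrite (residue_le x n k) residue_mod.
Qed.

(** Bezout inverses modulo p^n are unique, hence compatible. *)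
Lemma padic_unitP x : x 1%N != 0 -> exists y, y * x = 1.
Proof.
move=> x1.
have cop n : coprimez (x n) (q n).
  case: n => [|n]; first by rewrite expn0 coprimezE coprimen1.
  rewrite coprimezE coprime_sym absz_nat; apply: coprimeXl.
  rewrite prime_coprime //; apply/negP => h.
  have : (p%:Z %| x n.+1)%Z by rewrite dvdzE.
  move/dvdz_mod0P => e; have := residue_le x 1 n; rewrite addn1 residue_mod expn1 e => e'.
  by rewrite -e' eqxx in x1.
have bez n : exists u, (u * x n = 1 %[mod q n])%Z.
  have [[u v] /= e] := coprimezP _ _ (cop n); exists u.
  by rewrite -e addrC modzMDl.
have [u hu] := choice bez.
have hu' n : (u n = u n.+1 %[mod q n])%Z.
  have e1 : (u n.+1 * x n = 1 %[mod q n])%Z.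
    apply/eqP; rewrite -modzMmr residue_step modzMmr eqz_mod_dvd.
    apply: (@dvdz_trans (q n.+1)); first by rewrite expnS PoszM dvdz_mull.
    by rewrite -eqz_mod_dvd; apply/eqP/hu.
  have -> : (u n = u n * (u n.+1 * x n) %[mod q n])%Z.
    by rewrite -[RHS]modzMmr e1 modzMmr mulr1.
  have -> : u n * (u n.+1 * x n) = u n.+1 * (u n * x n) by ring.
  by rewrite -[LHS]modzMmr hu modzMmr mulr1.
exists (padic_int_of p_pr hu'); apply: padic_int_ext => n.
by rewrite residueM residue1 /= modzMml.
Qed.

Lemma padic_pX0 k y : (p%:R ^+ k * y : Zp) k = 0.
Proof.
by rewrite -natrX residueM residue_nat modzMml -modzMml modzz mul0r mod0z.
Qed.

Lemma padic_decomp x : x != 0 -> exists k y z, y * z = 1 /\ x = p%:R ^+ k * y.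
Proof.
move=> /residue_neq0 ex; case: (ex_minnP ex) => -[|k] xk kmin.
  by rewrite expn0 dvd1z in xk.
have xk0 : x k = 0.
  rewrite -residue_mod; apply/dvdz_mod0P/negPn/negP => /kmin; by rewrite ltnn.
have [y e] := padic_divp xk0.
have y1 : y 1%N != 0.
  apply/eqP => /padic_divp [w ew]; case/negP: xk; rewrite e ew expr1 mulrA -exprSr.
  by rewrite padic_pX0 dvdz0.
have [z ez] := padic_unitP y1; exists k, y, z; split=> //.
by rewrite mulrC.
Qed.

(** The limit is the diagonal: the n-th residue of the n-th term is stationary. *)
Lemma padic_lim (x : nat -> Zp) : (forall k, exists y, x k.+1 - x k = p%:R ^+ k * y) ->
  exists l, forall k, exists y, l - x k = p%:R ^+ k * y.
Proof.
move=> hx.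
have xS k : x k.+1 k = x k k.
  have [y e] := hx k; have : (x k.+1 - x k) k = 0 by rewrite e padic_pX0.
  rewrite residueB => /eqP; rewrite -[_ == _]/(_ == 0) => /eqP/dvdz_mod0P; rewrite -eqz_mod_dvd => /eqP.
  by rewrite !residue_mod.
have hu n : (x n n = x n.+1 n.+1 %[mod q n])%Z by rewrite -residue_step xS.
exists (padic_int_of p_pr hu) => k; apply: padic_divp.
by rewrite residueB /= residue_mod subrr mod0z.
Qed.

Local Notation tofrac := (@FracField.tofrac Zp).
Definition isZ (a : Qp) := exists x : Zp, a = tofrac x.

Lemma tofrac_nat n : tofrac n%:R = n%:R :> Qp.
Proof. exact: rmorph_nat. Qed.

Lemma tofrac_p k : tofrac (p%:R ^+ k) = p%:R ^+ k :> Qp.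
Proof. by rewrite tofracXn tofrac_nat. Qed.

Lemma frac_repr (a : Qp) : exists x y, y != 0 /\ a = tofrac x / tofrac y.
Proof.
elim/quotW: a => a; exists (frac a).1, (frac a).2; have d0 := denom_ratioP a; split=> //.
have d0' : tofrac (frac a).2 != 0 by rewrite tofrac_eq0.
apply: (mulIf d0'); rewrite divfK //.
unlock FracField.tofrac; rewrite -[LHS]FracField.pi_mul.
apply/eqmodP; rewrite /= FracField.equivfE /FracField.mulf.
by rewrite !numden_Ratio ?mulf_neq0 ?oner_neq0 // !mulr1 mulrC.
Qed.

Lemma Qp_char0 n : (0 < n)%N -> n%:R != 0 :> Qp.
Proof.
move=> n0; rewrite -tofrac_nat tofrac_eq0; apply/eqP => h.
have := congr1 (fun x : Zp => x n) h; rewrite residue_nat residue0 modz_small; last first.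
  by rewrite ltz_nat ltn_expl ?prime_gt1.
by move/eqP; rewrite eqz_nat => /eqP e; rewrite e in n0.
Qed.

Lemma Zp_eq_divp k x y : tofrac x = p%:R ^+ k * tofrac y -> x = p%:R ^+ k * y.
Proof. by move=> e; apply/eqP; rewrite -tofrac_eq tofracM tofrac_p e. Qed.

Lemma isZ_V (a : Qp) : isZ a \/ isZ a^-1.
Proof.
have [->|a0] := eqVneq a 0; first by left; exists 0; rewrite tofrac0.
have [x [y [y0 e]]] := frac_repr a.
have x0 : x != 0 by apply: contra_neq a0 => h; rewrite e h tofrac0 mul0r.
have [k [u [u' [uu ex]]]] := padic_decomp x0.
have [l [v [v' [vv ey]]]] := padic_decomp y0.
have inv w w' : w * w' = 1 -> (tofrac w)^-1 = tofrac w'.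
  move=> ww; have w0 : tofrac w != 0.
    by rewrite tofrac_eq0; apply: contra_eq_neq ww => ->; rewrite mul0r eq_sym oner_neq0.
  by apply: (mulfI w0); rewrite mulfV // -tofracM ww tofrac1.
have pX0 m : p%:R ^+ m != 0 :> Qp by rewrite expf_neq0 // Qp_char0.
have aux m n w w' z z' : (n <= m)%N -> w * w' = 1 -> z * z' = 1 ->
    isZ (tofrac (p%:R ^+ m * w) / tofrac (p%:R ^+ n * z)).
  move=> nm ww zz; exists (p%:R ^+ (m - n) * (w * z')).
  rewrite !tofracM !tofrac_p invfM (inv _ _ zz) -{1}(subnK nm) exprD.
  exact: mulf_cancel.
have [lk|kl] := leqP l k; [left|right]; rewrite e ?invf_div ex ey.
  exact: aux uu vv.
by apply: aux vv uu; apply: ltnW.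
Qed.

Lemma padic_dvr : dvr p isZ (p%:R : Qp).
Proof.
have pF : p%:R != 0 :> Qp by apply: Qp_char0.
split.
- exact: Qp_char0.
- split.
  + split; first by exists 1; rewrite tofrac1.
      by move=> _ _ [x ->] [y ->]; exists (x - y); rewrite tofracB.
    by move=> _ _ [x ->] [y ->]; exists (x * y); rewrite tofracM.
  + by exists p%:R; rewrite tofrac_nat.
  + move=> a ha; have [_ [z ->]] := ha 0%N; rewrite mul1r => e0.
    rewrite e0; apply/eqP; rewrite tofrac_eq0; apply/eqP; apply: padic_int_ext => k.
    have [_ [w ->]] := ha k; rewrite e0 => /Zp_eq_divp ->.
    by rewrite padic_pX0 residue0.
  move=> z hz dz; have [x hx] := choice hz.
  have [k|l hl] := @padic_lim x.
    have [_ [w ->]] := dz k; rewrite !hx -tofracB => /Zp_eq_divp e.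
    by exists w.
  exists (tofrac l); first by exists l.
  move=> k; have [w e] := hl k; exists (tofrac w); first by exists w.
  by rewrite hx -tofracB e tofracM tofrac_p.
- exact: isZ_V.
- case=> x e.
  have /(congr1 (fun z : Zp => z 1%N)) : p%:R ^+ 1 * x = 1 :> Zp.
    by apply/eqP; rewrite -tofrac_eq tofracM tofrac_p -e mulfV ?tofrac1.
  by rewrite padic_pX0 residue1 modz_small // expn1 ltz_nat prime_gt1.
- move=> _ [x ->]; have [x1|/padic_unitP [y e]] := eqVneq (x 1%N) 0.
    have [y ->] := padic_divp x1; right; exists (tofrac y); first by exists y.
    by rewrite tofracM tofrac_p.
  left; exists y; have x0 : tofrac x != 0.
    by rewrite tofrac_eq0; apply: contra_eq_neq e => ->; rewrite mulr0 eq_sym oner_neq0.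
  by apply: (mulIf x0); rewrite mulVf // -tofracM e tofrac1.
- by exists 1; [exists 1; rewrite tofrac1 | rewrite mulr1].
move=> _ [m ->]; rewrite tofrac_eq0 => /padic_decomp [k [u [u' [uu em]]]].
have hT (a : Qp) : exists t : 'I_((p ^ k)%N.-1.+1), forall x, a = tofrac x -> t%:Z = x k.
  have [[x ->]|na] := pselect (isZ a); last by exists ord0 => x ea; case: na; exists x.
  have lt : (absz (x k) < (p ^ k).-1.+1)%N.
    by rewrite prednK ?expn_gt0 ?p0 // -ltz_nat gez0_abs ?residue_ge0 // residue_lt.
  exists (Ordinal lt) => y /eqP; rewrite tofrac_eq => /eqP <- /=.
  by rewrite gez0_abs // residue_ge0.
have [r hr] := choice hT; exists _, r.
move=> _ _ [x ->] [y ->] e.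
have exy : x k = y k by rewrite -(hr _ x erefl) -(hr _ y erefl) e.
have [w ew] : exists w, x - y = p%:R ^+ k * w.
  by apply: padic_divp; rewrite residueB exy subrr mod0z.
exists (tofrac (u' * w)); first by exists (u' * w).
by rewrite -tofracB -tofracM ew em -mulrA [u * _]mulrA uu mul1r.
Qed.
End Padic.

(** * Finite extensions of complete discrete valuation rings *)

Section MaximalSubring.
Variables (L : fieldType) (P : L) (A0 : L -> Prop).
Hypotheses (sA0 : subring A0) (A0P : A0 P) (P0 : P != 0) (nA0 : ~ A0 P^-1).

Lemma maximal_subring : exists A : L -> Prop, [/\ subring A, (forall x, A0 x -> A x), ~ A P^-1 &
  forall B : L -> Prop, subring B -> (forall x, A x -> B x) -> ~ B P^-1 -> forall x, B x -> A x].
Proof.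
pose Q (A : set L) := A = set0 \/ [/\ subring A, (forall x, A0 x -> A x) & ~ A P^-1].
have [|A [QA Amax]] := @Zorn_bigcup L Q.
  move=> F FQ tot; have [[X FX [x Xx]]|nF] := pselect (exists2 X, F X & X !=set0); last first.
    left; apply/seteqP; split=> // x [X FX Xx]; case: nF; exists X => //; by exists x.
  have good Y y : F Y -> Y y -> [/\ subring Y, (forall x, A0 x -> Y x) & ~ Y P^-1].
    by move=> FY Yy; case: (FQ _ FY) => // Y0; move: Yy; rewrite Y0.
  right; split.
  - have two u v : (\bigcup_(Y in F) Y) u -> (\bigcup_(Y in F) Y) v ->
        exists Y, [/\ F Y, Y u, Y v & subring Y].
      move=> [Y FY Yu] [Z FZ Zv]; have [sY _ _] := good _ _ FY Yu; have [sZ _ _] := good _ _ FZ Zv.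
      by case: (tot _ _ FY FZ) => h; [exists Z | exists Y]; split=> //; apply: h.
    split.
    + by have [sX _ _] := good _ _ FX Xx; exists X => //; apply: sr1.
    + by move=> u v hu hv; have [Y [FY Yu Yv sY]] := two _ _ hu hv; exists Y => //; apply: srB.
    + by move=> u v hu hv; have [Y [FY Yu Yv sY]] := two _ _ hu hv; exists Y => //; apply: srM.
  - by move=> y hy; have [_ h _] := good _ _ FX Xx; exists X => //; apply: h.
  - by case=> Y FY YP; have [_ _ h] := good _ _ FY YP; apply: h.
have {}QA : [/\ subring A, (forall x, A0 x -> A x) & ~ A P^-1].
  case: QA => // A_0; case: (Amax A0); last by right.
  split; first by rewrite A_0; apply: sub0set.
  by rewrite A_0 => /(_ _ (sr1 sA0)).
case: QA => sA A0A nA; exists A; split=> // B sB AB nB x Bx.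
apply: contrapT => nAx; apply: (Amax B); last by right; split=> // y /A0A/AB.
by split=> // BA; apply/nAx/BA.
Qed.

Variable A : L -> Prop.
Hypotheses (sA : subring A) (AP : A P) (nA : ~ A P^-1).
Hypothesis Amax : forall B : L -> Prop,
  subring B -> (forall x, A x -> B x) -> ~ B P^-1 -> forall x, B x -> A x.

Let one_sub_neq0 a : A a -> 1 - P * a != 0.
Proof.
move=> Aa; apply/eqP => /eqP; rewrite subr_eq0 => /eqP e; apply: nA.
by rewrite -[_^-1]mulr1 e mulKf.
Qed.

(** Inverting s = 1 - P a cannot bring P^-1 into the ring, since the powers of s are
    again of the form 1 - P c. *)
Lemma one_sub_unit a : A a -> A (1 - P * a)^-1.
Proof.
move=> Aa; set s := 1 - P * a; have s0 : s != 0 by apply: one_sub_neq0.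
have As : A s by apply: srB => //; [apply: sr1 | apply: srM].
have sX k : exists2 c, A c & s ^+ k = 1 - P * c.
  elim: k => [|k [c Ac e]]; first by exists 0; [apply: sr0 | rewrite mulr0 subr0].
  exists (a + c - P * a * c); last by rewrite exprS e /s; ring.
  by apply: srB; [|apply: srD|apply: srM => //; apply: srM].
apply: (@Amax (fun y => exists k, A (s ^+ k * y))).
- split; first by exists 0%N; rewrite mul1r; apply: sr1.
  + move=> x y [k hx] [l hy]; exists (k + l)%N.
    have -> : s ^+ (k + l) * (x - y) = s ^+ l * (s ^+ k * x) - s ^+ k * (s ^+ l * y) by rewrite exprD; ring.
    by apply: srB => //; apply: srM => //; apply: srX.
  + move=> x y [k hx] [l hy]; exists (k + l)%N.
    have -> : s ^+ (k + l) * (x * y) = (s ^+ k * x) * (s ^+ l * y) by rewrite exprD; ring.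
    exact: srM.
- by move=> x Ax; exists 0%N; rewrite mul1r.
- case=> k h; have [c Ac e] := sX k; apply: nA.
  have -> : P^-1 = s ^+ k * P^-1 + c by rewrite e; field.
  exact: srD.
- by exists 1%N; rewrite expr1 mulfV //; apply: sr1.
Qed.

Let R x d := exists2 c : nat -> L, (forall i, A (c i)) & 1 = P * \sum_(i < d.+1) c i * x ^+ i.

Let R_mono x d e : (d <= e)%N -> R x d -> R x e.
Proof.
move=> /subnK <-; elim: (e - d)%N => // k IH /IH [c Ac e1].
exists (fun i => if i == (k + d).+1 then 0 else c i).
  by move=> i; case: eqP => // _; apply: sr0.
rewrite addSn big_ord_recr /= eqxx mul0r addr0 e1; congr (_ * _).
by apply: eq_bigr => i _; rewrite ltn_eqF // ltn_ord.
Qed.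

Let R_ex x : ~ A x -> exists d, R x d.
Proof.
move=> nx; apply: contrapT => nR; apply: nx.
pose B y := exists2 f : {poly L}, (forall i, A f`_i) & y = f.[x].
apply: (@Amax B).
- split.
  + by exists 1; rewrite ?hornerC // => i; rewrite coef1; case: eqP => _; [apply: sr1|apply: sr0].
  + move=> u v [f Af ->] [g Ag ->]; exists (f - g); rewrite ?hornerD ?hornerN // => i.
    by rewrite coefB; apply: srB.
  + move=> u v [f Af ->] [g Ag ->]; exists (f * g); rewrite ?hornerM // => i.
    by rewrite coefM; apply: sr_sum => // j _; apply: srM.
- move=> a Aa; exists a%:P; rewrite ?hornerC // => i; rewrite coefC.
  by case: eqP => _ //; apply: sr0.
- case=> f Af e; apply: nR; exists (size f).-1, (fun i => f`_i) => //.
  have fs : (0 < size f)%N.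
    rewrite lt0n size_poly_eq0; apply/eqP => f0; move/eqP: e.
    by rewrite f0 horner0 invr_eq0 (negbTE P0).
  by rewrite prednK // -horner_coef -e mulfV.
- exists 'X; last by rewrite hornerX.
  by move=> i; rewrite coefX; case: eqP => _; [apply: sr1|apply: sr0].
Qed.

Let R_step x d : x != 0 -> R x d.+1 -> R x^-1 d.+1 -> R x d.
Proof.
move=> x0 [a Aa ea] [b Ab eb].
have s0 := one_sub_neq0 (Ab 0%N); have As := one_sub_unit (Ab 0%N).
set s := 1 - P * b 0%N in s0 As.
have es : s = P * \sum_(j < d.+1) b j.+1 * x^-1 ^+ j.+1.
  rewrite /s {1}eb big_ord_recl /= expr0 mulr1 mulrDr addrC addrA addNr add0r.
  by congr (_ * _); apply: eq_bigr => i _; rewrite /bump /= add1n.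
have ex : x ^+ d.+1 = P * \sum_(j < d.+1) (b j.+1 / s) * x ^+ (d - j).
  have -> : x ^+ d.+1 = s * x ^+ d.+1 / s by rewrite mulrAC mulfV // mul1r.
  rewrite {1}es -!mulrA; congr (_ * _); rewrite big_distrl; apply: eq_bigr => j _ /=.
  have jd : (j <= d)%N by rewrite -ltnS.
  rewrite -[in x ^+ d.+1](subnK jd) -addnS exprD exprVn.
  have xj : x ^+ j.+1 != 0 by rewrite expf_neq0.
  by field; rewrite s0 xj.
exists (fun i => a i + P * a d.+1 * (b (d - i).+1 / s)).
  move=> i; apply: srD => //; apply: srM => //; first exact: srM.
  exact: srM.
rewrite {1}ea big_ord_recr /= ex; congr (_ * _).
under [RHS]eq_bigr => i _ do rewrite mulrDl.
rewrite big_split /=; congr (_ + _).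
rewrite (reindex_inj rev_ord_inj) /= mulrA !mulr_sumr; apply: eq_bigr => i _.
rewrite !subSS subKn; last by rewrite -ltnS.
by rewrite mulrA [a _ * P]mulrC.
Qed.

(** If neither x nor x^-1 were in A, both A[x] and A[x^-1] would contain P^-1, so 1
    would be P times a polynomial of degree d in x, and in x^-1. By [one_sub_unit]
    the relation in x^-1 expresses x^d as P times lower powers of x, which lowers
    the degree of the relation in x, and conversely. So d goes down to 0, where
    P^-1 is in A. *)
Lemma maximal_valuation x : A x \/ A x^-1.
Proof.
apply: contrapT => /not_orP [nx nxv].
have x0 : x != 0 by apply/eqP => h; apply: nx; rewrite h; apply: sr0.
have [d Rd] := R_ex nx; have [e Re] := R_ex nxv.
have {}Rd := R_mono (leq_maxl d e) Rd; have {}Re := R_mono (leq_maxr d e) Re.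
elim: (maxn d e) Rd Re => [|m IH] Rd Re.
  case: Rd => c Ac; rewrite big_ord_recl big_ord0 /= expr0 mulr1 addr0 => h.
  by apply: nA; rewrite -[_^-1]mulr1 h mulKf.
apply: IH; apply: R_step => //; first by rewrite invr_eq0.
by rewrite invrK.
Qed.
End MaximalSubring.

Section DvrTheory.
Variables (F : fieldType) (p : nat) (Z : F -> Prop) (pi : F).
Hypothesis HZ : dvr p Z pi.
Let sZ := cr_subring (dvr_cr HZ).

Lemma dvr_unif_neq0 : pi != 0.
Proof. by apply/eqP => h; apply: (dvr_piV HZ); rewrite h invr0; apply: sr0 sZ. Qed.
Let pi0 := dvr_unif_neq0.

Lemma dvr_bound a : exists k, Z (pi ^+ k * a).
Proof.
have [->|a0] := eqVneq a 0; first by exists 0%N; rewrite mulr0; apply: sr0 sZ.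
have [[k|k] [u [[_ Zu _] ->]]] := dvr_decomp HZ a0.
  exists 0%N; rewrite mul1r; apply: (srM sZ) => //; apply: (srX sZ).
  exact: cr_tau (dvr_cr HZ).
by exists k.+1; rewrite NegzE -invr_expz -exprnP mulVKf // expf_neq0.
Qed.

Lemma dvr_mulX k l a : (k <= l)%N -> Z (pi ^+ k * a) -> Z (pi ^+ l * a).
Proof.
move=> /subnK <- h; rewrite exprD -mulrA; apply: (srM sZ) => //.
by apply: (srX sZ); apply: cr_tau (dvr_cr HZ).
Qed.

(** If a is not in pi^-D Z, its value is less than -D. *)
Lemma dvr_inv D a : ~ Z (pi ^+ D * a) -> a != 0 /\ Z (a^-1 / pi ^+ D).
Proof.
move=> h; have a0 : a != 0 by apply/eqP => a0; apply: h; rewrite a0 mulr0; apply: sr0 sZ.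
split=> //; have [k [u [[_ Zu Zv] e]]] := dvr_decomp HZ a0.
have Zpi n : Z (pi ^+ n) by apply: (srX sZ); apply: cr_tau (dvr_cr HZ).
have e1 : pi ^+ D * a = pi ^ (D%:Z + k) * u by rewrite e mulrA expfzDr.
have -> : a^-1 / pi ^+ D = pi ^ (- (D%:Z + k)) * u^-1.
  by rewrite -invfM mulrC e1 invfM invr_expz.
move: h; rewrite e1; case: (D%:Z + k) => n h.
  by case: h; apply: (srM sZ) => //; apply: Zpi.
by rewrite NegzE opprK; apply: (srM sZ) => //; apply: Zpi.
Qed.

Lemma dvr_uniform_bound (I : finType) (f : I -> F) :
  exists K, forall i, Z (pi ^+ K * f i).
Proof.
have [k hk] := choice (fun i => dvr_bound (f i)).
exists (\max_i k i)%N => i; apply: dvr_mulX (hk i).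
exact: leq_bigmax.
Qed.

(** Completeness for sequences in F: subtracting the first term makes them
    integral. *)
Lemma dvr_lim (x : nat -> F) : (forall k, Z ((x k.+1 - x k) / pi ^+ k)) ->
  exists y, forall k, Z ((y - x k) / pi ^+ k).
Proof.
move=> hx; have Zpi n : Z (pi ^+ n) by apply: (srX sZ); apply: cr_tau (dvr_cr HZ).
have piX n : pi ^+ n != 0 by rewrite expf_neq0.
have Zx k : Z (x k - x 0%N).
  elim: k => [|k IH]; first by rewrite subrr; apply: sr0 sZ.
  have -> : x k.+1 - x 0%N = pi ^+ k * ((x k.+1 - x k) / pi ^+ k) + (x k - x 0%N).
    by rewrite mulrC divfK // addrA subrK.
  by apply: (srD sZ) => //; apply: (srM sZ).
have [k|l _ hl] := cr_lim (dvr_cr HZ) Zx.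
  by exists ((x k.+1 - x k) / pi ^+ k); rewrite // mulrC divfK // opprB addrA subrK.
exists (l + x 0%N) => k; have [w Zw e] := hl k.
have -> : l + x 0%N - x k = l - (x k - x 0%N) by ring.
by rewrite e mulrAC divff // mul1r.
Qed.
End DvrTheory.

Section Extension.
Variables (F : fieldType) (p : nat) (Z : F -> Prop) (pF : F) (L : fieldExtType F).
Hypothesis HZ : dvr p Z pF.
Local Notation P := (pF%:A : L).
Let sZ := cr_subring (dvr_cr HZ).
Let ZpF : Z pF := cr_tau (dvr_cr HZ).
Let pF0 : pF != 0 := dvr_unif_neq0 HZ.

Lemma alg_expr k : (pF ^+ k)%:A = P ^+ k.
Proof. by rewrite -!in_algE rmorphXn. Qed.

Lemma alg_unif_neq0 : P != 0.
Proof. by rewrite -in_algE fmorph_eq0. Qed.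
Let P0 := alg_unif_neq0.
Lemma alg_unifX_neq0 k : P ^+ k != 0. Proof. by rewrite expf_neq0 ?P0. Qed.
Let PX0 := alg_unifX_neq0.

(** The ring of integers of L is obtained as a subring that is maximal among those
    that contain Z but not P^-1. *)
Lemma ext_ring : exists O : L -> Prop, [/\ subring O, forall a, Z a -> O a%:A,
  ~ O P^-1 & forall x, O x \/ O x^-1].
Proof.
pose A0 (x : L) := exists2 a, Z a & x = a%:A.
have sA0 : subring A0.
  split; first by exists 1; [apply: sr1 | rewrite scale1r].
  - by move=> _ _ [a Za ->] [b Zb ->]; exists (a - b); [apply: srB | rewrite scalerBl].
  - by move=> _ _ [a Za ->] [b Zb ->]; exists (a * b); [apply: srM | rewrite -!in_algE rmorphM].
have A0P : A0 P by exists pF.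
have nA0 : ~ A0 P^-1.
  case=> a Za; rewrite -!in_algE -fmorphV => /fmorph_inj e.
  by apply: (dvr_piV HZ); rewrite e.
have [O [sO A0O nO Omax]] := maximal_subring sA0 nA0.
exists O; split=> //; first by move=> a Za; apply: A0O; exists a.
by apply: (maximal_valuation P0 sO _ nO Omax); apply: A0O.
Qed.

Variable O : L -> Prop.
Hypotheses (sO : subring O) (OZ : forall a, Z a -> O a%:A) (nO : ~ O P^-1)
  (OV : forall x, O x \/ O x^-1).

Let OP : O P. Proof. exact: OZ. Qed.
Let OX k : O (P ^+ k). Proof. exact: srX. Qed.
Let OsZ a x : Z a -> O x -> O (a *: x).
Proof. by move=> Za Ox; rewrite -mulr_algl; apply: srM => //; apply: OZ. Qed.

(** A valuation ring that contains Z is integrally closed. If y = P^K x were not in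
    O, then w = y^-1 would be, and the equation of x over F, with denominators at
    most P^K, would give 1 = w s with s in O. *)
Lemma ext_bound x : exists k, O (P ^+ k * x).
Proof.
have [->|x0] := eqVneq x 0; first by exists 0%N; rewrite mulr0; apply: sr0.
set f := minPoly 1%AS x.
have fA i : exists a : F, f`_i = a%:A.
  have /polyOverP/(_ i) := minPolyOver 1%AS x.
  by rewrite -/f => /vlineP.
have [a ha] := choice fA.
have sf : (1 < size f)%N by rewrite size_minPoly.
set m := (size f).-1; have fm : size f = m.+1 by rewrite /m prednK // ltnW.
have [K hK] := @dvr_uniform_bound _ _ _ _ HZ 'I_m (fun i => a i).
exists K; set y := P ^+ K * x; case: (OV y) => // Ow.
have y0 : y != 0 by rewrite mulf_neq0 ?PX0.
set w := y^-1 in Ow.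
have root_f : x ^+ m = - \sum_(i < m) f`_i * x ^+ i.
  have := minPolyxx 1%AS x; rewrite -/f /root horner_coef fm big_ord_recr /= => e.
  have lc : f`_m = 1 by have /monicP := monic_minPoly 1%AS x; rewrite -/f lead_coefE.
  by move: e; rewrite lc mul1r addrC => /eqP; rewrite addr_eq0 => /eqP.
have m0 : (0 < m)%N by rewrite -ltnS -fm.
have e1 : 1 = - (w * \sum_(i < m) (f`_i * P ^+ K) * (P ^+ (K * (m - i).-1) * w ^+ (m - i).-1)).
  have xm0 : x ^+ m != 0 by rewrite expf_neq0.
  apply: (mulIf xm0); rewrite mul1r {1}root_f mulNr; congr (- _).
  rewrite big_distrr big_distrl /=; apply: eq_bigr => i _.
  have im : (0 < m - i)%N by rewrite subn_gt0.
  have wP : P ^+ K * w = x^-1 by rewrite /w /y invfM mulrA mulfV ?PX0 // mul1r.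
  have -> : w * (f`_i * P ^+ K * (P ^+ (K * (m - i).-1) * w ^+ (m - i).-1)) * x ^+ m =
    f`_i * ((P ^+ K * w) * (P ^+ K * w) ^+ (m - i).-1) * x ^+ m.
    rewrite exprMn exprM; congr (_ * _).
    have reassoc (c1 c2 c3 c4 c5 : L) : c3 * (c1 * c2 * (c4 * c5)) = c1 * (c2 * c3 * (c4 * c5)) by ring.
    exact: reassoc.
  rewrite -exprS prednK // wP exprVn -mulrA; congr (_ * _).
  have im' : (i <= m)%N by rewrite ltnW.
  by rewrite -[in x ^+ m](subnKC im') exprD mulrCA mulVf ?mulr1 // expf_neq0.
have -> : y = - \sum_(i < m) (f`_i * P ^+ K) * (P ^+ (K * (m - i).-1) * w ^+ (m - i).-1).
  have w0 : w != 0 by rewrite invr_eq0.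
  by apply: (mulfI w0); rewrite /w mulVf // {1}e1 mulrN.
apply: srN => //; apply: sr_sum => // i _; apply: srM => //; last by apply: srM => //; apply: srX.
rewrite ha -alg_expr -!in_algE -rmorphM mulrC; apply: OZ; exact: hK.
Qed.

(** The valuation is archimedean: u^-1 is integral up to a power of P. *)
Lemma ext_sep u : (forall k, O (u / P ^+ k)) -> u = 0.
Proof.
move=> h; apply: contrapT => /eqP u0; have [k hk] := ext_bound u^-1.
apply: nO; have -> : P^-1 = P ^+ k * u^-1 * (u / P ^+ k.+1).
  by rewrite exprS; field; rewrite PX0 u0 P0.
exact: srM.
Qed.

Local Notation n := (\dim {:L}).
Local Notation b := (vbasis {:L}).

Lemma ext_basis : exists (e : 'I_n -> L) (co : L -> 'I_n -> F),
  [/\ forall i, O (e i), forall x, x = \sum_i co x i *: e i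
    & forall c, co (\sum_i c i *: e i) = c].
Proof.
have [k hk] := choice (fun i : 'I_n => ext_bound b`_i).
have p0 i : pF ^+ k i != 0 by rewrite expf_neq0.
have eE i : P ^+ k i * b`_i = pF ^+ k i *: b`_i by rewrite -alg_expr mulr_algl.
exists (fun i => P ^+ k i * b`_i), (fun x i => coord b i x / pF ^+ k i); split=> //.
  move=> x; rewrite {1}(coord_vbasis (memvf x)); apply: eq_bigr => i _.
  by rewrite eE scalerA divfK.
move=> c; apply/funext => i.
under [in LHS]eq_bigr => j _ do rewrite eE scalerA.
rewrite (coord_sum_free (fun j => c j * pF ^+ k j)) ?(basis_free (vbasisP _)) //.
by rewrite mulfK.
Qed.

Section Basis.
Variables (e : 'I_n -> L) (co : L -> 'I_n -> F).
Hypotheses (Oe : forall i, O (e i)) (coE : forall x, x = \sum_i co x i *: e i)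
  (coK : forall c, co (\sum_i c i *: e i) = c).

Let lc (c : 'I_n -> F) := \sum_i c i *: e i.
Let lcB c d : lc c - lc d = lc (fun i => c i - d i).
Proof. by rewrite /lc -sumrB; apply: eq_bigr => i _; rewrite scalerBl. Qed.
Let lcZ a c : a%:A * lc c = lc (fun i => a * c i).
Proof. by rewrite /lc mulr_sumr; apply: eq_bigr => i _; rewrite mulr_algl scalerA. Qed.
Let lcO c : (forall i, Z (c i)) -> O (lc c).
Proof. by move=> h; apply: sr_sum => // i _; apply: OsZ. Qed.

Let coB x y i : co (x - y) i = co x i - co y i.
Proof. by rewrite {1}(coE x) {1}(coE y) lcB coK. Qed.
Let coZ a x i : co (a%:A * x) i = a * co x i.
Proof. by rewrite {1}(coE x) lcZ coK. Qed.

Let pX0 k : pF ^+ k != 0. Proof. by rewrite expf_neq0. Qed.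
Let divPX x k : x / P ^+ k = (pF ^+ k)^-1%:A * x.
Proof. by rewrite mulrC -alg_expr -!in_algE fmorphV. Qed.

(** O is contained in a multiple of the lattice spanned by the basis e. By induction
    on the number j of coordinates: if the coordinate of index j is unbounded on
    O, scaling it to 1 gives elements of O with coordinate 1 that are divisible by
    higher and higher powers of P; by induction their other coordinates form
    Cauchy sequences, and the limit is a nonzero element that is divisible by all
    powers of P, against [ext_sep]. *)
Lemma ext_bounded_coord (j : nat) : (j <= n)%N -> exists C, forall c : 'I_n -> F,
  (forall i : 'I_n, (j <= i)%N -> c i = 0) -> O (lc c) -> forall i, Z (pF ^+ C * c i).
Proof.
elim: j => [|j IH] jn.
  by exists 0%N => c c0 _ i; rewrite c0 // mulr0; apply: sr0.
have [C hC] := IH (ltnW jn); pose jo := Ordinal jn.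
have [[D hD]|nD] := pselect (exists D, forall c : 'I_n -> F,
  (forall i : 'I_n, (j < i)%N -> c i = 0) -> O (lc c) -> Z (pF ^+ D * c jo)).
  exists (C + D)%N => c c0 Oc.
  pose c' i := if i == jo then 0 else pF ^+ D * c i.
  have h i : Z (pF ^+ C * c' i).
    apply: hC.
      move=> i' ji; rewrite /c'; case: eqP => // /eqP ij; rewrite c0 ?mulr0 //.
      by rewrite ltn_neqAle ji andbT; apply: contra ij => /eqP h; apply/eqP/val_inj.
    pose c2 i := if i == jo then pF ^+ D * c jo else 0.
    have -> : lc c' = P ^+ D * lc c - lc c2.
      rewrite -alg_expr lcZ lcB; apply: eq_bigr => i' _; rewrite /c' /c2.
      by case: eqP => [->|_]; rewrite ?subrr ?subr0.
    apply: srB => //; first exact: srM.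
    by apply: lcO => i'; rewrite /c2; case: eqP => _; [apply: hD | apply: sr0].
  move=> i; have [->|ij] := eqVneq i jo.
    by rewrite exprD -mulrA; apply: srM => //; [apply: srX => // | apply: hD].
  by have := h i; rewrite /c' (negbTE ij) mulrA exprD.
have ex D : exists c : 'I_n -> F, [/\ forall i : 'I_n, (j < i)%N -> c i = 0, c jo = 1 & O (lc c / P ^+ D)].
  apply: contrapT => h; apply: nD; exists D => c c0 Oc; apply: contrapT => nZ.
  have [cj0 Zi] := dvr_inv HZ nZ.
  apply: h; exists (fun i => (c jo)^-1 * c i); split; first by move=> i /c0 ->; rewrite mulr0.
    by rewrite mulVf.
  rewrite -lcZ divPX mulrA -!in_algE -rmorphM; apply: srM => //; apply: OZ.
  by rewrite mulrC.
have [u hu] := choice ex.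
pose v D := u (D + C)%N.
have dv D i : Z ((v D.+1 i - v D i) / pF ^+ D).
  have [u0 u1 Ou] := hu (D + C)%N; have [u0' u1' Ou'] := hu (D + C).+1.
  pose d i := (v D.+1 i - v D i) / pF ^+ (D + C).
  have : Z (pF ^+ C * d i).
    apply: hC => [i' ji|].
      rewrite /d /v addSn; have [->|ij] := eqVneq i' jo; first by rewrite u1 u1' subrr mul0r.
      have lt : (j < i')%N by rewrite ltn_neqAle ji andbT; apply: contra ij => /eqP h; apply/eqP/val_inj.
      by rewrite u0 // u0' // subrr mul0r.
    have -> : lc d = lc (u (D + C).+1) / P ^+ (D + C) - lc (u (D + C)%N) / P ^+ (D + C).
      by rewrite -mulrBl lcB divPX lcZ; apply: eq_bigr => i' _; rewrite /d /v addSn mulrC.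
    apply: srB => //; have -> : lc (u (D + C).+1) / P ^+ (D + C) = P * (lc (u (D + C).+1) / P ^+ (D + C).+1).
      by rewrite exprS; field; rewrite P0 PX0.
    exact: srM.
  rewrite /d exprD invfM mulrCA [_^-1 * _^-1]mulrC [pF ^+ C * _]mulrA mulfV // mul1r.
  by [].
(* the coordinate of index jo is constant, and its limit is chosen to be 1 *)
have lim i : exists y, (i = jo -> y = 1) /\ forall D, Z ((y - v D i) / pF ^+ D).
  have [->|ij] := eqVneq i jo.
    exists 1; split=> // D; have [_ h _] := hu (D + C)%N.
    by rewrite /v h subrr mul0r; apply: sr0.
  have [y hy] := dvr_lim HZ (fun D => dv D i).
  by exists y; split=> // /eqP; rewrite (negbTE ij).
have [l hl] := choice lim; have l1 : l jo = 1 by apply: (hl jo).1.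
have lz : lc l = 0.
  apply: ext_sep => D.
  have -> : lc l / P ^+ D = lc (fun i => (l i - v D i) / pF ^+ D) + P ^+ C * (lc (v D) / P ^+ (D + C)).
    have -> : lc (fun i => (l i - v D i) / pF ^+ D) = (lc l - lc (v D)) / P ^+ D.
      by rewrite lcB divPX lcZ; apply: eq_bigr => i _; rewrite mulrC.
    by rewrite exprD; field; rewrite !PX0.
  apply: srD => //; first by apply: lcO => i; apply: (hl i).2.
  by apply: srM => //; have [] := hu (D + C)%N.
have := congr1 (fun c => c jo) (coK l); rewrite -/(lc l) lz l1.
have -> : co 0 jo = 0 by rewrite -(subrr 0) coB subrr.
by move/esym/eqP; rewrite oner_eq0.
Qed.

Lemma ext_lattice : exists C, forall x, O x -> forall i, Z (pF ^+ C * co x i).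
Proof.
have [C hC] := ext_bounded_coord (leqnn n); exists C => x Ox; apply: hC; last by rewrite /lc -coE.
by move=> i; rewrite leqNgt ltn_ord.
Qed.
End Basis.
End Extension.

Section Nonunits.
Variables (L : fieldType) (O : L -> Prop).
Hypotheses (sO : subring O) (OV : forall x, O x \/ O x^-1).

Definition nonunit x := O x /\ ~ O x^-1.

Lemma nonunit_neq0 x : nonunit x -> x != 0.
Proof. by case=> Ox h; apply/eqP => x0; apply: h; rewrite x0 invr0; apply: sr0. Qed.

Lemma nonunitMl a x : O a -> a != 0 -> nonunit x -> nonunit (a * x).
Proof.
move=> Oa a0 [Ox h]; split; first exact: srM.
by move=> /(srM sO Oa); rewrite invfM mulrA mulfV // mul1r.
Qed.

Lemma nonunit_one_sub x : nonunit x -> O (1 - x)^-1.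
Proof.
move=> nx; have [Ox h] := nx; case: (OV (1 - x)) => // O1x.
have x0 := nonunit_neq0 nx.
have [e0|e0] := eqVneq (1 - x) 0; first by rewrite e0 invr0; apply: sr0.
(* whichever of x and 1 - x divides the other divides 1 *)
apply: contrapT => h'.
case: (OV (x / (1 - x))) => hd.
  apply: h'; have -> : (1 - x)^-1 = 1 + x / (1 - x) by field.
  by apply: srD => //; apply: sr1.
apply: h; have -> : x^-1 = 1 + (x / (1 - x))^-1 by rewrite invf_div; field.
by apply: srD => //; apply: sr1.
Qed.

Lemma not_div x y : x != 0 -> y != 0 -> ~ O (x / y) -> nonunit (y / x).
Proof.
move=> x0 y0 h; split; last by rewrite invf_div.
by case: (OV (x / y)) => //; rewrite invf_div.
Qed.

Variable P : L.
Hypotheses (nP : nonunit P).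
Variables (T : finType) (r : L -> T).
Hypothesis rP : forall x y, O x -> O y -> r x = r y -> O ((x - y) / P).

(** Otherwise there is a chain y_0 = P, y_1, y_2, ... of nonunits in which each term
    is a nonunit multiple of the next. For i < j the difference of y_i and y_j is
    y_j up to a unit, so it is not divisible by P, and the ring modulo P would be
    infinite. *)
Lemma uniformizer_exists : exists2 pi, nonunit pi & forall x, nonunit x -> O (x / pi).
Proof.
apply: contrapT => h; have P0 := nonunit_neq0 nP.
have step (y : {y | nonunit y}) : exists z : {z | nonunit z}, nonunit (sval y / sval z).
  case: y => y ny /=; apply: contrapT => hy; apply: h; exists y => // x nx.
  apply: contrapT => nO; apply: hy; exists (exist _ x nx) => /=.
  by apply: not_div nO; apply: nonunit_neq0.
have [s hs] := choice step.
pose Y k := iter k s (exist _ P nP); pose y k := sval (Y k).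
have ny k : nonunit (y k) by rewrite /y; case: (Y k).
have y0 k : y k != 0 by apply: nonunit_neq0.
have dy k m : nonunit (y k / y (k + m.+1)%N).
  elim: m => [|m IH]; first by rewrite addn1; apply: hs.
  have -> : y k / y (k + m.+2)%N = y k / y (k + m.+1)%N * (y (k + m.+1)%N / y (k + m.+2)%N).
    by rewrite mulrA divfK.
  apply: nonunitMl; [by case: IH | exact: nonunit_neq0 | rewrite [(k + m.+2)%N]addnS; exact: hs].
have [i [j [ij _ e]]] := pigeonhole (fun k => r (y k)).
have jE : j = (i + (j - i).-1.+1)%N by rewrite prednK ?subn_gt0 // subnKC // ltnW.
have nij : nonunit (y i / y j) by rewrite jE.
have := rP (ny i).1 (ny j).1 e.
have uv := nonunit_one_sub nij.
have ne : 1 - y i / y j != 0.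
  apply/eqP => /eqP; rewrite subr_eq0 => /eqP e1; case: nij => _; apply.
  by rewrite -e1 invr1; apply: sr1.
move=> /(srM sO uv) h1.
have n0j : nonunit (P / y j).
  have -> : j = (0 + j.-1.+1)%N by rewrite add0n prednK //; apply: leq_ltn_trans ij.
  exact: (dy 0%N).
case: n0j => _; apply; rewrite invf_div.
have -> : y j / P = - ((1 - y i / y j)^-1 * ((y i - y j) / P)).
  have ne' : y j - y i != 0.
    by apply: contra_neq ne => h2; rewrite -[1](mulfV (y0 j)) -mulrBl h2 mul0r.
  by field; rewrite P0 y0 ne'.
exact: srN.
Qed.

(** Two powers of pi agree modulo P, and their difference is the smaller power up
    to a unit. *)
Lemma uniformizer_pow pi : nonunit pi -> exists2 e, (0 < e)%N & O (pi ^+ e / P).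
Proof.
move=> npi; have pi0 := nonunit_neq0 npi; have P0 := nonunit_neq0 nP.
have Opi : O pi by case: npi.
have [i [j [ij _ e]]] := pigeonhole (fun k => r (pi ^+ k)).
have := rP (srX sO i Opi) (srX sO j Opi) e.
have nd : nonunit (pi ^+ (j - i)).
  have -> : (j - i = (j - i).-1.+1)%N by rewrite prednK // subn_gt0.
  by rewrite exprSr; apply: nonunitMl; rewrite ?expf_neq0 //; apply: srX.
have uv := nonunit_one_sub nd.
have ne : 1 - pi ^+ (j - i) != 0.
  apply/eqP => /eqP; rewrite subr_eq0 => /eqP e1; case: nd => _; apply.
  by rewrite -e1 invr1; apply: sr1.
have -> : pi ^+ i - pi ^+ j = pi ^+ i * (1 - pi ^+ (j - i)).
  by rewrite mulrBr mulr1 -exprD subnKC // ltnW.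
move=> /(srM sO uv) h1; have h2 : O (pi ^+ i / P).
  have -> : pi ^+ i / P =
      (1 - pi ^+ (j - i))^-1 * (pi ^+ i * (1 - pi ^+ (j - i)) / P).
    by field; rewrite P0 ne.
  exact: h1.
exists i => //; case: i h2 {ij e nd uv ne h1} => //; rewrite expr0 div1r.
by case: nP.
Qed.
End Nonunits.

Section ExtensionDvr.
Variables (F : fieldType) (p : nat) (Z : F -> Prop) (pF : F) (L : fieldExtType F).
Hypothesis HZ : dvr p Z pF.
Local Notation P := (pF%:A : L).

(** By [ext_lattice], the ring O is pinched between two lattices, which gives
    finiteness modulo P^k, and from it a uniformizer pi some power of which P
    divides, as well as convergence, coordinate by coordinate. *)
Lemma extension_dvr : exists O pi, dvr (F := L) p O pi.
Proof.
have sZ := cr_subring (dvr_cr HZ).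
have pF0 := dvr_unif_neq0 HZ.
have [O [sO OZ nOP OV]] := ext_ring L HZ.
have [e [co [Oe coE coK]]] := ext_basis HZ sO OZ OV.
have [C hC] := ext_lattice HZ sO OZ nOP OV Oe coE coK.
have PX0 k : P ^+ k != 0 by apply: (alg_unifX_neq0 L HZ).
have P0 : P != 0 by apply: (alg_unif_neq0 L HZ).
have pX0 k : pF ^+ k != 0 by rewrite expf_neq0.
have OP : O P by apply: OZ; apply: cr_tau (dvr_cr HZ).
have nP : nonunit O P by split.
have coB x y i : co (x - y) i = co x i - co y i.
  rewrite {1}(coE x) {1}(coE y) -sumrB.
  under eq_bigr => j _ do rewrite -scalerBl.
  by rewrite coK.
have coZ a x i : co (a *: x) i = a * co x i.
  rewrite {1}(coE x) scaler_sumr.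
  under eq_bigr => j _ do rewrite scalerA.
  by rewrite coK.
have divPX x k : x / P ^+ k = (pF ^+ k)^-1 *: x.
  by rewrite mulrC -[RHS]mulr_algl -(alg_expr pF L) -!in_algE fmorphV.
have fromco x k : (forall i, Z (co x i / pF ^+ k)) -> O (x / P ^+ k).
  move=> h; rewrite divPX (coE (_ *: x)); apply: sr_sum => // i _.
  by rewrite -mulr_algl; apply: srM => //; apply: OZ; rewrite coZ mulrC.
have fin k : exists (T : finType) (r : L -> T), forall x y, O x -> O y -> r x = r y -> O ((x - y) / P ^+ k).
  have ZX : Z (pF ^+ (C + k)) by apply: (srX sZ); apply: cr_tau (dvr_cr HZ).
  have [T0 [r0 hr]] := dvr_fin HZ ZX (pX0 (C + k)%N).
  exists {ffun 'I_(\dim {:L}) -> T0}, (fun x => [ffun i => r0 (pF ^+ C * co x i)]).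
  move=> x y Ox Oy /ffunP h; apply: fromco => i.
  have := h i; rewrite !ffunE => /(hr _ _ (hC _ Ox i) (hC _ Oy i)) [w Zw].
  rewrite -mulrBr exprD -mulrA => /(mulfI (pX0 C)); rewrite coB => ->.
  by rewrite mulrAC divff // mul1r.
have [T [r rP]] := fin 1%N.
have rP1 x y : O x -> O y -> r x = r y -> O ((x - y) / P).
  by move=> Ox Oy /(rP _ _ Ox Oy); rewrite expr1.
have [pi npi hpi] := uniformizer_exists sO OV nP rP1.
have [ee e0 hee] := uniformizer_pow sO OV nP rP1 npi.
have pi0 := nonunit_neq0 sO npi; have Opi : O pi by case: npi.
have piX0 k : pi ^+ k != 0 by rewrite expf_neq0.
have divX a x y k : a != 0 -> O (a / y) -> O (x / a ^+ k) -> y != 0 -> O (x / y ^+ k).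
  move=> a0 h1 h2 y0; have -> : x / y ^+ k = (a / y) ^+ k * (x / a ^+ k).
    by rewrite expr_div_n [RHS]mulrC mulrA divfK // expf_neq0.
  by apply: srM => //; apply: srX.
exists O, pi; split.
- by move=> k k0; rewrite -scaler_nat -in_algE fmorph_eq0; apply: (dvr_char0 HZ).
- split.
  + exact: sO.
  + exact: Opi.
  + move=> x hx; apply: (ext_sep HZ sO OZ nOP OV) => k.
    have [w Ow ->] := hx (ee * k)%N; apply: (@divX (pi ^+ ee)) => //.
    by rewrite exprM mulrC mulKf // expf_neq0.
  move=> z Oz dz.
  have tele m k : O ((z (k + m)%N - z k) / pi ^+ k).
    elim: m => [|m IH]; first by rewrite addn0 subrr mul0r; apply: sr0.
    have [w Ow ew] := dz (k + m)%N.
    have -> : (z (k + m.+1)%N - z k) / pi ^+ k = pi ^+ m * w + (z (k + m)%N - z k) / pi ^+ k.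
      rewrite addnS -[z (k + m).+1](subrK (z (k + m)%N)) ew exprD -addrA mulrDl.
      by congr (_ + _); rewrite -[X in X / _]mulrA mulrAC divff ?mul1r.
    by apply: srD => //; apply: srM => //; apply: srX.
  (* consecutive terms of this subsequence agree modulo P^(D + C), so that their
     coordinates agree modulo the D-th power of the uniformizer of Z *)
  pose y D := z (ee * (D + C))%N.
  have dy i D : Z ((co (y D.+1) i - co (y D) i) / pF ^+ D).
    have h : O ((y D.+1 - y D) / P ^+ (D + C)).
      apply: (@divX (pi ^+ ee)) => //; rewrite -exprM /y addSn mulnS addnC.
      exact: tele.
    have := hC _ h i; rewrite divPX coZ coB exprD; congr Z.
    by field; rewrite !pX0.
  have [l hl] := choice (fun i => dvr_lim HZ (dy i)).
  pose x := \sum_i l i *: e i.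
  have hx D : O ((x - y D) / P ^+ D) by apply: fromco => i; rewrite coB coK.
  have hxz k : O ((x - z k) / pi ^+ k).
    have -> : (x - z k) / pi ^+ k = (x - y k) / pi ^+ k + (y k - z k) / pi ^+ k.
      by rewrite -mulrDl addrA subrK.
    apply: srD => //; first by apply: divX (hpi _ nP) (hx k) pi0.
    rewrite /y; have -> : (ee * (k + C) = k + (ee * (k + C) - k))%N.
      by rewrite subnKC // (leq_trans (leq_addr C k)) // leq_pmull.
    exact: tele.
  exists x; last by move=> k; exists ((x - z k) / pi ^+ k); rewrite // mulrC divfK.
  by have := srD sO (hxz 0%N) (Oz 0%N); rewrite expr0 divr1 subrK.
- exact: OV.
- by case: npi.
- move=> x Ox; have [h|h] := pselect (O x^-1); [by left|right].
  by exists (x / pi); [apply: hpi | rewrite mulrC divfK].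
- have [w Zw e1] := dvr_p HZ; exists (P / pi * w%:A).
    by apply: srM => //; [apply: hpi | apply: OZ].
  by rewrite mulrA [pi * _]mulrC divfK // -scaler_nat e1 -!in_algE rmorphM.
- move=> mu Omu mu0; have [k hk] := ext_bound HZ sO OZ OV mu^-1.
  have [T' [r' hr']] := fin k; exists T', r' => x y Ox Oy /(hr' _ _ Ox Oy) h.
  exists (P ^+ k * mu^-1 * ((x - y) / P ^+ k)); first exact: srM.
  have cancel_both (a b c : L) : a != 0 -> b != 0 -> c = a * (b * a^-1 * (c / b)).
    by move=> a0 b0; field; rewrite a0 b0.
  exact: cancel_both.
Qed.
End ExtensionDvr.

(** * Iterated Laurent series over finite extensions of the p-adic numbers *)

Theorem theorem3p1p1 (p : nat) (p_pr : prime p)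
    (L : fieldExtType (padic p_pr)) (n : nat) :
  let K := iterated_laurent L n in
  (forall x : K0 K, x = 0) /\
  definable_bijection [set: 1.-tuple K] [set x : 1.-tuple K | tnth x ord0 != 0].
Proof.
move=> K.
have [D] : inhabited (angular_field K).
  rewrite /K {K}; elim: n => [|n [D]] /=; last by constructor; apply: laurent_angular.
  have [O [pi HO]] := extension_dvr L (padic_dvr p_pr).
  exact: (dvr_angular p_pr HO).
have bij := angular_line_bijection D.
by split=> //; apply: K0_trivial.
Qed.
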